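(* Let $n,\alpha\in\mathbb{Z}_{\ge 1}$ be such that $4n\equiv 1\pmod{5^{\alpha}}$. Then $d_5(n)\equiv 0\pmod{5^{\lfloor\alpha/2\rfloor+1}}$.
   Context: Notation: $(a;q)_{\infty}:=\prod_{j=0}^{\infty}(1-aq^j)$. For an integer $k\ge 0$ the integers $d_k(n)$, $n\ge 0$ (the number of $k$-elongated plane partitions of $n$), are defined by the generating function $$\sum_{n=0}^{\infty}d_k(n)q^n=\frac{(q^2;q^2)_{\infty}^{k}}{(q;q)_{\infty}^{3k+1}},\qquad |q|<1.$$ *)

(* Defs.v *)
From Stdlib Require Import Reals ZArith.
From Coquelicot Require Import Coquelicot.
Open Scope R_scope.

(* (a; q)_infinity; [prod_f_R0 f N] is the product of f 0, ..., f N. The limit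
   exists and is finite for |q| < 1. *)
Definition qpoch (a q : R) : R :=
  real (Lim_seq (fun N : nat => prod_f_R0 (fun j : nat => 1 - a * q ^ j) N)).

(* The generating function, required to converge to the quotient at every real
   q with |q| < 1; this determines all the integers d k n uniquely. *)
Definition elongated_plane_partitions (d : nat -> nat -> Z) : Prop :=
  forall (k : nat) (q : R), Rabs q < 1 ->
    is_series (fun n : nat => IZR (d k n) * q ^ n)
      (qpoch (q ^ 2) (q ^ 2) ^ k / qpoch q q ^ (3 * k + 1)).

(* Main.v *)
(* Write U for the operator sum a_n q^n |-> sum a_(5n) q^n, phi for the theta series phi(-q) and psi
   for psi(q). By the Jacobi triple product the generating function d of d_5 equals
   phi^(-9) psi^(-2), so with mu = phi(-q^5) / phi(-q) and mu^2 = 1 + 4 xi one gets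
   q d(q) / d(q^5) = mu^9 xi / (1 + 5 xi). Hence iterating f |-> U(q f) on d produces
   d times a power series in xi (and a factor mu at odd steps), and the coefficients to be studied
   are those of T^alpha(1), T f = U(mu^9 xi / (1 + 5 xi) f).

   The 5-dissection phi(-q) = phi(-q^25) + a + b, together with the lattice identity
   phi(-q^5)^2 = phi(-q^25)^2 + a b, its analogue for psi and the product a b c d of the four
   components, determines a^5 + b^5, hence a modular equation of degree 5 for mu and for xi. It gives
   a recurrence for U(xi^i) and U(mu xi^i), from which the matrices of T in powers of xi satisfy
   5-adic bounds growing with the column index. On the lattice of series whose xi^j-coefficient is
   divisible by 5^((5j-16)/6), the step from even to odd alpha loses nothing, and lands in a smaller
   lattice on which the coefficients of xi and xi^2 cancel modulo 5, so that the step from odd to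
   even alpha gains a factor 5. *)
Require Import Defs.
From Stdlib Require Import Reals ZArith Lra Lia List Permutation.
From Stdlib Require Import FunctionalExtensionality Classical.
From Coquelicot Require Import Coquelicot.
Import ListNotations.
Local Open Scope Z_scope.
Ltac Zify.zify_post_hook ::= Z.to_euclidean_division_equations.

(** * Formal power series *)

(** The 5-adic bounds alone give no gain; it comes from the multipliers modulo 5. There (1 + 4 xi)^4
    becomes 1 + xi + ... + xi^4, so that the even step adds up five consecutive series V5(xi^j), and
    (1 + 4 xi)^5 becomes 1 - xi^5, so that the odd step on xi - xi^2 is governed by U5(xi^2) and
    U5(xi^3), which agree modulo 5. Both use that xi^5 is xi(q^5) modulo 5, whence the rows of the
    matrices repeat with period 5 up to a shift. The +1 in the exponent is a separate fact:
    T_even(1) is divisible by 5, and this step has to be examined modulo 25.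

    No theory of modular forms is available to supply the modular equation, so it is found by
    elimination. The relation that links phi and psi at levels 5 and 25 involves series in q^5 only;
    it can be lowered to levels 1 and 5 and then dissected once more. Its residue classes modulo 5
    are the additional equations that determine a^5 + b^5. *)

Fixpoint lsum {A : Type} (f : A -> Z) (l : list A) : Z :=
  match l with nil => 0 | a :: l' => f a + lsum f l' end.

Lemma lsum_app {A} (f : A -> Z) l1 l2 : lsum f (l1 ++ l2) = lsum f l1 + lsum f l2.
Proof. induction l1; simpl; lia. Qed.

Lemma lsum_ext {A} (f g : A -> Z) l :
  (forall a, In a l -> f a = g a) -> lsum f l = lsum g l.
Proof.
  induction l; simpl; intros H; [reflexivity|].
  rewrite (H a), IHl; auto.
Qed.

Lemma lsum_zero {A} (f : A -> Z) l : (forall a, In a l -> f a = 0) -> lsum f l = 0.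
Proof.
  induction l; simpl; intros H; [reflexivity|].
  rewrite (H a), IHl; auto.
Qed.

Lemma lsum_add {A} (f g : A -> Z) l : lsum (fun a => f a + g a) l = lsum f l + lsum g l.
Proof. induction l; simpl; lia. Qed.

Lemma lsum_scal {A} (c : Z) (f : A -> Z) l : lsum (fun a => c * f a) l = c * lsum f l.
Proof. induction l; simpl; lia. Qed.

Lemma lsum_swap {A B} (f : A -> B -> Z) l1 l2 :
  lsum (fun a => lsum (f a) l2) l1 = lsum (fun b => lsum (fun a => f a b) l1) l2.
Proof.
  induction l1; simpl.
  - symmetry; apply lsum_zero; auto.
  - rewrite IHl1, <- lsum_add. reflexivity.
Qed.

Lemma lsum_map {A B} (g : A -> B) (f : B -> Z) l : lsum f (map g l) = lsum (fun a => f (g a)) l.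
Proof. induction l; simpl; congruence. Qed.

Lemma lsum_perm {A} (f : A -> Z) l1 l2 : Permutation l1 l2 -> lsum f l1 = lsum f l2.
Proof. induction 1; simpl; lia. Qed.

Lemma lsum_filter {A} (p : A -> bool) (f : A -> Z) l :
  lsum f (filter p l) = lsum (fun a => if p a then f a else 0) l.
Proof. induction l; simpl; [reflexivity|]. destruct (p a); simpl; lia. Qed.

Lemma lsum_prod {A B} (f : A * B -> Z) l1 l2 :
  lsum f (list_prod l1 l2) = lsum (fun a => lsum (fun b => f (a, b)) l2) l1.
Proof.
  induction l1; simpl; [reflexivity|].
  rewrite lsum_app, IHl1, lsum_map. reflexivity.
Qed.

(** Only the non-zero terms have to correspond, because the zero terms are filtered out before the
    two lists are compared up to permutation. Hence the finite boxes that truncate theta series need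
    not be matched by the change of variables. *)
Lemma lsum_reindex {A B} (g : A -> B) (f1 : A -> Z) (f2 : B -> Z) l1 l2 :
  NoDup l1 -> NoDup l2 ->
  (forall a a', In a l1 -> In a' l1 -> f1 a <> 0 -> f1 a' <> 0 -> g a = g a' -> a = a') ->
  (forall a, In a l1 -> f1 a <> 0 -> In (g a) l2 /\ f2 (g a) = f1 a) ->
  (forall b, In b l2 -> f2 b <> 0 -> exists a, In a l1 /\ f1 a <> 0 /\ g a = b) ->
  lsum f1 l1 = lsum f2 l2.
Proof.
  intros N1 N2 Hinj Hto Hon.
  pose (nz := fun z => negb (z =? 0)).
  assert (R : forall (C : Type) (f : C -> Z) l, lsum f l = lsum f (filter (fun c => nz (f c)) l)).
  { intros C f l. rewrite lsum_filter. apply lsum_ext. intros c _. unfold nz.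
    destruct (Z.eqb_spec (f c) 0); simpl; auto. }
  rewrite (R _ f1 l1), (R _ f2 l2).
  assert (F : forall (C : Type) (f : C -> Z) l c,
    In c (filter (fun c => nz (f c)) l) <-> In c l /\ f c <> 0).
  { intros C f l c. rewrite filter_In. unfold nz.
    destruct (Z.eqb_spec (f c) 0); simpl; intuition congruence. }
  transitivity (lsum f2 (map g (filter (fun c => nz (f1 c)) l1))).
  - rewrite lsum_map. apply lsum_ext. intros a Ha. apply F in Ha. symmetry. apply Hto; tauto.
  - apply lsum_perm, NoDup_Permutation.
    + apply NoDup_map_NoDup_ForallPairs.
      * intros a a' Ha Ha' E. apply F in Ha, Ha'. apply Hinj; tauto.
      * now apply NoDup_filter.
    + now apply NoDup_filter.
    + intros b. rewrite in_map_iff, F. split.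
      * intros (a & <- & Ha). apply F in Ha as [H1 H2]. destruct (Hto a H1 H2).
        split; [assumption|]. congruence.
      * intros [Hb Hn]. destruct (Hon b Hb Hn) as (a & H1 & H2 & H3).
        exists a. rewrite F. auto.
Qed.

Definition ps := nat -> Z.

Definition padd (f g : ps) : ps := fun n => f n + g n.
Definition popp (f : ps) : ps := fun n => - f n.
Definition psub (f g : ps) : ps := fun n => f n - g n.
Definition pmul (f g : ps) : ps :=
  fun n => lsum (fun i => f i * g (n - i)%nat) (seq 0 (S n)).
Definition cst (z : Z) : ps := fun n => if Nat.eqb n 0 then z else 0.

Lemma lsum_seq_S (f : nat -> Z) n : lsum f (seq 0 (S n)) = lsum f (seq 0 n) + f n.
Proof. rewrite seq_S, lsum_app. simpl. lia. Qed.

Lemma lsum_seq_single (f : nat -> Z) n k :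
  (k < n)%nat -> (forall i, (i < n)%nat -> i <> k -> f i = 0) -> lsum f (seq 0 n) = f k.
Proof.
  intros Hk H. induction n; [lia|].
  rewrite lsum_seq_S. destruct (Nat.eq_dec k n) as [->|E].
  - rewrite lsum_zero; [lia|]. intros i Hi. apply in_seq in Hi. apply H; lia.
  - rewrite IHn; [rewrite (H n); lia|lia|]. intros; apply H; lia.
Qed.

Lemma lsum_seq_rev (f : nat -> Z) n :
  lsum f (seq 0 (S n)) = lsum (fun i => f (n - i)%nat) (seq 0 (S n)).
Proof.
  apply (lsum_reindex (fun i => (n - i)%nat)); try apply seq_NoDup.
  - intros a a' Ha Ha'. apply in_seq in Ha, Ha'. lia.
  - intros a Ha Hn. rewrite in_seq in *. split; [lia|].
    f_equal. lia.
  - intros b Hb Hn. apply in_seq in Hb. exists (n - b)%nat.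
    rewrite in_seq. replace (n - (n - b))%nat with b by lia. repeat split; auto; lia.
Qed.

Lemma pmul_comm f g : pmul f g = pmul g f.
Proof.
  extensionality n. unfold pmul. rewrite lsum_seq_rev. apply lsum_ext.
  intros i Hi. apply in_seq in Hi. replace (n - (n - i))%nat with i by lia. ring.
Qed.

(** The bound m is kept apart from n so that the induction on m leaves the third index n - i - j
    alone. *)
Lemma lsum_triangle (F : nat -> nat -> nat -> Z) (n m : nat) :
  (m <= n)%nat ->
  lsum (fun i => lsum (fun j => F i j (n - i - j)%nat) (seq 0 (S (m - i)))) (seq 0 (S m)) =
  lsum (fun k => lsum (fun i => F i (k - i)%nat (n - k)%nat) (seq 0 (S k))) (seq 0 (S m)).
Proof.
  induction m; intros Hm.
  - simpl. now rewrite !Nat.sub_0_r.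
  - rewrite lsum_seq_S, (lsum_seq_S _ (S m)), <- IHm by lia.
    rewrite (lsum_seq_S _ (S m)).
    replace (S m - S m)%nat with 0%nat by lia.
    rewrite (lsum_ext _ (fun i => lsum (fun j => F i j (n - i - j)%nat) (seq 0 (S (m - i))) +
      F i (S m - i)%nat (n - S m)%nat)).
    + rewrite lsum_add. simpl (seq 0 1). simpl (lsum _ [_]).
      rewrite !Z.add_0_r, Nat.sub_0_r. lia.
    + intros i Hi. apply in_seq in Hi. replace (S m - i)%nat with (S (m - i)) by lia.
      rewrite lsum_seq_S. do 2 f_equal. lia.
Qed.

Lemma pmul_assoc f g h : pmul f (pmul g h) = pmul (pmul f g) h.
Proof.
  extensionality n. unfold pmul.
  transitivity (lsum (fun i => lsum (fun j => f i * g j * h (n - i - j)%nat) (seq 0 (S (n - i)))) (seq 0 (S n))).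
  { apply lsum_ext. intros i _. rewrite <- lsum_scal. apply lsum_ext. intros; ring. }
  transitivity (lsum (fun k => lsum (fun i => f i * g (k - i)%nat * h (n - k)%nat) (seq 0 (S k))) (seq 0 (S n))).
  2:{ apply lsum_ext. intros k _. rewrite Z.mul_comm, <- lsum_scal. apply lsum_ext. intros; ring. }
  exact (lsum_triangle (fun i j k => f i * g j * h k) n n (le_n n)).
Qed.

Lemma pmul_cst_l z f : pmul (cst z) f = fun n => z * f n.
Proof.
  extensionality n. unfold pmul. rewrite (lsum_seq_single _ _ 0); [|lia|].
  - unfold cst. simpl. now rewrite Nat.sub_0_r.
  - intros i _ Hi. unfold cst. destruct (Nat.eqb_spec i 0); [tauto|ring].
Qed.

Lemma pmul_add_l f g h : pmul (padd f g) h = padd (pmul f h) (pmul g h).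
Proof.
  extensionality n. unfold pmul, padd. rewrite <- lsum_add. apply lsum_ext. intros; ring.
Qed.

Declare Scope ps_scope.
Delimit Scope ps_scope with ps.
Bind Scope ps_scope with ps.
Infix "+" := padd : ps_scope.
Infix "-" := psub : ps_scope.
Infix "*" := pmul : ps_scope.
Notation "- f" := (popp f) : ps_scope.
Notation "# z" := (cst z%Z) (at level 1, z at level 0, format "# z") : ps_scope.

Fixpoint ppow (f : ps) (n : nat) : ps :=
  match n with O => cst 1 | S n' => pmul f (ppow f n') end.
Infix "^" := ppow : ps_scope.
Local Open Scope ps_scope.
Arguments ppow f%_ps n%_nat.

Lemma ps_ring_theory : ring_theory (#0) (#1) padd pmul psub popp (@eq ps).
Proof.
  split; intros.
  - extensionality n. unfold padd, cst. destruct (n =? 0)%nat; ring.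
  - extensionality n. unfold padd. ring.
  - extensionality n. unfold padd. ring.
  - rewrite pmul_cst_l. extensionality n. ring.
  - apply pmul_comm.
  - apply pmul_assoc.
  - apply pmul_add_l.
  - extensionality n. reflexivity.
  - extensionality n. unfold padd, popp, cst. destruct (n =? 0)%nat; ring.
Qed.

(** Lets [ring] compute with the constants [#z] as integers, on which the long polynomial identities
    below depend. *)
Lemma ps_ring_morph :
  ring_morph (#0) (#1) padd pmul psub popp (@eq ps) 0%Z 1%Z Z.add Z.mul Z.sub Z.opp Z.eqb cst.
Proof.
  split; try reflexivity; intros.
  - extensionality n. unfold padd, cst. destruct (n =? 0)%nat; ring.
  - extensionality n. unfold psub, cst. destruct (n =? 0)%nat; ring.
  - rewrite pmul_cst_l. extensionality n. unfold cst. destruct (n =? 0)%nat; ring.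
  - extensionality n. unfold popp, cst. destruct (n =? 0)%nat; ring.
  - apply Z.eqb_eq in H. now subst.
Qed.

Lemma ps_power_theory : power_theory (#1) pmul (@eq ps) N.to_nat ppow.
Proof.
  split. intros r n. destruct n as [|p]; [reflexivity|].
  simpl. induction p using Pos.peano_ind.
  - simpl. rewrite pmul_comm, pmul_cst_l. extensionality k. ring.
  - rewrite Pos2Nat.inj_succ. simpl ppow. rewrite IHp.
    clear IHp. induction p; simpl; [|reflexivity..].
    rewrite <- IHp. rewrite !pmul_assoc. f_equal. rewrite <- !pmul_assoc.
    f_equal. apply pmul_comm.
Qed.

Ltac ps_cst t :=
  match t with
  | cst ?z => match isZcst z with true => z | _ => constr:(InitialRing.NotConstant) end
  | _ => constr:(InitialRing.NotConstant)
  end.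
Ltac ps_pow_cst t :=
  match isnatcst t with true => constr:(N.of_nat t) | _ => constr:(InitialRing.NotConstant) end.

Add Ring ps_ring : ps_ring_theory
  (morphism ps_ring_morph, constants [ps_cst], power_tac ps_power_theory [ps_pow_cst]).

(** * Equality up to a given order, inverses and cancellation *)

Definition eqN (N : nat) (f g : ps) : Prop := forall n, (n < N)%nat -> f n = g n.
Notation "f =[ N ] g" := (eqN N f g) (at level 70, N at level 0, format "f  =[ N ]  g").

Lemma eqN_refl N f : f =[N] f.
Proof. intros n _; reflexivity. Qed.
Lemma eqN_sym N f g : f =[N] g -> g =[N] f.
Proof. intros H n Hn; symmetry; auto. Qed.
Lemma eqN_trans N f g h : f =[N] g -> g =[N] h -> f =[N] h.
Proof. intros H1 H2 n Hn; rewrite H1; auto. Qed.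
Lemma eqN_le N M f g : (M <= N)%nat -> f =[N] g -> f =[M] g.
Proof. intros H1 H2 n Hn; apply H2; lia. Qed.
Lemma eqN_all f g : (forall N, f =[N] g) -> f = g.
Proof. intros H; extensionality n; apply (H (S n)); lia. Qed.
Lemma eqN_add N f g f' g' : f =[N] f' -> g =[N] g' -> f + g =[N] f' + g'.
Proof. intros H1 H2 n Hn. unfold padd. rewrite H1, H2; auto. Qed.
Lemma eqN_sub N f g f' g' : f =[N] f' -> g =[N] g' -> f - g =[N] f' - g'.
Proof. intros H1 H2 n Hn. unfold psub. rewrite H1, H2; auto. Qed.
(** Orders add: if g starts at q^M, then N coefficients of f determine N + M coefficients of the
    product. *)
Lemma eqN_mul_gen N M f g f' : f =[N] f' -> g =[M] #0 -> f * g =[N + M] f' * g.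
Proof.
  intros H1 H2 n Hn. unfold pmul. apply lsum_ext. intros i Hi. apply in_seq in Hi.
  destruct (Nat.lt_ge_cases i N) as [L|L]; [now rewrite H1|].
  rewrite (H2 (n - i)%nat) by lia. unfold cst. destruct (_ =? _)%nat; ring.
Qed.
Lemma eqN_0 f g : f =[0] g.
Proof. intros n Hn; lia. Qed.
Lemma eqN_mul N f g f' g' : f =[N] f' -> g =[N] g' -> f * g =[N] f' * g'.
Proof.
  intros H1 H2 n Hn. unfold pmul. apply lsum_ext. intros i Hi. apply in_seq in Hi.
  rewrite H1, H2; auto; lia.
Qed.
Lemma eqN_pow N f f' k : f =[N] f' -> f ^ k =[N] f' ^ k.
Proof. intros H. induction k; simpl; [apply eqN_refl|]. now apply eqN_mul. Qed.

Lemma eqN_0_mul N M f g : f =[N] #0 -> g =[M] #0 -> f * g =[N + M] #0.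
Proof.
  intros H1 H2. eapply eqN_trans; [apply (eqN_mul_gen N M _ _ (#0)); auto|].
  replace (#0 * g) with (#0) by ring. apply eqN_refl.
Qed.

Lemma eqN_0_pow f k : f 0%nat = 0%Z -> f ^ k =[k] #0.
Proof.
  intros H. induction k; simpl; [apply eqN_0|].
  apply (eqN_0_mul 1 k); auto. intros n Hn. replace n with 0%nat by lia. auto.
Qed.

Lemma ppow_add f a b : f ^ (a + b) = f ^ a * f ^ b.
Proof. induction a; simpl; [|rewrite IHa]; ring. Qed.
Lemma ppow_mul_base f g k : (f * g) ^ k = f ^ k * g ^ k.
Proof. induction k; simpl; [|rewrite IHk]; ring. Qed.
Lemma ppow_ppow f a b : (f ^ a) ^ b = f ^ (a * b).
Proof.
  induction b; simpl; [now rewrite Nat.mul_0_r|].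
  rewrite IHb, Nat.mul_succ_r, Nat.add_comm, ppow_add. reflexivity.
Qed.
Lemma ppow_1_l k : #1 ^ k = #1.
Proof. induction k; simpl; [|rewrite IHk]; ring. Qed.

Lemma mul_coef_0 f g : (f * g) 0%nat = (f 0%nat * g 0%nat)%Z.
Proof. unfold pmul. simpl. ring. Qed.

Fixpoint geom (f : ps) (N : nat) : ps :=
  match N with O => #0 | S N' => geom f N' + f ^ N' end.
(* An inverse of f only when f 0 = 1. *)
Definition pinv (f : ps) : ps := fun n => geom (#1 - f) (S n) n.

Lemma geom_mul f N : (#1 - f) * geom f N = #1 - f ^ N.
Proof.
  induction N; simpl; [ring|].
  transitivity ((#1 - f) * geom f N + (#1 - f) * f ^ N); [ring|]. rewrite IHN. ring.
Qed.

Lemma geom_stable f N M : f 0%nat = 0%Z -> (N <= M)%nat -> geom f M =[N] geom f N.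
Proof.
  intros H0 H. induction H; [apply eqN_refl|]. simpl.
  eapply eqN_trans; [|exact IHle]. intros n Hn. unfold padd at 1.
  rewrite (eqN_0_pow f m H0 n) by lia. unfold cst. destruct (n =? 0)%nat; lia.
Qed.

Lemma pinv_geom f N : f 0%nat = 1%Z -> pinv f =[N] geom (#1 - f) N.
Proof.
  intros H n Hn. unfold pinv. symmetry. apply (geom_stable _ (S n)); try lia.
  unfold psub. rewrite H. reflexivity.
Qed.

Lemma mul_pinv f : f 0%nat = 1%Z -> f * pinv f = #1.
Proof.
  intros H. apply eqN_all. intros N.
  eapply eqN_trans; [apply eqN_mul; [apply eqN_refl|apply pinv_geom, H]|].
  replace f with (#1 - (#1 - f)) at 1 by ring. rewrite geom_mul.
  replace (#1) with (#1 - #0) at 3 by ring. apply eqN_sub; [apply eqN_refl|].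
  apply eqN_0_pow. unfold psub. rewrite H. reflexivity.
Qed.

(** With d the order of f, the coefficient of index d + k in f g reduces to f_d g_k once the earlier
    coefficients of g are known to vanish. *)
Lemma pmul_eq_0 f g : f <> #0 -> f * g = #0 -> g = #0.
Proof.
  intros Hf Hfg.
  assert (E : exists d, f d <> 0%Z).
  { apply not_all_not_ex. intros A. apply Hf. extensionality n.
    replace (#0 n) with 0%Z by (unfold cst; destruct (n =? 0)%nat; reflexivity).
    apply NNPP, A. }
  assert (M : exists d, f d <> 0%Z /\ forall i, (i < d)%nat -> f i = 0%Z).
  { destruct E as [d Hd]. induction d as [d IH] using lt_wf_ind.
    destruct (classic (exists i, (i < d)%nat /\ f i <> 0%Z)) as [(i & Hi & Hi')|A].
    - exact (IH i Hi Hi').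
    - exists d. split; [assumption|]. intros i Hi. apply NNPP. intros B. apply A. eauto. }
  destruct M as (d & Hd & Hmin). extensionality k.
  replace (#0 k) with 0%Z by (unfold cst; destruct (k =? 0)%nat; reflexivity).
  induction k as [k IH] using lt_wf_ind.
  pose proof (f_equal (fun h : ps => h (d + k)%nat) Hfg) as C. simpl in C.
  unfold pmul in C. rewrite (lsum_seq_single _ _ d) in C; [|lia|].
  - replace (d + k - d)%nat with k in C by lia.
    unfold cst in C. destruct (_ =? _)%nat in C; apply Z.mul_eq_0 in C; tauto.
  - intros i Hi Hid. destruct (Nat.lt_ge_cases i d) as [L|L].
    + rewrite Hmin by assumption. reflexivity.
    + rewrite (IH (d + k - i)%nat) by lia. ring.
Qed.

Lemma pmul_cancel f g h : f <> #0 -> f * g = f * h -> g = h.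
Proof.
  intros Hf E. assert (D : g - h = #0).
  { apply (pmul_eq_0 f); auto. transitivity (f * g - f * h); [ring|]. rewrite E. ring. }
  transitivity (g - h + h); [ring|]. rewrite D. ring.
Qed.

Lemma pmul_neq_0 f g : f <> #0 -> g <> #0 -> f * g <> #0.
Proof. intros Hf Hg E. apply Hg, (pmul_eq_0 f); auto. Qed.

Lemma ppow_neq_0 f k : f <> #0 -> f ^ k <> #0.
Proof.
  intros Hf. induction k; simpl.
  - intros E. apply (f_equal (fun h : ps => h 0%nat)) in E. discriminate.
  - now apply pmul_neq_0.
Qed.

Lemma coef_neq_0 f n : f n <> 0%Z -> f <> #0.
Proof. intros H ->. apply H. unfold cst. destruct (n =? 0)%nat; reflexivity. Qed.

(** * Monomials, the substitution q -> q^k and the extraction of residue classes of exponents *)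

Definition mono (k : nat) : ps := fun n => if (n =? k)%nat then 1%Z else 0%Z.

Lemma mono_mul_coef k f n : (mono k * f) n = if (n <? k)%nat then 0%Z else f (n - k)%nat.
Proof.
  unfold pmul, mono. destruct (Nat.ltb_spec n k).
  - apply lsum_zero. intros i Hi. apply in_seq in Hi. destruct (Nat.eqb_spec i k); [lia|ring].
  - rewrite (lsum_seq_single _ _ k); [|lia|].
    + rewrite Nat.eqb_refl. ring.
    + intros i _ Hi. destruct (Nat.eqb_spec i k); [tauto|ring].
Qed.

Lemma mono_mul a b : mono a * mono b = mono (a + b).
Proof.
  extensionality n. rewrite mono_mul_coef. unfold mono.
  destruct (Nat.ltb_spec n a), (Nat.eqb_spec (n - a) b), (Nat.eqb_spec n (a + b)); lia.
Qed.

Lemma mono_pow a k : mono a ^ k = mono (a * k).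
Proof.
  induction k; simpl; [now rewrite Nat.mul_0_r|].
  rewrite IHk, mono_mul. f_equal. lia.
Qed.

Lemma mono_neq_0 k : mono k <> #0.
Proof. apply (coef_neq_0 _ k). unfold mono. rewrite Nat.eqb_refl. lia. Qed.

Lemma eqN_mono k N : (N <= k)%nat -> mono k =[N] #0.
Proof.
  intros H n Hn. unfold mono, cst.
  destruct (Nat.eqb_spec n k), (Nat.eqb_spec n 0); auto; lia.
Qed.

(* f(q) |-> f(q^k) *)
Definition dil (k : nat) (f : ps) : ps :=
  fun n => if (n mod k =? 0)%nat then f (n / k)%nat else 0%Z.

Definition sect (k r : nat) (f : ps) : ps := fun n => f (k * n + r)%nat.

Lemma dil_at k f n : (0 < k)%nat -> dil k f (k * n)%nat = f n.
Proof.
  intros Hk. unfold dil. rewrite Nat.mul_comm, Nat.Div0.mod_mul, Nat.div_mul by lia.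
  reflexivity.
Qed.

Lemma dil_off k f n r : (r < k)%nat -> (0 < r)%nat -> dil k f (k * n + r)%nat = 0%Z.
Proof.
  intros Hk Hr. unfold dil.
  replace ((k * n + r) mod k)%nat with r.
  - destruct (Nat.eqb_spec r 0); [lia|reflexivity].
  - rewrite Nat.add_comm, Nat.mul_comm, Nat.Div0.mod_add, Nat.mod_small; lia.
Qed.

Lemma nat_divmod k n : (0 < k)%nat -> exists a r, (r < k)%nat /\ n = (k * a + r)%nat.
Proof.
  intros Hk. exists (n / k)%nat, (n mod k)%nat. split.
  - apply Nat.mod_upper_bound; lia.
  - apply Nat.div_mod_eq.
Qed.

Lemma dil_cases k f n z : (0 < k)%nat ->
  (forall a, n = (k * a)%nat -> f a = z) -> (z <> 0%Z -> exists a, n = (k * a)%nat) ->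
  dil k f n = z.
Proof.
  intros Hk H1 H2. destruct (nat_divmod k n Hk) as (a & r & Hr & ->).
  destruct (Nat.eq_dec r 0) as [->|N].
  - rewrite Nat.add_0_r in *. rewrite dil_at by auto. now apply H1.
  - rewrite dil_off by lia. destruct (Z.eq_dec z 0) as [->|Hz]; [reflexivity|].
    destruct (H2 Hz) as [b Hb]. destruct (Nat.lt_ge_cases a b); nia.
Qed.

(** A factor in q^k passes through the extraction of a residue class. This makes U5 linear over the
    series in q^5, the source of all recurrences for U5. *)
Lemma dil_mul_coef k r f g n : (r < k)%nat ->
  (dil k f * g) (k * n + r)%nat = (f * sect k r g) n.
Proof.
  intros Hr. unfold pmul.
  symmetry. apply (lsum_reindex (fun i => k * i)%nat); try apply seq_NoDup.
  - intros a a' _ _ _ _ E. nia.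
  - intros a Ha _. rewrite in_seq in *. split; [nia|].
    rewrite dil_at by lia. unfold sect. do 2 f_equal. nia.
  - intros b Hb Hn. rewrite in_seq in Hb.
    destruct (nat_divmod k b ltac:(lia)) as (a & s & Hs & ->).
    destruct (Nat.eq_dec s 0) as [->|N].
    + assert (a <= n)%nat by (destruct (Nat.lt_ge_cases n a); nia).
      exists a. rewrite in_seq. rewrite Nat.add_0_r in *. split; [lia|]. split; [|reflexivity].
      rewrite dil_at in Hn by lia. unfold sect.
      replace (k * (n - a) + r)%nat with (k * n + r - k * a)%nat; [assumption|].
      rewrite Nat.mul_sub_distr_l. assert (k * a <= k * n)%nat by nia. lia.
    + rewrite dil_off in Hn by lia. lia.
Qed.

Lemma sect_dil_mul k r f g : (r < k)%nat -> sect k r (dil k f * g) = f * sect k r g.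
Proof. intros Hr. extensionality n. now apply dil_mul_coef. Qed.

Lemma sect_dil k f : (0 < k)%nat -> sect k 0 (dil k f) = f.
Proof. intros Hk. extensionality n. unfold sect. rewrite Nat.add_0_r. now apply dil_at. Qed.

Lemma sect_dil_off k r f : (0 < r < k)%nat -> sect k r (dil k f) = #0.
Proof.
  intros Hk. extensionality n. unfold sect. rewrite dil_off by lia.
  unfold cst; destruct (n =? 0)%nat; reflexivity.
Qed.

Lemma sect_ext k f g : (0 < k)%nat ->
  (forall r, (r < k)%nat -> sect k r f = sect k r g) -> f = g.
Proof.
  intros Hk H. extensionality n. destruct (nat_divmod k n Hk) as (a & r & Hr & ->).
  exact (f_equal (fun h : ps => h a) (H r Hr)).
Qed.

Lemma dil_inj k f g : (0 < k)%nat -> dil k f = dil k g -> f = g.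
Proof. intros Hk E. rewrite <- (sect_dil k f), <- (sect_dil k g), E; auto. Qed.

Lemma dil_mul k f g : (0 < k)%nat -> dil k (f * g) = dil k f * dil k g.
Proof.
  intros Hk. apply (sect_ext k); auto. intros r Hr. rewrite sect_dil_mul by auto.
  destruct (Nat.eq_dec r 0) as [->|N].
  - now rewrite !sect_dil.
  - rewrite !sect_dil_off by lia. ring.
Qed.

Lemma dil_add k f g : dil k (f + g) = dil k f + dil k g.
Proof. extensionality n. unfold dil, padd. destruct (_ =? _)%nat; ring. Qed.
Lemma dil_sub k f g : dil k (f - g) = dil k f - dil k g.
Proof. extensionality n. unfold dil, psub. destruct (_ =? _)%nat; ring. Qed.
Lemma dil_mono k a : (0 < k)%nat -> dil k (mono a) = mono (k * a).
Proof.
  intros Hk. extensionality n. apply dil_cases; auto; unfold mono.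
  - intros b ->. destruct (Nat.eqb_spec b a), (Nat.eqb_spec (k * b) (k * a)); nia.
  - destruct (Nat.eqb_spec n (k * a)); [eauto|lia].
Qed.
Lemma dil_cst k z : (0 < k)%nat -> dil k (#z) = #z.
Proof.
  intros Hk. extensionality n. apply dil_cases; auto; unfold cst.
  - intros b ->. destruct (Nat.eqb_spec b 0), (Nat.eqb_spec (k * b) 0); nia.
  - destruct (Nat.eqb_spec n 0); [exists 0%nat; lia|lia].
Qed.
Lemma dil_pow k f n : (0 < k)%nat -> dil k (f ^ n) = dil k f ^ n.
Proof. intros Hk. induction n; simpl; [now apply dil_cst|]. rewrite dil_mul, IHn; auto. Qed.
Lemma dil_dil a b f : (0 < a)%nat -> (0 < b)%nat -> dil a (dil b f) = dil (a * b) f.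
Proof.
  intros Ha Hb. extensionality n. apply dil_cases; auto.
  - intros m ->. symmetry. apply dil_cases; [lia| |].
    + intros j E. replace m with (b * j)%nat by nia. symmetry. now apply dil_at.
    + intros H. destruct (nat_divmod b m Hb) as (c & r & Hr & ->).
      destruct (Nat.eq_dec r 0) as [->|N].
      * exists c. nia.
      * rewrite dil_off in H by lia. lia.
  - destruct (nat_divmod (a * b) n ltac:(nia)) as (c & r & Hr & ->).
    destruct (Nat.eq_dec r 0) as [->|N].
    + intros _. exists (b * c)%nat. nia.
    + rewrite dil_off by lia. lia.
Qed.

Lemma dil_coef_0 k f : dil k f 0%nat = f 0%nat.
Proof.
  unfold dil. destruct k; [reflexivity|].
  rewrite Nat.Div0.mod_0_l, Nat.Div0.div_0_l. reflexivity.
Qed.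

Lemma eqN_dil N k f g : (0 < k)%nat -> f =[N] g -> dil k f =[k * N] dil k g.
Proof.
  intros Hk H n Hn. unfold dil. destruct (_ =? _)%nat; [|reflexivity].
  apply H. apply Nat.Div0.div_lt_upper_bound. lia.
Qed.

Lemma sect_add k r f g : sect k r (f + g) = sect k r f + sect k r g.
Proof. reflexivity. Qed.
Lemma sect_cst_mul k r z f : sect k r (#z * f) = #z * sect k r f.
Proof. rewrite !pmul_cst_l. reflexivity. Qed.
Lemma eqN_sect N r f g k : (r < k)%nat -> f =[k * N] g -> sect k r f =[N] sect k r g.
Proof. intros Hr H n Hn. unfold sect. apply H. nia. Qed.

(** * Theta series and their 5-dissection *)

Definition zr (n : nat) : list Z :=
  map (fun i => (Z.of_nat i - Z.of_nat n)%Z) (seq 0 (2 * n + 1)).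

Lemma in_zr n x : In x (zr n) <-> (Z.abs x <= Z.of_nat n)%Z.
Proof.
  unfold zr. rewrite in_map_iff. split.
  - intros (i & <- & Hi). apply in_seq in Hi. lia.
  - intros H. exists (Z.to_nat (x + Z.of_nat n)). rewrite in_seq. lia.
Qed.

Lemma zr_NoDup n : NoDup (zr n).
Proof.
  apply NoDup_map_NoDup_ForallPairs; [|apply seq_NoDup].
  intros i j _ _ H. lia.
Qed.

Definition at_exp (e w : Z -> Z) (n : nat) (x : Z) : Z := if (e x =? Z.of_nat n)%Z then w x else 0%Z.

(* Sum over all integers x of w(x) q^(e(x)); the range searched for the exponent n suffices
   when |x| <= e(x) on the support of w. *)
Definition theta (e w : Z -> Z) : ps := fun n => lsum (at_exp e w n) (zr n).

Definition proper (e w : Z -> Z) : Prop := forall x, w x <> 0%Z -> (Z.abs x <= e x)%Z.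

Lemma at_exp_neq_0 e w n x : at_exp e w n x <> 0%Z <-> (e x = Z.of_nat n /\ w x <> 0%Z).
Proof. unfold at_exp. destruct (Z.eqb_spec (e x) (Z.of_nat n)); intuition. Qed.

Lemma theta_box e w n N : proper e w -> (n <= N)%nat ->
  theta e w n = lsum (at_exp e w n) (zr N).
Proof.
  intros P H. apply (lsum_reindex (fun x => x)); try apply zr_NoDup; auto.
  - intros a Ha _. apply in_zr in Ha. rewrite in_zr. split; [lia|reflexivity].
  - intros b Hb Hn. exists b. repeat split; auto. apply at_exp_neq_0 in Hn as [E Hw].
    apply in_zr. specialize (P b Hw). lia.
Qed.

Lemma theta_reindex (rho : Z -> Z) e w e' w' :
  proper e w -> proper e' w' ->
  (forall i j, rho i = rho j -> i = j) ->
  (forall j, w (rho j) = w' j) ->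
  (forall j, w' j <> 0%Z -> e (rho j) = e' j) ->
  (forall x, w x <> 0%Z -> exists j, x = rho j) ->
  theta e w = theta e' w'.
Proof.
  intros P P' Hinj Hw He Hs. extensionality n. symmetry.
  apply (lsum_reindex rho); try apply zr_NoDup; auto.
  - intros a Ha Hn. pose proof Hn as Hn'. apply at_exp_neq_0 in Hn as [E W].
    split.
    + apply in_zr. specialize (P (rho a)). rewrite Hw, He in P by auto. specialize (P W). lia.
    + unfold at_exp. now rewrite Hw, He.
  - intros b Hb Hn. apply at_exp_neq_0 in Hn as [E W]. destruct (Hs b W) as [j ->].
    rewrite Hw in W. rewrite He in E by auto. exists j. rewrite in_zr, at_exp_neq_0.
    repeat split; auto. specialize (P' j W). lia.
Qed.

Lemma theta_ext e w w' : (forall x, w x = w' x) -> theta e w = theta e w'.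
Proof. intros H. f_equal. extensionality x. apply H. Qed.

Lemma theta_add e w1 w2 : theta e w1 + theta e w2 = theta e (fun x => w1 x + w2 x)%Z.
Proof.
  extensionality n. unfold padd, theta. rewrite <- lsum_add. apply lsum_ext.
  intros x _. unfold at_exp. destruct (_ =? _)%Z; reflexivity.
Qed.

Lemma theta_cst_mul c e w : #c * theta e w = theta e (fun x => c * w x)%Z.
Proof.
  rewrite pmul_cst_l. extensionality n. unfold theta. rewrite <- lsum_scal. apply lsum_ext.
  intros x _. unfold at_exp. destruct (_ =? _)%Z; ring.
Qed.

Lemma theta_dil t e w : (0 < t)%nat -> proper e w ->
  dil t (theta e w) = theta (fun x => Z.of_nat t * e x)%Z w.
Proof.
  intros Ht P. extensionality n. apply dil_cases; auto.
  - intros a ->. rewrite (theta_box e w a (t * a)) by (auto; nia).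
    apply lsum_ext. intros x _. unfold at_exp.
    destruct (Z.eqb_spec (e x) (Z.of_nat a)), (Z.eqb_spec (Z.of_nat t * e x) (Z.of_nat (t * a)));
      auto; nia.
  - intros H. apply NNPP. intros A. apply H. apply lsum_zero. intros x _. unfold at_exp.
    destruct (Z.eqb_spec (Z.of_nat t * e x) (Z.of_nat n)); auto.
    destruct (Z.eq_dec (w x) 0) as [|W]; auto. specialize (P x W).
    exfalso. apply A. exists (Z.to_nat (e x)). nia.
Qed.

Lemma theta_shift s e w : proper e w ->
  mono s * theta e w = theta (fun x => Z.of_nat s + e x)%Z w.
Proof.
  intros P. extensionality n. rewrite mono_mul_coef. destruct (Nat.ltb_spec n s).
  - symmetry. apply lsum_zero. intros x _. unfold at_exp.
    destruct (Z.eqb_spec (Z.of_nat s + e x) (Z.of_nat n)); auto.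
    destruct (Z.eq_dec (w x) 0) as [|W]; auto. specialize (P x W). lia.
  - rewrite (theta_box e w _ n) by (auto; lia). apply lsum_ext. intros x _. unfold at_exp.
    destruct (Z.eqb_spec (e x) (Z.of_nat (n - s))), (Z.eqb_spec (Z.of_nat s + e x) (Z.of_nat n));
      auto; lia.
Qed.

Lemma NoDup_list_prod {A B} (l1 : list A) (l2 : list B) :
  NoDup l1 -> NoDup l2 -> NoDup (list_prod l1 l2).
Proof.
  intros N1 N2. induction N1 as [|a l1 Ha N1 IH]; simpl; [constructor|].
  apply NoDup_app; auto.
  - apply NoDup_map_NoDup_ForallPairs; auto. intros b b' _ _ E. congruence.
  - intros [x y] Hx Hy. apply in_map_iff in Hx as (b & E & _). injection E as <- <-.
    apply in_prod_iff in Hy. tauto.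
Qed.

Definition at_exp2 (e w : Z * Z -> Z) (n : nat) (p : Z * Z) : Z :=
  if (e p =? Z.of_nat n)%Z then w p else 0%Z.
Definition theta2 (e w : Z * Z -> Z) : ps :=
  fun n => lsum (at_exp2 e w n) (list_prod (zr n) (zr n)).

Lemma theta_mul e1 w1 e2 w2 : proper e1 w1 -> proper e2 w2 ->
  theta e1 w1 * theta e2 w2 =
  theta2 (fun p => e1 (fst p) + e2 (snd p))%Z (fun p => w1 (fst p) * w2 (snd p))%Z.
Proof.
  intros P1 P2. extensionality n. unfold theta2. rewrite lsum_prod. unfold pmul.
  rewrite (lsum_ext _ (fun i => lsum (fun x => lsum (fun y =>
    (at_exp e1 w1 i x * at_exp e2 w2 (n - i) y)%Z) (zr n)) (zr n))).
  2:{ intros i Hi. apply in_seq in Hi.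
      rewrite (theta_box e1 w1 i n), (theta_box e2 w2 (n - i) n) by (auto; lia).
      rewrite Z.mul_comm, <- lsum_scal. apply lsum_ext. intros x _.
      rewrite Z.mul_comm, <- lsum_scal. reflexivity. }
  rewrite lsum_swap. apply lsum_ext. intros x _. rewrite lsum_swap. apply lsum_ext. intros y _.
  unfold at_exp2, at_exp. cbn [fst snd].
  destruct (Z.eq_dec (w1 x) 0) as [E|W1].
  { rewrite E. rewrite lsum_zero.
    - destruct (_ =? _)%Z; reflexivity.
    - intros i _. destruct (e1 x =? _)%Z; ring. }
  destruct (Z.eq_dec (w2 y) 0) as [E|W2].
  { rewrite E. rewrite lsum_zero; [destruct (_ =? _)%Z; ring|].
    intros i _. destruct (_ =? Z.of_nat (n - i))%Z; ring. }
  specialize (P1 x W1). specialize (P2 y W2).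
  destruct (Z.eqb_spec (e1 x + e2 y) (Z.of_nat n)).
  - rewrite (lsum_seq_single _ _ (Z.to_nat (e1 x))); [|lia|].
    + destruct (Z.eqb_spec (e1 x) (Z.of_nat (Z.to_nat (e1 x)))); [|lia].
      destruct (Z.eqb_spec (e2 y) (Z.of_nat (n - Z.to_nat (e1 x)))); [reflexivity|lia].
    + intros i Hi Hne. destruct (Z.eqb_spec (e1 x) (Z.of_nat i)); [lia|ring].
  - apply lsum_zero. intros i Hi. apply in_seq in Hi.
    destruct (Z.eqb_spec (e1 x) (Z.of_nat i)); [|ring].
    destruct (Z.eqb_spec (e2 y) (Z.of_nat (n - i))); [lia|ring].
Qed.

Lemma theta2_add e w1 w2 : theta2 e w1 + theta2 e w2 = theta2 e (fun p => w1 p + w2 p)%Z.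
Proof.
  extensionality n. unfold padd, theta2. rewrite <- lsum_add. apply lsum_ext.
  intros x _. unfold at_exp2. destruct (_ =? _)%Z; reflexivity.
Qed.

Lemma theta2_ext e e' w w' : (forall p, e p = e' p) -> (forall p, w p = w' p) ->
  theta2 e w = theta2 e' w'.
Proof.
  intros H1 H2. extensionality n. apply lsum_ext. intros p _. unfold at_exp2.
  now rewrite H1, H2.
Qed.

Definition sq (x : Z) : Z := (x * x)%Z.

Lemma abs_le_sq x : (Z.abs x <= x * x)%Z.
Proof. nia. Qed.

Lemma sq_proper w : proper sq w.
Proof. intros x _. apply abs_le_sq. Qed.

Lemma proper_scal t e w : (0 < t)%nat -> proper e w -> proper (fun x => Z.of_nat t * e x)%Z w.
Proof. intros Ht P x Hx. specialize (P x Hx). nia. Qed.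

Definition on_class (k r : Z) (w : Z -> Z) : Z -> Z :=
  fun x => if (x mod k =? r)%Z then w x else 0%Z.

Lemma mod_5_cases x : (x mod 5 = 0 \/ x mod 5 = 1 \/ x mod 5 = 2 \/ x mod 5 = 3 \/ x mod 5 = 4)%Z.
Proof. lia. Qed.

(** Two weights are used, (-1)^x for phi(-q) and the indicator of the odd integers for psi. Both
    depend only on the parity of x, which is all that the rotation by 2 + i has to respect. *)
Section Lattice.
Variable w : Z -> Z.
Hypothesis w_parity : forall x y, (x mod 2 = y mod 2)%Z -> w x = w y.

Lemma theta_class_opp r s : (0 <= r < 5)%Z -> (0 <= s < 5)%Z -> (r + s = 5)%Z ->
  theta sq (on_class 5 r w) = theta sq (on_class 5 s w).
Proof.
  intros Hr Hs E. apply (theta_reindex Z.opp); try apply sq_proper.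
  - intros; lia.
  - intros j. unfold on_class.
    destruct (Z.eqb_spec (- j mod 5) r), (Z.eqb_spec (j mod 5) s); try lia; auto.
    apply w_parity. lia.
  - intros j _. unfold sq. ring.
  - intros x _. exists (- x)%Z. lia.
Qed.

(* The map (m, n) |-> (2 m + n, m - 2 n), i.e. multiplication of m - n i by 2 + i,
   multiplies m^2 + n^2 by 5 and its image consists of the (x, y) with x = 2 y mod 5. *)
Lemma theta_sq_dissect :
  dil 5 (theta sq w) ^ 2 =
  theta sq (on_class 5 0 w) ^ 2 + #4 * theta sq (on_class 5 1 w) * theta sq (on_class 5 2 w).
Proof.
  pose (T := fun r => theta sq (on_class 5 r w)).
  assert (M : forall r s, T r * T s = theta2 (fun p => sq (fst p) + sq (snd p))%Z
     (fun p => on_class 5 r w (fst p) * on_class 5 s w (snd p))%Z).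
  { intros; apply theta_mul; apply sq_proper. }
  assert (E : dil 5 (theta sq w) * dil 5 (theta sq w) =
    T 0%Z * T 0%Z + T 2%Z * T 1%Z + T 4%Z * T 2%Z + T 1%Z * T 3%Z + T 3%Z * T 4%Z).
  { rewrite !M, !theta2_add, theta_dil by (try lia; apply sq_proper).
    rewrite theta_mul by (apply proper_scal; [lia|apply sq_proper]).
    transitivity (theta2 (fun p => sq (fst p) + sq (snd p))%Z
      (fun p => if ((fst p - 2 * snd p) mod 5 =? 0)%Z then w (fst p) * w (snd p) else 0)%Z).
    - extensionality N.
      assert (B : forall x y, (x * x + y * y <= Z.of_nat N ->
        Z.abs x <= Z.of_nat N /\ Z.abs y <= Z.of_nat N)%Z).
      { intros x y Hxy. pose proof (abs_le_sq x). pose proof (abs_le_sq y). nia. }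
      apply (lsum_reindex (fun p => (2 * fst p + snd p, fst p - 2 * snd p)%Z)).
      + apply NoDup_list_prod; apply zr_NoDup.
      + apply NoDup_list_prod; apply zr_NoDup.
      + intros [a b] [c d] _ _ _ _ H. cbn [fst snd] in H. apply pair_equal_spec in H.
        f_equal; lia.
      + intros [a b] _ Hn. unfold at_exp2 in *. cbn [fst snd] in *. unfold sq in *.
        change (Z.of_nat 5) with 5%Z in *.
        destruct (Z.eqb_spec (5 * (a * a) + 5 * (b * b)) (Z.of_nat N)) as [e|];
          [|congruence].
        split.
        * destruct (B (2 * a + b) (a - 2 * b))%Z; [nia|]. apply in_prod; now apply in_zr.
        * destruct (Z.eqb_spec ((2 * a + b) * (2 * a + b) + (a - 2 * b) * (a - 2 * b))
             (Z.of_nat N)); [|nia].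
          destruct (Z.eqb_spec ((2 * a + b - 2 * (a - 2 * b)) mod 5) 0).
          (* 2 a + b has the parity of b and a - 2 b that of a, hence the exchange of the two
             factors. *)
          -- rewrite Z.mul_comm. f_equal; apply w_parity; lia.
          -- lia.
      + intros [x y] _ Hn. unfold at_exp2 in *. cbn [fst snd] in *. unfold sq in *.
        change (Z.of_nat 5) with 5%Z in *.
        destruct (Z.eqb_spec (x * x + y * y) (Z.of_nat N)); [|congruence].
        destruct (Z.eqb_spec ((x - 2 * y) mod 5) 0); [|congruence].
        assert (exists b, x = 5 * b + 2 * y)%Z as [b ->].
        { exists ((x - 2 * y) / 5)%Z. lia. }
        exists (2 * b + y, b)%Z. cbn [fst snd].
        change (Z.of_nat 5) with 5%Z.
        destruct (Z.eqb_spec (5 * ((2 * b + y) * (2 * b + y)) + 5 * (b * b))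
          (Z.of_nat N)); [|nia].
        repeat split.
        * destruct (B (2 * b + y) b)%Z; [nia|]. apply in_prod; now apply in_zr.
        * intros Z0. apply Hn. rewrite Z.mul_comm, <- Z0. f_equal; apply w_parity; lia.
        * f_equal; lia.
    - apply theta2_ext; [reflexivity|]. intros [x y]. unfold on_class. cbn [fst snd].
      rewrite (Zminus_mod x), (Zmult_mod 2 y).
      destruct (mod_5_cases x) as [->|[->|[->|[->| ->]]]];
      destruct (mod_5_cases y) as [->|[->|[->|[->| ->]]]]; simpl; ring. }
  assert (E4 : T 4%Z = T 1%Z) by (apply theta_class_opp; lia).
  assert (E3 : T 3%Z = T 2%Z) by (apply theta_class_opp; lia).
  rewrite E4, E3 in E. simpl ppow.
  transitivity (dil 5 (theta sq w) * dil 5 (theta sq w)); [ring|]. rewrite E.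
  unfold T. ring.
Qed.

Lemma theta_dissect :
  theta sq w = theta sq (on_class 5 0 w) + #2 * theta sq (on_class 5 1 w) +
    #2 * theta sq (on_class 5 2 w).
Proof.
  transitivity (theta sq (on_class 5 0 w) + theta sq (on_class 5 1 w) + theta sq (on_class 5 2 w)
    + theta sq (on_class 5 3 w) + theta sq (on_class 5 4 w)).
  - rewrite !theta_add. apply theta_ext. intros x. unfold on_class.
    destruct (mod_5_cases x) as [->|[->|[->|[->| ->]]]]; simpl; ring.
  - rewrite (theta_class_opp 4 1), (theta_class_opp 3 2) by lia. ring.
Qed.

Lemma theta_class_0 : theta sq (on_class 5 0 w) = dil 25 (theta sq w).
Proof.
  rewrite theta_dil by (try lia; apply sq_proper).
  apply (theta_reindex (fun j => 5 * j)%Z); try apply sq_proper.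
  - apply proper_scal; [lia|apply sq_proper].
  - intros; lia.
  - intros j. unfold on_class. destruct (Z.eqb_spec ((5 * j) mod 5) 0); [|lia].
    apply w_parity. lia.
  - intros j _. unfold sq. lia.
  - intros x. unfold on_class. destruct (Z.eqb_spec (x mod 5) 0); [|congruence].
    intros _. exists (x / 5)%Z. lia.
Qed.

End Lattice.

(** * The Jacobi triple product *)

Fixpoint sump (f : nat -> ps) (N : nat) : ps :=
  match N with O => #0 | S N' => sump f N' + f N' end.
Fixpoint prodp (f : nat -> ps) (N : nat) : ps :=
  match N with O => #1 | S N' => prodp f N' * f N' end.

Lemma sump_S f N : sump f (S N) = sump f N + f N.
Proof. reflexivity. Qed.
Lemma sump_ext f g N : (forall k, (k < N)%nat -> f k = g k) -> sump f N = sump g N.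
Proof. induction N; intros H; simpl; [reflexivity|]. rewrite IHN, H; auto. Qed.
Lemma sump_scal h f N : sump (fun k => h * f k) N = h * sump f N.
Proof. induction N; simpl; [|rewrite IHN]; ring. Qed.
Lemma sump_add f g N : sump (fun k => f k + g k) N = sump f N + sump g N.
Proof. induction N; simpl; [|rewrite IHN]; ring. Qed.
Lemma sump_first f N : sump f (S N) = f O + sump (fun k => f (S k)) N.
Proof. induction N; [simpl; ring|]. simpl in *. rewrite IHN. ring. Qed.
Lemma sump_coef f N n : sump f N n = lsum (fun k => f k n) (seq 0 N).
Proof.
  induction N; [simpl; unfold cst; destruct (n =? 0)%nat; reflexivity|].
  rewrite lsum_seq_S, <- IHN. reflexivity.
Qed.
Lemma eqN_sump K f g N : (forall k, (k < N)%nat -> f k =[K] g k) -> sump f N =[K] sump g N.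
Proof. induction N; intros H; simpl; [apply eqN_refl|]. apply eqN_add; auto. Qed.

Lemma prodp_ext f g N : (forall k, (k < N)%nat -> f k = g k) -> prodp f N = prodp g N.
Proof. induction N; intros H; simpl; [reflexivity|]. rewrite IHN, H; auto. Qed.
Lemma prodp_mul f g N : prodp (fun k => f k * g k) N = prodp f N * prodp g N.
Proof. induction N; simpl; [|rewrite IHN]; ring. Qed.
Lemma prodp_app f N M : prodp f (N + M) = prodp f N * prodp (fun k => f (N + k)%nat) M.
Proof.
  induction M; simpl; [rewrite Nat.add_0_r; ring|].
  rewrite Nat.add_succ_r. simpl. rewrite IHM. ring.
Qed.
Lemma prodp_first f N : prodp f (S N) = f O * prodp (fun k => f (S k)) N.
Proof.
  induction N; [simpl; ring|].
  change (prodp f (S (S N))) with (prodp f (S N) * f (S N)). rewrite IHN. simpl. ring.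
Qed.
Lemma prodp_rev f N : prodp f N = prodp (fun k => f (N - 1 - k)%nat) N.
Proof.
  revert f. induction N; intros f; [reflexivity|].
  rewrite prodp_first, IHN. simpl. rewrite Nat.sub_0_r, Nat.sub_diag.
  rewrite (prodp_ext (fun k => f (S (N - 1 - k))) (fun k => f (N - k)%nat)); [ring|].
  intros k Hk. f_equal. lia.
Qed.
Lemma prodp_single f N j : (j < N)%nat -> (forall k, (k < N)%nat -> k <> j -> f k = #1) ->
  prodp f N = f j.
Proof.
  intros Hj H. induction N; [lia|]. simpl. destruct (Nat.eq_dec j N) as [->|E].
  - assert (prodp f N = #1) as ->; [|ring].
    assert (forall k, (k < N)%nat -> f k = #1) by (intros; apply H; lia).
    clear - H0. induction N; simpl; [reflexivity|]. rewrite IHN, H0 by auto. ring.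
  - rewrite IHN by (auto; lia). rewrite (H N) by lia. ring.
Qed.

(* f k = 1 + O(q^(k+1)), so that the product over all k converges. *)
Definition unital (f : nat -> ps) : Prop := forall k, f k =[S k] #1.
Definition iprod (f : nat -> ps) : ps := fun n => prodp f (S n) n.

Lemma prodp_stable f N M : unital f -> (N <= M)%nat -> prodp f M =[S N] prodp f N.
Proof.
  intros H L. induction L; [apply eqN_refl|]. simpl.
  eapply eqN_trans; [apply eqN_mul; [apply IHL|]|].
  - apply (eqN_le (S m)); [lia|apply H].
  - replace (prodp f N * #1) with (prodp f N) by ring. apply eqN_refl.
Qed.

Lemma iprod_prodp f N : unital f -> iprod f =[S N] prodp f N.
Proof.
  intros H n Hn. unfold iprod.
  rewrite (prodp_stable f n (S n)) by (auto; lia). symmetry. apply (prodp_stable f n N); auto; lia.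
Qed.

Lemma unital_mul f g : unital f -> unital g -> unital (fun k => f k * g k).
Proof.
  intros Hf Hg k. eapply eqN_trans; [apply eqN_mul; auto|].
  replace (#1 * #1) with (#1) by ring. apply eqN_refl.
Qed.

Lemma iprod_mul f g : unital f -> unital g -> iprod f * iprod g = iprod (fun k => f k * g k).
Proof.
  intros Hf Hg. apply eqN_all. intros N. apply (eqN_le (S N)); [lia|].
  eapply eqN_trans; [apply eqN_mul; apply iprod_prodp; auto|].
  rewrite <- prodp_mul. apply eqN_sym, iprod_prodp, unital_mul; auto.
Qed.

Lemma unital_mono e a : (forall k, (k < a k)%nat) -> unital (fun k => #1 + #e * mono (a k)).
Proof.
  intros H k. replace (#1) with (#1 + #e * #0) at 2 by ring.
  apply eqN_add; [apply eqN_refl|]. apply eqN_mul; [apply eqN_refl|]. apply eqN_mono, H.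
Qed.

Lemma iprod_coef_0 f : unital f -> iprod f 0%nat = 1%Z.
Proof. intros H. rewrite (iprod_prodp f 0) by (auto; lia). reflexivity. Qed.

(** An infinite product is recorded by the exponents of its factors 1 - q^n. Multiplication adds
    exponents, so that a product identity becomes an equality of periodic functions of n, which
    [qprod_check] decides on one period. *)
Definition qprod (c : nat -> nat) : ps := iprod (fun k => (#1 + #(-1) * mono (S k)) ^ c (S k)).

Lemma qprod_unital c : unital (fun k => (#1 + #(-1) * mono (S k)) ^ c (S k)).
Proof.
  intros k. eapply eqN_trans; [apply eqN_pow, (unital_mono (-1) S); intros; lia|].
  rewrite ppow_1_l. apply eqN_refl.
Qed.

Lemma qprod_mul c d : qprod c * qprod d = qprod (fun n => c n + d n)%nat.
Proof.
  unfold qprod. rewrite iprod_mul by apply qprod_unital. f_equal. extensionality k.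
  now rewrite ppow_add.
Qed.

Lemma qprod_ext c d : (forall n, (0 < n)%nat -> c n = d n) -> qprod c = qprod d.
Proof. intros H. unfold qprod. f_equal. extensionality k. rewrite H; auto. lia. Qed.

Lemma qprod_coef_0 c : qprod c 0%nat = 1%Z.
Proof. apply iprod_coef_0, qprod_unital. Qed.

Lemma qprod_neq_0 c : qprod c <> #0.
Proof. apply (coef_neq_0 _ 0). rewrite qprod_coef_0. lia. Qed.

(** Reducing a as well lets a = c stand for the progression of the multiples of c. *)
Definition res (c a n : nat) : nat := if (n mod c =? a mod c)%nat then 1%nat else 0%nat.

Lemma iprod_progression a c : (0 < a <= c)%nat ->
  iprod (fun k => #1 + #(-1) * mono (a + c * k)) = qprod (res c a).
Proof.
  intros H. apply eqN_all. intros N. apply (eqN_le (S N)); [lia|].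
  eapply eqN_trans; [apply iprod_prodp, unital_mono; intros; nia|].
  apply eqN_sym. eapply eqN_trans; [apply (eqN_le (S (c * N))); [nia|]; apply iprod_prodp, qprod_unital|].
  match goal with |- ?x =[_] ?y => assert (x = y) as -> end; [|apply eqN_refl].
  clear -H. induction N; [now rewrite Nat.mul_0_r|].
  rewrite Nat.mul_succ_r, prodp_app, IHN. simpl. f_equal.
  rewrite (prodp_single _ _ (a - 1)); [|lia|].
  - replace (S (c * N + (a - 1))) with (a + c * N)%nat by lia.
    unfold res. replace (a + c * N)%nat with (a + N * c)%nat by lia.
    rewrite Nat.Div0.mod_add, Nat.eqb_refl. simpl. ring.
  - intros k Hk Hne. unfold res.
    replace (S (c * N + k)) with (S k + N * c)%nat by lia. rewrite Nat.Div0.mod_add.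
    destruct (Nat.eqb_spec (S k mod c) (a mod c)) as [E|]; [|reflexivity].
    exfalso. apply Hne.
    destruct (Nat.eq_dec (S k) c) as [E1|E1], (Nat.eq_dec a c) as [E2|E2];
      try rewrite E1, Nat.Div0.mod_same in E; try rewrite E2, Nat.Div0.mod_same in E;
      rewrite ?Nat.mod_small in E by lia; lia.
Qed.

(** * Gaussian binomials and the finite triple product *)

Section Gauss.
Variable Q : ps.

(** The Gaussian binomial coefficient, given by the q-Pascal rule so that no division of series
    occurs; [gb_qfact] is its usual quotient formula with the denominators cleared. *)
Fixpoint gb (M j : nat) : ps :=
  match M, j with
  | _, O => #1
  | O, S _ => #0
  | S M', S j' => gb M' (S j') + Q ^ (M' - j') * gb M' j'
  end.
Definition qfact (n : nat) : ps := prodp (fun k => #1 - Q ^ S k) n.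

Lemma gb_0_r M : gb M 0 = #1.
Proof. destruct M; reflexivity. Qed.

Lemma gb_big M : forall j, (M < j)%nat -> gb M j = #0.
Proof.
  induction M; intros [|j] H; try lia; simpl; [reflexivity|]. rewrite !IHM by lia. ring.
Qed.

Lemma gb_qfact M : forall j k, M = (j + k)%nat -> gb M j * qfact j * qfact k = qfact M.
Proof.
  induction M; intros [|j] k E; try lia.
  - assert (k = 0)%nat as -> by lia. unfold qfact. simpl. ring.
  - assert (k = S M) as -> by lia. rewrite gb_0_r. unfold qfact. simpl. ring.
  - destruct k as [|k].
    + assert (j = M) as -> by lia. simpl gb. rewrite gb_big, Nat.sub_diag by lia.
      specialize (IHM M 0%nat ltac:(lia)).
      assert (qfact (S M) = qfact M * (#1 - Q ^ S M)) as -> by reflexivity.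
      transitivity (gb M M * qfact M * qfact 0 * (#1 - Q ^ S M)); [simpl; ring|].
      now rewrite IHM.
    + assert (M = j + S k)%nat as EM by lia.
      pose proof (IHM j (S k) EM) as H1. pose proof (IHM (S j) k ltac:(lia)) as H2.
      simpl gb. replace (M - j)%nat with (S k) by lia.
      assert (qfact (S M) = qfact M * (#1 - Q ^ S M)) as -> by reflexivity.
      assert (qfact (S j) = qfact j * (#1 - Q ^ S j)) as A1 by reflexivity.
      assert (qfact (S k) = qfact k * (#1 - Q ^ S k)) as A2 by reflexivity.
      replace (S M) with (S j + S k)%nat by lia.
      transitivity (gb M (S j) * qfact (S j) * qfact k * (#1 - Q ^ S k)
        + Q ^ S k * (gb M j * qfact j * qfact (S k)) * (#1 - Q ^ S j)).
      { rewrite A1, A2. ring. }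
      rewrite H1, H2, ppow_add. ring.
Qed.

Fixpoint tri (n : nat) : nat := match n with O => O | S n' => (tri n' + n')%nat end.

(** The q-binomial theorem in homogeneous form. The triple product is centred by a factor Q^(-N),
    which is not a power series; Y = Q^N takes its place. *)
Lemma gauss_binomial Y Z M :
  prodp (fun k => Y + Z * Q ^ k) M =
  sump (fun j => gb M j * Q ^ tri j * Z ^ j * Y ^ (M - j)) (S M).
Proof.
  induction M; [simpl; ring|].
  simpl prodp. rewrite IHM. clear IHM.
  transitivity (sump (fun j => gb M j * Q ^ tri j * Z ^ j * Y ^ (S M - j)) (S M)
     + sump (fun j => Q ^ (M - j) * gb M j * Q ^ tri (S j) * Z ^ S j * Y ^ (S M - S j)) (S M)).
  { transitivity (Y * sump (fun j => gb M j * Q ^ tri j * Z ^ j * Y ^ (M - j)) (S M)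
      + Z * Q ^ M * sump (fun j => gb M j * Q ^ tri j * Z ^ j * Y ^ (M - j)) (S M)); [ring|].
    rewrite <- !sump_scal. f_equal; apply sump_ext; intros j Hj.
    - replace (S M - j)%nat with (S (M - j)) by lia. simpl. ring.
    - replace M with ((M - j) + j)%nat at 1 by lia. simpl tri.
      rewrite !ppow_add. simpl. ring. }
  rewrite (sump_first _ (S M)), (sump_first _ M).
  rewrite (sump_ext (fun k => gb (S M) (S k) * _ * _ * _) (fun k =>
    gb M (S k) * Q ^ tri (S k) * Z ^ S k * Y ^ (S M - S k) +
    Q ^ (M - k) * gb M k * Q ^ tri (S k) * Z ^ S k * Y ^ (S M - S k)) (S M)).
  2:{ intros k _. simpl gb. ring. }
  rewrite sump_add, !gb_0_r.
  rewrite (sump_S (fun k => gb M (S k) * _ * _ * _) M), (gb_big M (S M)) by lia. ring.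
Qed.
End Gauss.

(** The power e^n of a sign e, valid for negative n too. *)
Definition epow (e : Z) (n : Z) : Z := if Z.even n then 1%Z else e.

(** This is a n(n+1)/2 + b n(n-1)/2, the exponent in Ramanujan's theta function f(q^a, q^b). *)
Definition jexp (a b : nat) (n : Z) : Z := (Z.of_nat a * n + Z.of_nat (a + b) * (n * (n - 1) / 2))%Z.

Lemma jexp_proper a b w : (0 < a)%nat -> (0 < b)%nat -> proper (jexp a b) w.
Proof.
  intros Ha Hb n _. unfold jexp.
  assert (exists t, n * (n - 1) = 2 * t)%Z as [t Ht].
  { exists (n * (n - 1) / 2)%Z. assert ((n * (n - 1)) mod 2 = 0)%Z; [|lia].
    rewrite Zmult_mod. assert (n mod 2 = 0 \/ n mod 2 = 1)%Z as [E|E] by lia.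
    - rewrite E. reflexivity.
    - replace ((n - 1) mod 2)%Z with 0%Z by lia. rewrite Z.mul_0_r. reflexivity. }
  rewrite Ht, Z.mul_comm, (Z.mul_comm 2 t), Z.div_mul by lia.
  rewrite Nat2Z.inj_add. destruct (Z.le_gt_cases 0 n).
  - assert (0 <= t)%Z by nia.
    assert (n <= Z.of_nat a * n)%Z by nia. assert (0 <= (Z.of_nat a + Z.of_nat b) * t)%Z by nia. lia.
  - assert (0 <= t + n)%Z by nia. assert (- n <= t)%Z by nia.
    assert (0 <= Z.of_nat a * (t + n))%Z by nia. assert (t <= Z.of_nat b * t)%Z by nia. lia.
Qed.

Lemma tri_2 n : (2 * Z.of_nat (tri n) = Z.of_nat n * (Z.of_nat n - 1))%Z.
Proof. induction n; [reflexivity|]. simpl tri. lia. Qed.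

Lemma cst_pow z n : (#z) ^ n = #(z ^ Z.of_nat n).
Proof.
  induction n; [reflexivity|]. simpl ppow. rewrite IHn, pmul_cst_l. extensionality k.
  rewrite Nat2Z.inj_succ, Z.pow_succ_r by lia. unfold cst. destruct (k =? 0)%nat; ring.
Qed.

Section Jacobi.
Variables (e : Z) (a b : nat).
Hypotheses (He : (e * e = 1)%Z) (Ha : (0 < a)%nat) (Hb : (0 < b)%nat).
Let c := (a + b)%nat.
Let Q := mono c.
Let A := #e * mono a.
Let B := #e * mono b.

Lemma AB_Q : A * B = Q.
Proof.
  unfold A, B, Q, c. rewrite <- mono_mul.
  transitivity (#e * #e * (mono a * mono b)); [ring|].
  assert (#e * #e = #1) as ->; [|ring].
  rewrite pmul_cst_l. extensionality n. unfold cst. destruct (n =? 0)%nat; lia.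
Qed.

Lemma mono_prod_tri N : prodp (fun k => Q ^ k) N = Q ^ tri N.
Proof. induction N; simpl; [reflexivity|]. rewrite IHN, ppow_add. ring. Qed.

Lemma prodp_cst f N : prodp (fun _ => f) N = f ^ N.
Proof. induction N; simpl; [reflexivity|]. rewrite IHN. ring. Qed.

(** Since A B = Q, a factor of the lower half is Q^N + A Q^(N-1-k) = A Q^(N-1-k) (1 + B Q^k); the
    upper half gives Q^N (1 + A Q^k). *)
Lemma jacobi_lhs N :
  prodp (fun k => Q ^ N + A * Q ^ k) (N + N) =
  A ^ N * Q ^ tri N * Q ^ (N * N) * prodp (fun k => (#1 + A * Q ^ k) * (#1 + B * Q ^ k)) N.
Proof.
  rewrite prodp_app, prodp_mul.
  rewrite (prodp_rev (fun k => Q ^ N + A * Q ^ k)).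
  rewrite (prodp_ext (fun k => Q ^ N + A * Q ^ (N - 1 - k)%nat)
    (fun k => A * Q ^ (N - 1 - k)%nat * (#1 + B * Q ^ k))).
  2:{ intros k Hk. replace N with (S ((N - 1 - k) + k)) at 1 by lia.
      simpl. rewrite ppow_add, <- AB_Q at 1. ring. }
  rewrite (prodp_ext (fun k => Q ^ N + A * Q ^ (N + k)%nat) (fun k => Q ^ N * (#1 + A * Q ^ k))).
  2:{ intros k _. rewrite ppow_add. ring. }
  rewrite !prodp_mul, !prodp_cst, ppow_ppow.
  rewrite <- (prodp_rev (fun k => Q ^ k)), mono_prod_tri. ring.
Qed.

Definition jterm (N j : nat) : ps :=
  #(epow e (Z.of_nat j - Z.of_nat N)) * mono (Z.to_nat (jexp a b (Z.of_nat j - Z.of_nat N))).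

Lemma sign_pow n : (e ^ Z.of_nat n = epow e (Z.of_nat n))%Z.
Proof.
  induction n; [reflexivity|]. rewrite Nat2Z.inj_succ, Z.pow_succ_r, IHn by lia.
  unfold epow. rewrite Z.even_succ, <- Z.negb_even. destruct (Z.even _); simpl; lia.
Qed.

Lemma jterm_spec N j : (j <= N + N)%nat ->
  Q ^ tri j * A ^ j * (Q ^ N) ^ (N + N - j) = A ^ N * Q ^ tri N * Q ^ (N * N) * jterm N j.
Proof.
  intros Hj. unfold jterm, Q, A. rewrite !ppow_mul_base, !cst_pow, !mono_pow, !sign_pow.
  transitivity (#(epow e (Z.of_nat j)) * (mono (c * tri j) * mono (a * j) * mono (c * N * (N + N - j)))).
  { ring. }
  transitivity (#(epow e (Z.of_nat N)) * #(epow e (Z.of_nat j - Z.of_nat N)) *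
    (mono (a * N) * mono (c * tri N) * mono (c * (N * N)) *
    mono (Z.to_nat (jexp a b (Z.of_nat j - Z.of_nat N))))); [|ring].
  rewrite !mono_mul. f_equal.
  - rewrite pmul_cst_l. extensionality k. unfold cst. destruct (k =? 0)%nat; [|ring].
    unfold epow. rewrite Z.even_sub. destruct (Z.even (Z.of_nat j)), (Z.even (Z.of_nat N)); cbn [Bool.eqb]; lia.
  - f_equal. pose proof (jexp_proper a b (fun _ => 1%Z) Ha Hb (Z.of_nat j - Z.of_nat N)%Z ltac:(lia)) as P.
    assert (E : (jexp a b (Z.of_nat j - Z.of_nat N) = Z.of_nat a * (Z.of_nat j - Z.of_nat N)
      + Z.of_nat c * (Z.of_nat (tri j) - Z.of_nat (tri N) + Z.of_nat N * Z.of_nat N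
        - Z.of_nat N * Z.of_nat j))%Z).
    { unfold jexp. fold c. do 2 f_equal. pose proof (tri_2 j). pose proof (tri_2 N).
      symmetry; apply Z.div_unique_exact; [lia|]. nia. }
    apply Nat2Z.inj. rewrite !Nat2Z.inj_add, Z2Nat.id by lia. rewrite E.
    rewrite !Nat2Z.inj_mul, Nat2Z.inj_sub, !Nat2Z.inj_add by lia. ring.
Qed.

Lemma A_neq_0 : A <> #0.
Proof.
  intros E. apply (mono_neq_0 c). change (mono c) with Q. rewrite <- AB_Q, E. ring.
Qed.

(** The q-binomial theorem for 2N factors, after the common monomial factor is cancelled. *)
Lemma finite_jacobi N :
  prodp (fun k => (#1 + A * Q ^ k) * (#1 + B * Q ^ k)) N =
  sump (fun j => gb Q (N + N) j * jterm N j) (S (N + N)).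
Proof.
  apply (pmul_cancel (A ^ N * Q ^ tri N * Q ^ (N * N))).
  { repeat apply pmul_neq_0; apply ppow_neq_0; (apply A_neq_0 || apply mono_neq_0). }
  rewrite <- jacobi_lhs, gauss_binomial, <- sump_scal. apply sump_ext. intros j Hj.
  transitivity (gb Q (N + N) j * (A ^ N * Q ^ tri N * Q ^ (N * N) * jterm N j)); [|ring].
  rewrite <- jterm_spec by lia. ring.
Qed.

Let E := iprod (fun k => #1 - Q ^ S k).

Lemma E_unital : unital (fun k => #1 - Q ^ S k).
Proof.
  intros k. replace (#1) with (#1 - #0) at 2 by ring.
  apply eqN_sub; [apply eqN_refl|]. unfold Q. rewrite mono_pow. apply eqN_mono. unfold c. nia.
Qed.

(** In the quotient formula for the Gaussian binomial all three finite products agree with E up to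
    order N. This gives the claim multiplied by E, which is invertible. *)
Lemma gb_limit N M j K : M = (j + K)%nat -> (N <= j)%nat -> (N <= K)%nat ->
  gb Q M j * E =[S N] #1.
Proof.
  intros HM Hj HK.
  assert (F : forall n, (N <= n)%nat -> E =[S N] qfact Q n).
  { intros n Hn. apply (eqN_le (S n)); [lia|]. apply iprod_prodp, E_unital. }
  assert (C : gb Q M j * E * E =[S N] E).
  { eapply eqN_trans; [apply eqN_mul; [apply eqN_mul; [apply eqN_refl|apply (F j Hj)]|apply (F K HK)]|].
    rewrite gb_qfact by exact HM. apply eqN_sym, F. lia. }
  assert (E0 : E 0%nat = 1%Z) by apply iprod_coef_0, E_unital.
  replace (gb Q M j * E) with (gb Q M j * E * E * pinv E).
  2:{ transitivity (gb Q M j * E * (E * pinv E)); [ring|]. rewrite mul_pinv by auto. ring. }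
  rewrite <- (mul_pinv E E0). apply eqN_mul; [exact C|apply eqN_refl].
Qed.

Lemma eqN_shift N k f g : f =[N] g -> f * mono k =[N + k] g * mono k.
Proof. intros H. apply eqN_mul_gen; auto. apply eqN_mono; lia. Qed.

Theorem jacobi_triple :
  iprod (fun k => (#1 + A * Q ^ k) * (#1 + B * Q ^ k)) * E = theta (jexp a b) (epow e).
Proof.
  apply eqN_all. intros N. apply (eqN_le (S N)); [lia|].
  assert (U : unital (fun k => (#1 + A * Q ^ k) * (#1 + B * Q ^ k))).
  { apply unital_mul; intros k; unfold A, B, Q; rewrite mono_pow.
    - replace (#e * mono a * mono (c * k)) with (#e * (mono a * mono (c * k))) by ring.
      rewrite mono_mul. apply (unital_mono e (fun k => a + c * k)%nat). unfold c. intros; nia.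
    - replace (#e * mono b * mono (c * k)) with (#e * (mono b * mono (c * k))) by ring.
      rewrite mono_mul. apply (unital_mono e (fun k => b + c * k)%nat). unfold c. intros; nia. }
  eapply eqN_trans; [apply eqN_mul; [apply iprod_prodp, U|apply eqN_refl]|].
  rewrite finite_jacobi. rewrite pmul_comm, <- sump_scal.
  eapply eqN_trans; [apply (eqN_sump _ _ (jterm N))|].
  - intros j Hj. unfold jterm.
    pose proof (jexp_proper a b (fun _ => 1%Z) Ha Hb (Z.of_nat j - Z.of_nat N)%Z ltac:(lia)) as P.
    set (x := jexp a b (Z.of_nat j - Z.of_nat N)) in *.
    set (s := epow e _). set (r := Nat.min j (N + N - j)).
    (* The binomial times E is 1 only up to order r = N - |j - N|, but the monomial has order at
       least |j - N|, so that every term is correct through q^N. *)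
    apply (eqN_le (S r + Z.to_nat x)); [unfold r; lia|].
    replace (E * (gb Q (N + N) j * (#s * mono (Z.to_nat x)))) with
      (#s * (gb Q (N + N) j * E * mono (Z.to_nat x))) by ring.
    apply eqN_mul; [apply eqN_refl|].
    replace (mono (Z.to_nat x)) with (#1 * mono (Z.to_nat x)) at 2 by ring.
    apply eqN_shift. apply (gb_limit r _ _ (N + N - j)); unfold r; lia.
  - intros n Hn. rewrite (theta_box _ _ n N) by (try lia; now apply jexp_proper).
    rewrite sump_coef. unfold zr. rewrite lsum_map.
    replace (2 * N + 1)%nat with (S (N + N)) by lia. apply lsum_ext. intros j _.
    unfold jterm. rewrite pmul_cst_l. unfold at_exp, mono.
    pose proof (jexp_proper a b (fun _ => 1%Z) Ha Hb (Z.of_nat j - Z.of_nat N)%Z ltac:(lia)) as P.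
    destruct (Nat.eqb_spec n (Z.to_nat (jexp a b (Z.of_nat j - Z.of_nat N)))),
      (Z.eqb_spec (jexp a b (Z.of_nat j - Z.of_nat N)) (Z.of_nat n)); lia.
Qed.
End Jacobi.

Lemma jacobi_minus a b : (0 < a)%nat -> (0 < b)%nat ->
  theta (jexp a b) (epow (-1)) =
  qprod (res (a + b) a) * qprod (res (a + b) b) * qprod (res (a + b) (a + b)).
Proof.
  intros Ha Hb. rewrite <- jacobi_triple, <- !iprod_progression by lia.
  rewrite (iprod_mul (fun k => _ + _ * mono (a + _)) (fun k => _ + _ * mono (b + _)))
    by (apply unital_mono; intros; nia).
  f_equal; f_equal; extensionality k.
  - rewrite mono_pow, <- !mono_mul. ring.
  - rewrite mono_pow. replace ((a + b) * S k)%nat with (a + b + (a + b) * k)%nat by lia. ring.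
Qed.

(** Products of factors 1 + x have no description by exponents of the 1 - q^n with natural values;
    multiplying by 1 - x turns them into 1 - x^2. *)
Lemma jacobi_plus a b : (0 < a)%nat -> (0 < b)%nat ->
  theta (jexp a b) (epow 1) * (qprod (res (a + b) a) * qprod (res (a + b) b)) =
  qprod (res (2 * (a + b)) (2 * a)) * qprod (res (2 * (a + b)) (2 * b)) *
  qprod (res (a + b) (a + b)).
Proof.
  intros Ha Hb. rewrite <- jacobi_triple, <- !iprod_progression by lia.
  rewrite (iprod_mul (fun k => _ + _ * mono (a + _)) (fun k => _ + _ * mono (b + _))),
    (iprod_mul (fun k => _ + _ * mono (2 * a + _)) (fun k => _ + _ * mono (2 * b + _)))
    by (apply unital_mono; intros; nia).
  match goal with |- ?x * ?y * ?z = _ => transitivity ((x * z) * y); [ring|] end.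
  rewrite iprod_mul.
  - f_equal; f_equal; extensionality k.
    + rewrite mono_pow.
      replace (2 * a + 2 * (a + b) * k)%nat with ((a + (a + b) * k) + (a + (a + b) * k))%nat by lia.
      replace (2 * b + 2 * (a + b) * k)%nat with ((b + (a + b) * k) + (b + (a + b) * k))%nat by lia.
      rewrite <- !mono_mul. ring.
    + rewrite mono_pow. replace ((a + b) * S k)%nat with (a + b + (a + b) * k)%nat by lia. ring.
  - apply unital_mul.
    + intros k. rewrite mono_pow. eapply eqN_trans; [|apply (unital_mono 1 (fun k => a + (a + b) * k)%nat); intros; nia].
      rewrite <- !mono_mul. replace (#1 + #1 * mono a * mono ((a + b) * k)) with
        (#1 + #1 * (mono a * mono ((a + b) * k))) by ring. apply eqN_refl.
    + intros k. rewrite mono_pow. eapply eqN_trans; [|apply (unital_mono 1 (fun k => b + (a + b) * k)%nat); intros; nia].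
      rewrite <- !mono_mul. replace (#1 + #1 * mono b * mono ((a + b) * k)) with
        (#1 + #1 * (mono b * mono ((a + b) * k))) by ring. apply eqN_refl.
  - apply unital_mul; apply unital_mono; intros; nia.
Qed.

Lemma dil_qprod t c : (0 < t)%nat -> (0 < c)%nat ->
  dil t (qprod (res c c)) = qprod (res (t * c) (t * c)).
Proof.
  intros Ht Hc. rewrite <- !iprod_progression by nia.
  apply eqN_all. intros N. apply (eqN_le (t * S N)); [nia|].
  eapply eqN_trans; [apply eqN_dil; [lia|]; apply iprod_prodp, unital_mono; intros; nia|].
  assert (E : dil t (prodp (fun k => #1 + #(-1) * mono (c + c * k)) N) =
    prodp (fun k => #1 + #(-1) * mono (t * c + t * c * k)) N).
  { induction N; simpl; [now apply dil_cst|].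
    rewrite dil_mul, IHN, dil_add, dil_mul, !dil_cst, dil_mono by lia.
    do 4 f_equal. lia. }
  rewrite E. clear E. intros n Hn. symmetry.
  pose (f := fun k => #1 + #(-1) * mono (t * c + t * c * k)).
  assert (V : forall k, f k =[t * S k] #1).
  { intros k. replace (#1) with (#1 + #(-1) * #0) at 1 by ring. unfold f.
    apply eqN_add; [apply eqN_refl|]. apply eqN_mul; [apply eqN_refl|]. apply eqN_mono. nia. }
  fold f. assert (S : forall M, (N <= M)%nat -> prodp f M =[t * S N] prodp f N).
  { intros M L. induction L; [apply eqN_refl|]. simpl.
    eapply eqN_trans; [apply eqN_mul; [apply IHL|apply (eqN_le (t * S m)); [nia|apply V]]|].
    replace (prodp f N * #1) with (prodp f N) by ring. apply eqN_refl. }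
  rewrite (iprod_prodp f (N + n)) by (try lia; apply unital_mono; intros; nia).
  apply S; [lia|exact Hn].
Qed.

(* Ramanujan's phi(-q) and psi(q). *)
Definition phi : ps := theta sq (epow (-1)).
Definition psi : ps := theta (jexp 3 1) (epow 1).
Definition euler_1 : ps := qprod (res 1 1).
Definition euler_2 : ps := qprod (res 2 2).

Lemma res_period c a m t r : (m mod c = 0)%nat -> res c a (m * t + r) = res c a r.
Proof.
  intros H. unfold res. destruct c as [|c].
  - simpl in *. now subst.
  - apply Nat.Div0.div_exact in H. rewrite H.
    replace (S c * (m / S c) * t + r)%nat with (r + (m / S c * t) * S c)%nat by lia.
    now rewrite Nat.Div0.mod_add.
Qed.

Ltac qprod_check m :=
  rewrite !qprod_mul; apply qprod_ext;
  let n := fresh "n" in let t := fresh "t" in let r := fresh "r" in let Hr := fresh "Hr" in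
  intros n _; destruct (nat_divmod m n ltac:(lia)) as (t & r & Hr & ->);
  rewrite !(res_period _ _ m t r) by reflexivity;
  repeat (first [exfalso; lia | destruct r as [|r]; [reflexivity|]]).

Lemma half_pronic n : (2 * (n * (n - 1) / 2) = n * (n - 1))%Z.
Proof.
  assert (E : ((n * (n - 1)) mod 2 = 0)%Z).
  { rewrite Zmult_mod. assert (n mod 2 = 0 \/ n mod 2 = 1)%Z as [E|E] by lia.
    - rewrite E. reflexivity.
    - replace ((n - 1) mod 2)%Z with 0%Z by lia. rewrite Z.mul_0_r. reflexivity. }
  lia.
Qed.

Lemma phi_product : phi * euler_2 = euler_1 ^ 2.
Proof.
  assert (phi = theta (jexp 1 1) (epow (-1))) as ->.
  { unfold phi. f_equal. extensionality n. unfold jexp, sq. simpl (Z.of_nat _).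
    pose proof (half_pronic n). lia. }
  rewrite jacobi_minus by lia. unfold euler_1, euler_2. simpl ppow.
  transitivity (qprod (res 1 1) * qprod (res 1 1)); [|ring].
  qprod_check 2%nat.
Qed.

Lemma psi_product : psi * euler_1 = euler_2 ^ 2.
Proof.
  assert (H : psi * (qprod (res 4 3) * qprod (res 4 1)) =
    qprod (res 8 6) * qprod (res 8 2) * qprod (res 4 4)) by (apply (jacobi_plus 3 1); lia).
  assert (euler_1 = qprod (res 4 3) * qprod (res 4 1) * qprod (res 2 2)) as ->
    by (unfold euler_1; qprod_check 4%nat).
  rewrite pmul_assoc, H. unfold euler_2. simpl ppow.
  transitivity (qprod (res 2 2) * qprod (res 2 2)); [|ring].
  qprod_check 8%nat.
Qed.

Lemma phi_psi : phi * psi = euler_1 * euler_2.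
Proof.
  apply (pmul_cancel (euler_1 * euler_2)).
  - apply pmul_neq_0; apply qprod_neq_0.
  - transitivity ((phi * euler_2) * (psi * euler_1)); [ring|]. rewrite phi_product, psi_product. ring.
Qed.

(** The four theta functions are, up to scaling of q, the components of the 5-dissections of phi(-q)
    and psi(q). In their product the factors 1 - q^n with n prime to 5 cancel, and the others form
    the square of [euler_1 * euler_2] at q^5. *)
Lemma four_thetas :
  theta (jexp 7 3) (epow (-1)) * theta (jexp 9 1) (epow (-1)) *
  (theta (jexp 3 2) (epow 1) * theta (jexp 1 4) (epow 1)) = dil 5 phi ^ 2 * dil 5 psi ^ 2.
Proof.
  transitivity (dil 5 (phi * psi) ^ 2); [|rewrite dil_mul by lia; ring].
  rewrite phi_psi. unfold euler_1, euler_2. rewrite dil_mul, !dil_qprod by lia. simpl (5 * _)%nat.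
  pose proof (jacobi_plus 3 2 ltac:(lia) ltac:(lia)) as H1.
  pose proof (jacobi_plus 1 4 ltac:(lia) ltac:(lia)) as H2.
  simpl Nat.add in *; simpl Nat.mul in *.
  apply (pmul_cancel (qprod (res 5 3) * qprod (res 5 2) * (qprod (res 5 1) * qprod (res 5 4)))).
  { repeat apply pmul_neq_0; apply qprod_neq_0. }
  match goal with |- (?x * ?y) * (?u * (?v * ?w)) = _ =>
    transitivity (u * ((v * x) * (w * y))); [ring|] end.
  rewrite H1, H2, !jacobi_minus by lia. simpl Nat.add. simpl ppow.
  match goal with |- _ = ?l * (?x * (?x * _)) => transitivity (l * (x * x)); [|ring] end.
  qprod_check 10%nat.
Qed.

(** * Relations between phi and psi at levels 1, 5 and 25 *)

(** The sum over odd squares is 2 q psi(q^8). In this form psi is a sum over squares like phi and is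
    dissected by the same lattice argument; the price is that phi has to be taken at q^8 in the
    relations with psi. *)
Definition odd_weight (x : Z) : Z := if Z.even x then 0%Z else 1%Z.
Definition theta_odd : ps := theta sq odd_weight.

Lemma even_mod2 x : Z.even x = (x mod 2 =? 0)%Z.
Proof. now rewrite Zmod_even; destruct (Z.even x). Qed.

Lemma epow_parity e x y : (x mod 2 = y mod 2)%Z -> epow e x = epow e y.
Proof. intros H. unfold epow. now rewrite !even_mod2, H. Qed.
Lemma odd_weight_parity x y : (x mod 2 = y mod 2)%Z -> odd_weight x = odd_weight y.
Proof. intros H. unfold odd_weight. now rewrite !even_mod2, H. Qed.

(** Completing the square: a theta function with a linear term in its exponent is a sum over squares
    restricted to an arithmetic progression. z carries the sign of the weight at the base point
    r. *)
Lemma theta_progression (k r s z : Z) (t m a b : nat) (w : Z -> Z) (e : Z) :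
  (k <> 0)%Z -> (0 < t)%nat -> (0 < a)%nat -> (0 < b)%nat -> (z <> 0)%Z ->
  (forall j, sq (k * j + r) = Z.of_nat m + Z.of_nat t * jexp a b j)%Z ->
  (forall j, w (k * j + r)%Z = z * epow e j)%Z ->
  (forall x, w x <> 0%Z -> exists j, x = k * j + r)%Z ->
  theta sq w = #z * mono m * dil t (theta (jexp a b) (epow e)).
Proof.
  intros Hk Ht Ha Hb Hz He Hw Hs.
  assert (P : proper (jexp a b) (epow e)) by now apply jexp_proper.
  rewrite theta_dil, <- pmul_assoc, theta_shift, theta_cst_mul by (auto using proper_scal).
  apply (theta_reindex (fun j => k * j + r)%Z).
  - apply sq_proper.
  - intros x _. pose proof (jexp_proper a b (fun _ => 1%Z) Ha Hb x ltac:(lia)). nia.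
  - intros i j E. nia.
  - exact Hw.
  - intros j _. apply He.
  - exact Hs.
Qed.

Definition th (r : Z) : ps := theta sq (on_class 5 r (epow (-1))).
Definition Jr (r : Z) : ps := theta sq (on_class 5 r odd_weight).

Ltac parity := unfold on_class, odd_weight, epow; rewrite ?even_mod2;
  repeat match goal with |- context [(?x =? ?y)%Z] => destruct (Z.eqb_spec x y) end; lia.
Ltac jexp_eq := intros j; unfold sq, jexp; simpl Nat.add; simpl Z.of_nat; pose proof (half_pronic j); lia.

Lemma J_psi : theta_odd = #2 * mono 1 * dil 8 psi.
Proof.
  assert (theta_odd = theta sq (on_class 4 1 odd_weight) + theta sq (on_class 4 3 odd_weight)) as ->.
  { rewrite theta_add. apply theta_ext. intros x. parity. }
  rewrite (theta_progression 4 1 0 1 8 1 3 1 (on_class 4 1 odd_weight) 1); try lia;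
   [|jexp_eq|intros j; parity|].
  rewrite (theta_progression (-4) (-1) 0 1 8 1 3 1 (on_class 4 3 odd_weight) 1); try lia;
   [|jexp_eq|intros j; parity|].
  - fold psi. ring.
  - intros x. unfold on_class. destruct (Z.eqb_spec (x mod 4) 3); [|lia].
    intros _. exists (- ((x + 1) / 4))%Z. lia.
  - intros x. unfold on_class. destruct (Z.eqb_spec (x mod 4) 1); [|lia].
    intros _. exists (x / 4)%Z. lia.
Qed.

Lemma th1_jacobi : th 1 = #(-1) * mono 1 * dil 5 (theta (jexp 7 3) (epow (-1))).
Proof.
  apply (theta_progression 5 1 0 (-1) 5 1 7 3); try lia; [jexp_eq|intros j; parity|].
  intros x. unfold on_class. destruct (Z.eqb_spec (x mod 5) 1); [|lia].
  intros _. exists (x / 5)%Z. lia.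
Qed.
Lemma th2_jacobi : th 2 = #1 * mono 4 * dil 5 (theta (jexp 9 1) (epow (-1))).
Proof.
  apply (theta_progression 5 2 0 1 5 4 9 1); try lia; [jexp_eq|intros j; parity|].
  intros x. unfold on_class. destruct (Z.eqb_spec (x mod 5) 2); [|lia].
  intros _. exists (x / 5)%Z. lia.
Qed.
Lemma J1_jacobi : Jr 1 = #1 * mono 1 * dil 40 (theta (jexp 3 2) (epow 1)).
Proof.
  apply (theta_progression 10 1 0 1 40 1 3 2); try lia; [jexp_eq|intros j; parity|].
  intros x. unfold on_class, odd_weight. rewrite even_mod2.
  destruct (Z.eqb_spec (x mod 5) 1); [|lia]. destruct (Z.eqb_spec (x mod 2) 0); [lia|].
  intros _. exists (x / 10)%Z. lia.
Qed.
Lemma J2_jacobi : Jr 2 = #1 * mono 9 * dil 40 (theta (jexp 1 4) (epow 1)).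
Proof.
  apply (theta_progression 10 (-3) 0 1 40 9 1 4); try lia; [jexp_eq|intros j; parity|].
  intros x. unfold on_class, odd_weight. rewrite even_mod2.
  destruct (Z.eqb_spec (x mod 5) 2); [|lia]. destruct (Z.eqb_spec (x mod 2) 0); [lia|].
  intros _. exists ((x + 3) / 10)%Z. lia.
Qed.

Lemma phi_sq_dissect : dil 5 phi ^ 2 = dil 25 phi ^ 2 + #4 * th 1 * th 2.
Proof.
  unfold phi, th. rewrite theta_sq_dissect, theta_class_0 by apply epow_parity. reflexivity.
Qed.
Lemma phi_dissect : phi = dil 25 phi + #2 * th 1 + #2 * th 2.
Proof.
  unfold phi, th. rewrite theta_dissect at 1 by apply epow_parity.
  rewrite theta_class_0 by apply epow_parity. reflexivity.
Qed.
Lemma J_sq_dissect : dil 5 theta_odd ^ 2 = dil 25 theta_odd ^ 2 + #4 * Jr 1 * Jr 2.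
Proof.
  unfold theta_odd, Jr. rewrite theta_sq_dissect, theta_class_0 by apply odd_weight_parity. reflexivity.
Qed.
Lemma J_dissect : theta_odd = dil 25 theta_odd + #2 * Jr 1 + #2 * Jr 2.
Proof.
  unfold theta_odd, Jr. rewrite theta_dissect at 1 by apply odd_weight_parity.
  rewrite theta_class_0 by apply odd_weight_parity. reflexivity.
Qed.

(** This product couples the dissection of phi to that of psi. The sign comes from [th 1], and the
    monomials balance because 8 + 32 + 1 + 9 = 25 + 25. *)
Lemma four_classes :
  #4 * (dil 8 (th 1) * dil 8 (th 2)) * (Jr 1 * Jr 2) = - (dil 200 phi ^ 2 * dil 25 theta_odd ^ 2).
Proof.
  rewrite th1_jacobi, th2_jacobi, J1_jacobi, J2_jacobi, J_psi.
  rewrite !dil_mul, !dil_cst, !dil_mono, !dil_dil by lia. simpl Nat.mul.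
  transitivity (#(-4) * (mono 8 * mono 32 * mono 1 * mono 9) *
   dil 40 (theta (jexp 7 3) (epow (-1)) * theta (jexp 9 1) (epow (-1)) *
   (theta (jexp 3 2) (epow 1) * theta (jexp 1 4) (epow 1)))).
  { rewrite !dil_mul by lia. ring. }
  rewrite four_thetas, !mono_mul, dil_mul, !dil_pow, !dil_dil by lia. simpl Nat.add. simpl Nat.mul.
  transitivity (- (#4 * (mono 25 * mono 25) * dil 200 phi ^ 2 * dil 200 psi ^ 2)); [|ring].
  rewrite mono_mul. simpl Nat.add. ring.
Qed.

(** The dissections of the squares express the differences through [th 1 * th 2] and [Jr 1 * Jr 2],
    whose product is known from [four_classes]. *)
Lemma J_level : (dil 40 phi ^ 2 - dil 200 phi ^ 2) * (dil 5 theta_odd ^ 2 - dil 25 theta_odd ^ 2) =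
  #(-4) * dil 25 theta_odd ^ 2 * dil 200 phi ^ 2.
Proof.
  pose proof (f_equal (dil 8) phi_sq_dissect) as H.
  rewrite dil_add, !dil_mul, !dil_pow, !dil_cst, !dil_dil in H by lia. simpl Nat.mul in H.
  rewrite H, J_sq_dissect.
  transitivity (#4 * (#4 * (dil 8 (th 1) * dil 8 (th 2)) * (Jr 1 * Jr 2))); [ring|].
  rewrite four_classes. ring.
Qed.

(** All series in [J_level] are series in q^5, so q^5 may be replaced by q. Unlike [J_level], the
    result involves phi and [theta_odd] at the lowest level, where their 5-dissections can be
    inserted. *)
Lemma J_relation : (dil 8 phi ^ 2 - dil 40 phi ^ 2) * (theta_odd ^ 2 - dil 5 theta_odd ^ 2) =
  #(-4) * dil 5 theta_odd ^ 2 * dil 40 phi ^ 2.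
Proof.
  apply (dil_inj 5); [lia|].
  rewrite !dil_mul, !dil_sub, !dil_pow, !dil_cst, !dil_dil by lia. apply J_level.
Qed.

(* In terms of xi below: psi^2 xi = q psi(q^5)^2 (1 + 5 xi). *)
Lemma psi_relation : (phi ^ 2 - dil 5 phi ^ 2) * (psi ^ 2 - mono 1 * dil 5 psi ^ 2) =
  #(-4) * mono 1 * dil 5 psi ^ 2 * dil 5 phi ^ 2.
Proof.
  apply (dil_inj 8); [lia|]. apply (pmul_cancel (#4 * mono 2)).
  { apply pmul_neq_0; [apply (coef_neq_0 _ 0); discriminate|apply mono_neq_0]. }
  pose proof J_relation as H. rewrite J_psi in H.
  rewrite !dil_mul, !dil_cst, !dil_mono, !dil_dil in H by lia.
  rewrite !dil_mul, !dil_sub, !dil_mul, !dil_pow, !dil_cst, !dil_mono, !dil_dil by lia.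
  simpl Nat.mul in *.
  assert (M1 : mono 1 * mono 1 = mono 2) by now rewrite mono_mul.
  assert (M5 : mono 5 * mono 5 = mono 2 * mono 8) by now rewrite !mono_mul.
  transitivity ((dil 8 phi ^ 2 - dil 40 phi ^ 2) *
    (#4 * (mono 1 * mono 1) * dil 8 psi ^ 2 - #4 * (mono 5 * mono 5) * dil 40 psi ^ 2)).
  { rewrite M1, M5. ring. }
  etransitivity; [etransitivity; [|exact H]; ring|].
  transitivity (#(-16) * (mono 5 * mono 5) * dil 40 psi ^ 2 * dil 40 phi ^ 2); [ring|].
  rewrite M5. ring.
Qed.

(** * Separation of residue classes modulo 5 and elimination *)

Definition grade (r : nat) (f : ps) : Prop := forall n, (n mod 5 <> r)%nat -> f n = 0%Z.

Lemma grade_mul r s t f g : ((r + s) mod 5 = t)%nat -> grade r f -> grade s g -> grade t (f * g).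
Proof.
  intros <- Hf Hg n Hn. apply lsum_zero. intros i Hi. apply in_seq in Hi.
  destruct (Nat.eq_dec (i mod 5) r) as [E|E]; [|rewrite Hf by auto; ring].
  destruct (Nat.eq_dec ((n - i) mod 5) s) as [F|F]; [|rewrite Hg by auto; ring].
  exfalso. apply Hn. rewrite <- E, <- F, <- Nat.Div0.add_mod. f_equal. lia.
Qed.
Lemma grade_add r f g : grade r f -> grade r g -> grade r (f + g).
Proof. intros Hf Hg n Hn. unfold padd. now rewrite Hf, Hg. Qed.
Lemma grade_cst z : grade 0 (#z).
Proof. intros n Hn. unfold cst. destruct n; [now contradiction Hn|reflexivity]. Qed.
Lemma grade_scal r z f : grade r f -> grade r (#z * f).
Proof. intros H n Hn. rewrite pmul_cst_l, H by auto. ring. Qed.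
Lemma grade_dil k r f : (0 < k)%nat -> grade r f -> grade ((k * r) mod 5) (dil k f).
Proof.
  intros Hk H n Hn. apply dil_cases; auto; [|lia].
  intros a ->. apply H. intros <-. apply Hn. now rewrite Nat.Div0.mul_mod_idemp_r.
Qed.
Lemma grade_dil_0 k f : (0 < k)%nat -> (k mod 5 = 0)%nat -> grade 0 (dil k f).
Proof.
  intros Hk H n Hn. apply dil_cases; auto; [|lia].
  intros a ->. exfalso. apply Hn. rewrite <- Nat.Div0.mul_mod_idemp_l, H. reflexivity.
Qed.
Lemma grade_theta_class r s w : (r * r mod 5)%Z = Z.of_nat s -> grade s (theta sq (on_class 5 r w)).
Proof.
  intros H n Hn. apply lsum_zero. intros x _. unfold at_exp, on_class, sq.
  destruct (Z.eqb_spec (x * x) (Z.of_nat n)) as [E|]; auto.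
  destruct (Z.eqb_spec (x mod 5) r) as [F|]; auto.
  exfalso. apply Hn. rewrite <- F, <- Zmult_mod, E in H.
  apply Nat2Z.inj. now rewrite Nat2Z.inj_mod.
Qed.

Lemma grade_sum_0 f0 f1 f2 f3 f4 :
  grade 0 f0 -> grade 1 f1 -> grade 2 f2 -> grade 3 f3 -> grade 4 f4 ->
  f0 + f1 + f2 + f3 + f4 = #0 -> f2 = #0 /\ f3 = #0.
Proof.
  intros H0 H1 H2 H3 H4 E.
  assert (F : forall n, (f0 n + f1 n + f2 n + f3 n + f4 n = 0)%Z).
  { intros n. change ((f0 + f1 + f2 + f3 + f4) n = 0%Z). rewrite E.
    unfold cst. destruct (n =? 0)%nat; reflexivity. }
  assert (Z0 : forall n, #0 n = 0%Z) by (intros n; unfold cst; destruct (n =? 0)%nat; reflexivity).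
  split; extensionality n; rewrite Z0; specialize (F n).
  - destruct (Nat.eq_dec (n mod 5) 2) as [M|M]; [|now apply H2].
    rewrite H0, H1, H3, H4 in F by (rewrite M; discriminate). lia.
  - destruct (Nat.eq_dec (n mod 5) 3) as [M|M]; [|now apply H3].
    rewrite H0, H1, H2, H4 in F by (rewrite M; discriminate). lia.
Qed.

Lemma grade_sq r s f : ((r + r) mod 5 = s)%nat -> grade r f -> grade s (f ^ 2).
Proof.
  intros E H. replace (f ^ 2) with (f * f) by ring. now apply (grade_mul r r).
Qed.

Ltac find_grade f :=
  match f with
  | cst _ => constr:(0%nat)
  | ?x * ?y => let r := find_grade x in let s := find_grade y in eval compute in ((r + s) mod 5)%nat
  | ?x ^ 2 => let r := find_grade x in eval compute in ((r + r) mod 5)%nat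
  | ?x + _ => find_grade x
  | _ => match goal with H : grade ?r f |- _ => r end
  end.
Ltac graded :=
  lazymatch goal with
  | |- grade _ (_ + _) => apply grade_add; graded
  | |- grade _ (cst _) => apply grade_cst
  | |- grade _ (?f * ?g) =>
      let r := find_grade f in let s := find_grade g in
      apply (grade_mul r s); [reflexivity|graded|graded]
  | |- grade _ (?f ^ 2) => let r := find_grade f in apply (grade_sq r); [reflexivity|graded]
  | |- _ => assumption
  end.

Lemma two_neq_0 f : f <> #0 -> #2 * f <> #0.
Proof. intros H. apply pmul_neq_0; auto. apply (coef_neq_0 _ 0). discriminate. Qed.
Lemma dil_neq_0 k f : (0 < k)%nat -> f <> #0 -> dil k f <> #0.
Proof. intros Hk H E. apply H, (dil_inj k); auto. now rewrite dil_cst. Qed.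

(* Here w^2 = 0 for w = a^2 c + 2 tau (a d + iota b), so the two quadratic relations collapse
   to a^2 c = -2 tau (a d + iota b) and its mirror image. *)
Lemma quintic_elimination (a b c d tau iota : ps) :
  a <> #0 -> b <> #0 -> c <> #0 -> d <> #0 -> tau <> #0 -> iota <> #0 ->
  a * b * c * d + #4 * tau ^ 2 * iota ^ 2 = #0 ->
  a * b * c ^ 2 + #2 * tau * b * c * d + b ^ 2 * d ^ 2 + #2 * iota * a ^ 2 * c
    + #4 * tau * iota * a * d = #0 ->
  a * b * d ^ 2 + #2 * tau * a * c * d + a ^ 2 * c ^ 2 + #2 * iota * b ^ 2 * d
    + #4 * tau * iota * b * c = #0 ->
  (a ^ 5 + b ^ 5) * tau = (a * b) ^ 3 - #2 * (a * b) ^ 2 * tau ^ 2 + #8 * a * b * tau ^ 4.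
Proof.
  intros Ha Hb Hc Hd Ht Hi H G2 G3.
  (* In b times the third relation minus a times the second, all terms free of iota cancel. *)
  assert (D : b ^ 3 * d - a ^ 3 * c + #2 * tau * (b ^ 2 * c - a ^ 2 * d) = #0).
  { apply (pmul_eq_0 (#2 * iota)).
    - apply pmul_neq_0; auto. apply (coef_neq_0 _ 0). discriminate.
    - match type of G2 with ?g2 = _ => match type of G3 with ?g3 = _ =>
        transitivity (b * g3 - a * g2); [ring|rewrite G2, G3; ring] end end. }
  assert (W : a ^ 2 * c + #2 * tau * (a * d + iota * b) = #0).
  { match goal with |- ?w = _ => assert (S : w * w = #0) end.
    { apply (pmul_eq_0 a); auto.
      match type of H with ?h = _ => match type of G3 with ?g3 = _ => match type of D with ?dd = _ =>
        transitivity (#2 * b ^ 2 * tau * g3 + a * b ^ 2 * h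
          - dd * (#2 * a * d * tau + #4 * iota * b * tau + a ^ 2 * c)); [ring|rewrite H, G3, D; ring]
      end end end. }
    match goal with |- ?w = _ => destruct (classic (w = #0)) as [|N] end; auto.
    exact (pmul_eq_0 _ _ N S). }
  assert (W' : b ^ 2 * d + #2 * tau * (b * c + iota * a) = #0).
  { apply (pmul_eq_0 b); auto.
    match type of W with ?w = _ => match type of D with ?dd = _ =>
      transitivity (dd + a * w); [ring|rewrite W, D; ring] end end. }
  assert (X : a ^ 2 * c = #(-2) * tau * (a * d + iota * b)).
  { match type of W with ?w = _ => transitivity (w - #2 * tau * (a * d + iota * b)); [ring|rewrite W; ring] end. }
  assert (Y : b ^ 2 * d = #(-2) * tau * (b * c + iota * a)).
  { match type of W' with ?w = _ => transitivity (w - #2 * tau * (b * c + iota * a)); [ring|rewrite W'; ring] end. }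
  assert (N : tau ^ 2 * iota ^ 2 * #4 = - (a * b * c * d)).
  { match type of H with ?h = _ => transitivity (h - a * b * c * d); [ring|rewrite H; ring] end. }
  (* The product of X and Y; the term a^2 b^2 c d on its left side is rewritten by N, after which 4
     tau^2 divides everything. *)
  assert (V : a * b * c * d + iota * a ^ 2 * d + iota * b ^ 2 * c + #2 * iota ^ 2 * a * b = #0).
  { apply (pmul_eq_0 (#4 * tau ^ 2)).
    - apply pmul_neq_0; [|now apply ppow_neq_0]. apply (coef_neq_0 _ 0). discriminate.
    - transitivity ((#(-2) * tau * (a * d + iota * b)) * (#(-2) * tau * (b * c + iota * a))
        + a * b * (tau ^ 2 * iota ^ 2 * #4)); [ring|].
      rewrite <- X, <- Y, N. ring. }
  (* The factor c d makes a^2 c and b^2 d appear inside a^5 and b^5, where X and Y apply; iota^2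
     completes the combination known from V. *)
  apply (pmul_cancel (iota ^ 2 * c * d)).
  { apply pmul_neq_0; [apply pmul_neq_0|]; auto using ppow_neq_0. }
  assert (V' : iota * (a ^ 2 * d + b ^ 2 * c) = - (a * b * (c * d + #2 * iota ^ 2))).
  { match type of V with ?v = _ => transitivity (v - a * b * (c * d + #2 * iota ^ 2)); [ring|rewrite V; ring] end. }
  transitivity (iota ^ 2 * tau * (a ^ 3 * d * (a ^ 2 * c) + b ^ 3 * c * (b ^ 2 * d))); [ring|].
  rewrite X, Y.
  transitivity (#(-2) * tau ^ 2 * ((iota * (a ^ 2 * d + b ^ 2 * c)) ^ 2
    + iota ^ 2 * (a * b) * (iota * (a ^ 2 * d + b ^ 2 * c)) - #2 * iota ^ 2 * (a * b) ^ 2 * c * d)); [ring|].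
  rewrite V'.
  transitivity ((a * b) ^ 2 * iota ^ 2 * (a * b * c * d) - #2 * (a * b) ^ 2 * tau ^ 2 * iota ^ 2 * c * d
    + #2 * (a * b) * tau ^ 2 * c * d * (tau ^ 2 * iota ^ 2 * #4)); [|ring].
  rewrite N.
  assert (N' : a * b * c * d = - (tau ^ 2 * iota ^ 2 * #4)) by (rewrite N; ring).
  transitivity ((a * b) ^ 2 * iota ^ 2 * (- (tau ^ 2 * iota ^ 2 * #4)) - #2 * (a * b) ^ 2 * tau ^ 2 * iota ^ 2 * c * d
    + #2 * (a * b) * tau ^ 2 * c * d * - (a * b * c * d)); [ring|].
  rewrite <- N'. reflexivity.
Qed.

(* J_relation holds separately in every residue class of exponents modulo 5; the classes 2 and 3
   suffice to eliminate the components of theta_odd. *)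
Lemma th_quintic :
  ((#2 * th 1) ^ 5 + (#2 * th 2) ^ 5) * dil 25 phi =
  (#4 * th 1 * th 2) ^ 3 - #2 * (#4 * th 1 * th 2) ^ 2 * dil 25 phi ^ 2
    + #8 * (#4 * th 1 * th 2) * dil 25 phi ^ 4.
Proof.
  apply (dil_inj 8); [lia|].
  repeat rewrite ?dil_add, ?dil_sub, ?dil_mul, ?dil_pow, ?dil_cst, ?dil_dil by lia. simpl (8 * 25)%nat.
  set (t1 := dil 8 (th 1)). set (t2 := dil 8 (th 2)).
  transitivity (((#2 * t1) ^ 5 + (#2 * t2) ^ 5) * dil 200 phi); [reflexivity|].
  transitivity (((#2 * t1) * (#2 * t2)) ^ 3 - #2 * ((#2 * t1) * (#2 * t2)) ^ 2 * dil 200 phi ^ 2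
    + #8 * (#2 * t1) * (#2 * t2) * dil 200 phi ^ 4); [|ring].
  pose proof (f_equal (dil 8) phi_dissect) as P.
  rewrite !dil_add, !dil_mul, !dil_cst, !dil_dil in P by lia. simpl Nat.mul in P.
  pose proof (f_equal (dil 8) phi_sq_dissect) as S.
  rewrite dil_add, !dil_mul, !dil_pow, !dil_cst, !dil_dil in S by lia. simpl Nat.mul in S.
  pose proof J_relation as R. pose proof four_classes as F.
  pose proof J_dissect as PJ. pose proof J_sq_dissect as SJ.
  fold t1 t2 in P, S, F.
  set (c := #2 * Jr 1). set (d := #2 * Jr 2). set (a := #2 * t1) in P |- *. set (b := #2 * t2) in P |- *.
  set (tau := dil 200 phi) in P, S, F |- *. set (iota := dil 25 theta_odd) in F, PJ, SJ |- *.
  (* Replacing q by q^8 multiplies the classes by 3 modulo 5, so the components of phi move from 1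
     and 4 to 3 and 2, while those of [theta_odd] stay in 1 and 4. *)
  assert (Ga : grade 3 a). { apply grade_scal, (grade_dil 8 1); [lia|]. now apply grade_theta_class. }
  assert (Gb : grade 2 b). { apply grade_scal, (grade_dil 8 4); [lia|]. now apply grade_theta_class. }
  assert (Gc : grade 1 c). { apply grade_scal. now apply grade_theta_class. }
  assert (Gd : grade 4 d). { apply grade_scal. now apply grade_theta_class. }
  assert (Gt : grade 0 tau) by (apply grade_dil_0; [lia|reflexivity]).
  assert (Gi : grade 0 iota) by (apply grade_dil_0; [lia|reflexivity]).
  assert (H : a * b * c * d + #4 * tau ^ 2 * iota ^ 2 = #0).
  { transitivity (#4 * (#4 * (t1 * t2) * (Jr 1 * Jr 2)) + #4 * tau ^ 2 * iota ^ 2).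
    - unfold a, b, c, d. ring.
    - rewrite F. ring. }
  assert (R' : (a * b + a ^ 2 + b ^ 2 + #2 * tau * (a + b)) *
    (c * d + c ^ 2 + d ^ 2 + #2 * iota * (c + d)) =
    #(-4) * (iota ^ 2 + c * d) * (tau ^ 2 + a * b)).
  { assert (SJ' : dil 5 theta_odd ^ 2 = iota ^ 2 + c * d) by (rewrite SJ; unfold c, d; ring).
    assert (S' : dil 40 phi ^ 2 = tau ^ 2 + a * b) by (rewrite S; unfold a, b; ring).
    assert (PJ' : theta_odd = iota + c + d) by exact PJ.
    rewrite SJ', S', P, PJ' in R.
    match type of R with _ = ?r => transitivity r; [rewrite <- R; ring|ring] end. }
  destruct (grade_sum_0
    (a * b * c * d + #2 * iota * (c * b ^ 2) + #2 * iota * (d * a ^ 2) + #2 * tau * (a * c ^ 2)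
      + #2 * tau * (b * d ^ 2) + #4 * (iota ^ 2 + c * d) * (tau ^ 2 + a * b))
    (#2 * iota * (a * b * c) + a ^ 2 * c * d + b ^ 2 * c ^ 2 + #2 * tau * (a * d ^ 2)
      + #4 * (tau * iota) * (b * d))
    (a * b * c ^ 2 + #2 * tau * (b * c * d) + b ^ 2 * d ^ 2 + #2 * iota * (a ^ 2 * c)
      + #4 * (tau * iota) * (a * d))
    (a * b * d ^ 2 + #2 * tau * (a * c * d) + a ^ 2 * c ^ 2 + #2 * iota * (b ^ 2 * d)
      + #4 * (tau * iota) * (b * c))
    (#2 * iota * (a * b * d) + b ^ 2 * c * d + a ^ 2 * d ^ 2 + #2 * tau * (b * c ^ 2)
      + #4 * (tau * iota) * (a * c))) as [G2 G3].
  6:{ match type of R' with ?l = ?r => transitivity (l - r); [ring|rewrite R'; ring] end. }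
  all: cycle 5.
  - apply (quintic_elimination a b c d tau iota); auto.
    + apply two_neq_0, dil_neq_0; [lia|]. now apply (coef_neq_0 _ 1).
    + apply two_neq_0, dil_neq_0; [lia|]. now apply (coef_neq_0 _ 4).
    + apply two_neq_0. now apply (coef_neq_0 _ 1).
    + apply two_neq_0. now apply (coef_neq_0 _ 9).
    + apply dil_neq_0; [lia|]. now apply (coef_neq_0 _ 0).
    + apply dil_neq_0; [lia|]. now apply (coef_neq_0 _ 1).
    + rewrite <- G2. ring.
    + rewrite <- G3. ring.
  - graded.
  - graded.
  - graded.
  - graded.
  - graded.
Qed.

(** * The modular equation and the operator U5 *)

(** Polynomials are coefficient lists, constant term first, so that the finitely many tables needed
    later can be evaluated by computation. *)
Fixpoint peval (l : list Z) (f : ps) : ps :=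
  match l with nil => #0 | c :: l' => #c + f * peval l' f end.
Fixpoint ladd (l1 l2 : list Z) : list Z :=
  match l1, l2 with
  | nil, _ => l2
  | _, nil => l1
  | a :: l1', b :: l2' => (a + b)%Z :: ladd l1' l2'
  end.
Definition lscal (c : Z) (l : list Z) : list Z := map (Z.mul c) l.
Fixpoint lmul (l1 l2 : list Z) : list Z :=
  match l1 with nil => nil | a :: l1' => ladd (lscal a l2) (0%Z :: lmul l1' l2) end.

Lemma cst_add a b : #(a + b) = #a + #b.
Proof. extensionality n. unfold padd, cst. destruct (n =? 0)%nat; ring. Qed.
Lemma cst_mul a b : #(a * b) = #a * #b.
Proof. rewrite pmul_cst_l. extensionality n. unfold cst. destruct (n =? 0)%nat; ring. Qed.

Lemma peval_ladd l1 : forall l2 f, peval (ladd l1 l2) f = peval l1 f + peval l2 f.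
Proof.
  induction l1 as [|a l1 IH]; intros [|b l2] f; simpl; try ring.
  rewrite IH, cst_add. ring.
Qed.
Lemma peval_lscal c l f : peval (lscal c l) f = #c * peval l f.
Proof. induction l; simpl; [ring|]. rewrite IHl, cst_mul. ring. Qed.
Lemma peval_lmul l1 l2 f : peval (lmul l1 l2) f = peval l1 f * peval l2 f.
Proof.
  induction l1; simpl; [ring|]. rewrite peval_ladd, peval_lscal. simpl. rewrite IHl1. ring.
Qed.

Fixpoint evens (l : list Z) : list Z :=
  match l with nil => nil | a :: nil => [a] | a :: _ :: l' => a :: evens l' end.
Fixpoint odds (l : list Z) : list Z :=
  match l with nil => nil | a :: nil => nil | _ :: b :: l' => b :: odds l' end.

Lemma list_ind2 {A} (P : list A -> Prop) :
  P nil -> (forall a, P [a]) -> (forall a b l, P l -> P (a :: b :: l)) -> forall l, P l.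
Proof.
  intros H0 H1 H2 l. enough (P l /\ forall a, P (a :: l)) by tauto.
  induction l as [|a l [IH1 IH2]]; split; auto.
Qed.

Lemma peval_parity l f : peval l f = peval (evens l) (f ^ 2) + f * peval (odds l) (f ^ 2).
Proof. induction l using list_ind2; cbn [peval evens odds]; [ring..|]. rewrite IHl. ring. Qed.

Fixpoint lcomp (l s : list Z) : list Z :=
  match l with nil => nil | c :: l' => ladd [c] (lmul s (lcomp l' s)) end.
Lemma peval_lcomp l s f : peval (lcomp l s) f = peval l (peval s f).
Proof.
  induction l as [|c l IH]; [reflexivity|].
  change (lcomp (c :: l) s) with (ladd [c] (lmul s (lcomp l s))).
  rewrite peval_ladd, peval_lmul, IH. simpl. ring.
Qed.

Fixpoint lpow (l : list Z) (n : nat) : list Z :=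
  match n with O => [1%Z] | S n' => lmul l (lpow l n') end.
Lemma peval_lpow l n f : peval (lpow l n) f = peval l f ^ n.
Proof. induction n; simpl; [ring|]. now rewrite peval_lmul, IHn. Qed.

(** The inverse nu of mu is kept as well because its denominator is a series in q^5: it leaves U5,
    and U5 of a power of nu follows from the dissection of phi. In the names of lemmas K, m, h and x
    refer to [phi5], [mu], [nu] and [xi]. *)
Definition phi5 : ps := dil 5 phi.
Definition mu : ps := phi5 * pinv phi.
Definition nu : ps := phi * pinv phi5.
Definition U5 (f : ps) : ps := sect 5 0 f.

Lemma phi_0 : phi 0%nat = 1%Z.
Proof. reflexivity. Qed.
Lemma K_0 : phi5 0%nat = 1%Z.
Proof. unfold phi5. now rewrite dil_coef_0. Qed.
Lemma phi_inv : phi * pinv phi = #1.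
Proof. apply mul_pinv, phi_0. Qed.
Lemma K_inv : phi5 * pinv phi5 = #1.
Proof. apply mul_pinv, K_0. Qed.
Lemma phi_m : phi * mu = phi5.
Proof. unfold mu. transitivity (phi * pinv phi * phi5); [ring|]. rewrite phi_inv. ring. Qed.
Lemma K_h : phi5 * nu = phi.
Proof. unfold nu. transitivity (phi5 * pinv phi5 * phi); [ring|]. rewrite K_inv. ring. Qed.
Lemma h_m : nu * mu = #1.
Proof.
  unfold nu, mu. transitivity ((phi * pinv phi) * (phi5 * pinv phi5)); [ring|].
  rewrite phi_inv, K_inv. ring.
Qed.
Lemma K_neq_0 : phi5 <> #0.
Proof. apply (coef_neq_0 _ 0). rewrite K_0. lia. Qed.
Lemma K_m : phi5 * dil 5 mu = dil 25 phi.
Proof. unfold phi5 at 1. rewrite <- dil_mul, phi_m by lia. unfold phi5. now rewrite dil_dil by lia. Qed.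

(* phi(-q) is a root of the Dickson polynomial with parameters (2 th 1)(2 th 2) and
   (2 th 1)^5 + (2 th 2)^5, shifted by phi(-q^25). *)
Lemma m_quintic (M := dil 5 mu) :
  mu ^ 5 = M * (#1 - #5 * M * mu + (#15 * M ^ 2 - #5) * mu ^ 2 + (#15 * M - #25 * M ^ 3) * mu ^ 3
    + (#25 * M ^ 4 - #25 * M ^ 2 + #5) * mu ^ 4).
Proof.
  set (a := #2 * th 1). set (b := #2 * th 2). set (tau := dil 25 phi).
  assert (AB : a * b = phi5 ^ 2 - tau ^ 2).
  { unfold phi5. rewrite phi_sq_dissect. unfold a, b, tau. ring. }
  assert (P : phi - tau = a + b).
  { rewrite phi_dissect. fold tau. unfold a, b. ring. }
  assert (Q : (a ^ 5 + b ^ 5) * tau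
    = (a * b) ^ 3 - #2 * (a * b) ^ 2 * tau ^ 2 + #8 * (a * b) * tau ^ 4).
  { pose proof th_quintic as Q. fold a b tau in Q. rewrite Q. unfold a, b. ring. }
  assert (R : ((phi - tau) ^ 5 - #5 * (a * b) * (phi - tau) ^ 3 + #5 * (a * b) ^ 2 * (phi - tau)) * tau
    = (a * b) ^ 3 - #2 * (a * b) ^ 2 * tau ^ 2 + #8 * (a * b) * tau ^ 4).
  { rewrite <- Q, P. ring. }
  rewrite AB in R. unfold tau in R. rewrite <- K_m, <- K_h in R. fold M in R.
  clear AB P Q. clearbody M. clear a b tau.
  assert (S : ((nu - M) ^ 5 - #5 * (#1 - M ^ 2) * (nu - M) ^ 3 + #5 * (#1 - M ^ 2) ^ 2 * (nu - M)) * M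
    = (#1 - M ^ 2) ^ 3 - #2 * (#1 - M ^ 2) ^ 2 * M ^ 2 + #8 * (#1 - M ^ 2) * M ^ 4).
  { apply (pmul_cancel (phi5 ^ 6)); [apply ppow_neq_0, K_neq_0|].
    match type of R with ?l = ?r => transitivity l; [ring|]; transitivity r; [exact R|ring] end. }
  assert (T : ((#1 - M * mu) ^ 5 - #5 * (#1 - M ^ 2) * mu ^ 2 * (#1 - M * mu) ^ 3
    + #5 * (#1 - M ^ 2) ^ 2 * mu ^ 4 * (#1 - M * mu)) * M
    = mu ^ 5 * ((#1 - M ^ 2) ^ 3 - #2 * (#1 - M ^ 2) ^ 2 * M ^ 2 + #8 * (#1 - M ^ 2) * M ^ 4)).
  { rewrite <- S, <- h_m. ring. }
  match type of T with ?l = ?r => transitivity (mu ^ 5 + l - r); [rewrite T|]; ring end.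
Qed.

(** This is (mu^2 - 1) / 4; the form given by the dissection of phi^2 shows that the quotient has
    integer coefficients. *)
Definition xi : ps := - U5 (th 1 * th 2) * pinv phi ^ 2.

Lemma m_sq : mu ^ 2 = #1 + #4 * xi.
Proof.
  assert (E : phi ^ 2 = phi5 ^ 2 + #4 * U5 (th 1 * th 2)).
  { pose proof (f_equal U5 phi_sq_dissect) as H. unfold U5 in *.
    rewrite sect_add in H.
    replace (#4 * th 1 * th 2) with (#4 * (th 1 * th 2)) in H by ring.
    rewrite sect_cst_mul in H.
    replace (dil 25 phi) with (dil 5 phi5) in H by (unfold phi5; now rewrite dil_dil by lia).
    rewrite <- !dil_pow, !sect_dil in H by lia. exact H. }
  unfold mu, xi.
  transitivity (pinv phi ^ 2 * (phi ^ 2 - #4 * U5 (th 1 * th 2))); [rewrite E; ring|].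
  transitivity ((phi * pinv phi) ^ 2 - #4 * U5 (th 1 * th 2) * pinv phi ^ 2); [ring|].
  rewrite phi_inv. ring.
Qed.

Lemma x_0 : xi 0%nat = 0%Z.
Proof.
  unfold xi. rewrite mul_coef_0. unfold popp, U5, sect. simpl (5 * 0 + 0)%nat. rewrite mul_coef_0.
  reflexivity.
Qed.

(* Coefficients of the modular equation xi^5 = sum_k a_k(y) xi^k of level 5, y = xi(q^5). *)
Definition modular_coefs (k : nat) : list Z :=
  match k with
  | 0%nat => [0; 1; 20; 150; 500; 625]
  | 1%nat => [0; 15; 305; 2325; 7875; 10000]
  | 2%nat => [0; 85; 1750; 13525; 46500; 60000]
  | 3%nat => [0; 215; 4475; 35000; 122000; 160000]
  | _ => [0; 205; 4300; 34000; 120000; 160000]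
  end%Z.

(** With the odd powers of mu on one side and the even ones on the other, squaring the modular
    equation leaves a relation between mu^2 and M^2 only, that is between xi and xi(q^5). *)
Lemma x_quintic : xi ^ 5 = sump (fun k => peval (modular_coefs k) (dil 5 xi) * xi ^ k) 5.
Proof.
  set (y := dil 5 xi). set (M := dil 5 mu).
  assert (HX : mu ^ 2 = #1 + #4 * xi) by apply m_sq.
  assert (HY : M ^ 2 = #1 + #4 * y).
  { unfold M, y. rewrite <- dil_pow, m_sq, dil_add, dil_mul, !dil_cst by lia. reflexivity. }
  pose proof m_quintic as Q. cbv zeta in Q. fold M in Q.
  set (X := #1 + #4 * xi) in *. set (Y := #1 + #4 * y) in *.
  assert (P : mu * M * (X ^ 2 + #5 * Y - #15 * X * Y + #25 * X * Y ^ 2) =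
    Y * (#1 + (#15 * Y - #5) * X + (#25 * Y ^ 2 - #25 * Y + #5) * X ^ 2)).
  { rewrite <- HX, <- HY.
    match goal with |- _ = ?r => transitivity (mu ^ 5 * M +
      mu * M * (#5 * M ^ 2 - #15 * mu ^ 2 * M ^ 2 + #25 * mu ^ 2 * M ^ 4)); [ring|rewrite Q; ring] end. }
  assert (S : X * (X ^ 2 + #5 * Y - #15 * X * Y + #25 * X * Y ^ 2) ^ 2 =
    Y * (#1 + (#15 * Y - #5) * X + (#25 * Y ^ 2 - #25 * Y + #5) * X ^ 2) ^ 2).
  { apply (pmul_cancel Y).
    - rewrite <- HY. apply ppow_neq_0, dil_neq_0; [lia|]. intros E. pose proof h_m as C.
      rewrite E in C. apply (f_equal (fun f : ps => f 0%nat)) in C.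
      rewrite mul_coef_0 in C. unfold cst in C. simpl in C. lia.
    - match type of P with _ = ?r => transitivity (r ^ 2); [rewrite <- P|ring] end.
      rewrite <- HX, <- HY. ring. }
  (* 1024 = 4^5 is the leading coefficient that X = 1 + 4 xi produces; the difference of the two
     sides of S is 1024 times the difference of those of the claim. *)
  apply (pmul_cancel (#1024)); [apply (coef_neq_0 _ 0); discriminate|].
  match type of S with ?l = ?r => transitivity (#1024 * xi ^ 5 - l + r) end.
  - rewrite S. ring.
  - unfold X, Y. simpl sump. unfold modular_coefs. cbn [peval]. ring.
Qed.

Lemma U_dil f g : U5 (dil 5 f * g) = f * U5 g.
Proof. apply sect_dil_mul; lia. Qed.
Lemma U_add f g : U5 (f + g) = U5 f + U5 g.
Proof. reflexivity. Qed.
Lemma U_scal z f : U5 (#z * f) = #z * U5 f.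
Proof. apply sect_cst_mul. Qed.

Lemma U_grade r f : (r mod 5 <> 0)%nat -> grade r f -> U5 f = #0.
Proof.
  intros Hr H. extensionality n. unfold U5, sect. rewrite Nat.add_0_r.
  rewrite H by (rewrite Nat.mul_comm, Nat.Div0.mod_mul; intros <-; now apply Hr).
  unfold cst; destruct (n =? 0)%nat; reflexivity.
Qed.

Lemma U_h_pow j : U5 (nu ^ j) = pinv phi ^ j * U5 (phi ^ j).
Proof.
  unfold nu. rewrite ppow_mul_base, pmul_comm.
  assert (pinv phi5 = dil 5 (pinv phi)) as ->.
  { apply (pmul_cancel phi5 _ _ K_neq_0). rewrite K_inv. unfold phi5.
    rewrite <- dil_mul, phi_inv, dil_cst by lia. reflexivity. }
  rewrite <- dil_pow by lia. apply U_dil.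
Qed.

(** The components a and b lie in the classes 1 and 4, so in (tau + a + b)^j with j < 5 only powers
    of tau and of a b survive U5. The first exponent at which a^5 + b^5 would enter is 5. *)
Lemma U_h_powers :
  U5 nu = mu /\ U5 (nu ^ 2) = #2 - mu ^ 2 /\ U5 (nu ^ 3) = #6 * mu - #5 * mu ^ 3 /\ U5 (nu ^ 4) = #6 - #5 * mu ^ 4.
Proof.
  set (a := #2 * th 1). set (b := #2 * th 2). set (tau := dil 25 phi).
  assert (P : phi = tau + a + b) by apply phi_dissect.
  assert (Ga : grade 1 a) by (apply grade_scal; now apply grade_theta_class).
  assert (Gb : grade 4 b) by (apply grade_scal; now apply grade_theta_class).
  assert (Gt : grade 0 tau) by (apply grade_dil_0; [lia|reflexivity]).
  assert (T : tau = dil 5 phi5) by (unfold phi5; now rewrite dil_dil by lia).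
  assert (AB : a * b = dil 5 (phi ^ 2 - phi5 ^ 2)).
  { rewrite dil_sub, !dil_pow, <- T by lia. fold phi5. unfold phi5. rewrite phi_sq_dissect.
    fold tau. unfold a, b. ring. }
  assert (G : forall f0 f1 f2 f3 f4, grade 1 f1 -> grade 2 f2 -> grade 3 f3 -> grade 4 f4 ->
    U5 (f0 + f1 + f2 + f3 + f4) = U5 f0).
  { intros f0 f1 f2 f3 f4 H1 H2 H3 H4. rewrite !U_add.
    rewrite (U_grade 1 f1), (U_grade 2 f2), (U_grade 3 f3), (U_grade 4 f4) by (auto; discriminate).
    ring. }
  assert (I : forall j, pinv phi ^ j * phi ^ j = #1).
  { intros j. rewrite <- ppow_mul_base, (pmul_comm _ phi), phi_inv. apply ppow_1_l. }
  assert (Z0 : forall r, grade r (#0)) by (intros r n _; unfold cst; destruct (n =? 0)%nat; reflexivity).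
  assert (D : forall f, U5 (dil 5 f) = f) by (intros; apply sect_dil; lia).
  assert (H1 : U5 phi = phi5).
  { transitivity (U5 (tau + a + #0 + #0 + b)); [f_equal; rewrite P; ring|].
    rewrite G by auto. now rewrite T, D. }
  assert (H2 : U5 (phi ^ 2) = phi5 ^ 2 + #2 * (phi ^ 2 - phi5 ^ 2)).
  { transitivity (U5 (tau ^ 2 + #2 * (a * b) + #2 * (tau * a) + a ^ 2 + b ^ 2 + #2 * (tau * b)));
      [f_equal; rewrite P; ring|].
    rewrite G by graded. rewrite T, AB, <- (dil_cst 5 2), <- dil_pow, <- dil_mul, <- dil_add, D by lia.
    now rewrite ?dil_cst by lia. }
  assert (H3 : U5 (phi ^ 3) = phi5 ^ 3 + #6 * phi5 * (phi ^ 2 - phi5 ^ 2)).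
  { transitivity (U5 (tau ^ 3 + #6 * tau * (a * b) + (#3 * (tau ^ 2 * a) + #3 * (a ^ 2 * b))
      + (#3 * (tau * a ^ 2) + b ^ 2 * b) + (#3 * (tau * b ^ 2) + a ^ 2 * a)
      + (#3 * (tau ^ 2 * b) + #3 * (a * b ^ 2)))); [f_equal; rewrite P; ring|].
    rewrite G by graded.
    rewrite T, AB, <- (dil_cst 5 6), <- dil_pow, <- !dil_mul, <- dil_add, D by lia.
    now rewrite ?dil_cst by lia. }
  assert (H4 : U5 (phi ^ 4) = phi5 ^ 4 + #12 * phi5 ^ 2 * (phi ^ 2 - phi5 ^ 2) + #6 * (phi ^ 2 - phi5 ^ 2) ^ 2).
  { transitivity (U5 (tau ^ 4 + #12 * tau ^ 2 * (a * b) + #6 * (a * b) ^ 2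
      + (#4 * (tau ^ 2 * tau * a) + #12 * (tau * (a ^ 2 * b)) + b ^ 2 * b ^ 2)
      + (#6 * (tau ^ 2 * a ^ 2) + #4 * (a ^ 2 * a * b) + #4 * (tau * (b ^ 2 * b)))
      + (#6 * (tau ^ 2 * b ^ 2) + #4 * (a * (b ^ 2 * b)) + #4 * (tau * (a ^ 2 * a)))
      + (#4 * (tau ^ 2 * tau * b) + #12 * (tau * (a * b ^ 2)) + a ^ 2 * a ^ 2)));
      [f_equal; rewrite P; ring|].
    rewrite G by graded.
    rewrite T, AB, <- (dil_cst 5 6), <- (dil_cst 5 12), <- !dil_pow, <- !dil_mul, <- !dil_add, D by lia.
    now rewrite ?dil_cst by lia. }
  pose proof (I 1%nat) as I1. pose proof (I 2%nat) as I2. pose proof (I 3%nat) as I3.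
  pose proof (I 4%nat) as I4. unfold mu.
  assert (L1 : U5 nu = phi5 * pinv phi).
  { replace nu with (nu ^ 1) by ring. rewrite U_h_pow. replace (phi ^ 1) with phi by ring.
    rewrite H1. ring. }
  split; [exact L1|]. rewrite !U_h_pow, H2, H3, H4.
  assert (J1 : pinv phi * phi = #1) by (rewrite <- I1; ring).
  repeat split.
  - transitivity (#2 * (pinv phi * phi) ^ 2 - (phi5 * pinv phi) ^ 2); [ring|]. rewrite J1. ring.
  - transitivity (#6 * (phi5 * pinv phi) * (pinv phi * phi) ^ 2 - #5 * (phi5 * pinv phi) ^ 3); [ring|].
    rewrite J1. ring.
  - transitivity (#6 * (pinv phi * phi) ^ 4 - #5 * (phi5 * pinv phi) ^ 4); [ring|]. rewrite J1. ring.
Qed.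

(** The last entry is the right-hand side of [U_m_rec]. A window of five values is carried because
    the modular equation has degree 5 in mu; it starts at nu^4 since U5 of nu^4, ..., nu, 1 is what
    the dissection gives directly. *)
Definition m_step (s : list (list Z)) : list (list Z) :=
  match s with
  | [s0; s1; s2; s3; s4] =>
      [s1; s2; s3; s4;
       ladd (lmul [0; 1] s0) (ladd (lmul [0; 0; -5] s1) (ladd (lmul [0; -5; 0; 15] s2)
         (ladd (lmul [0; 0; 15; 0; -25] s3) (lmul [0; 5; 0; -25; 0; 25] s4))))]
  | _ => nil
  end%Z.
(* U5(nu^4 mu^j) for n <= j < n + 5, as polynomials in mu. *)
Definition m_state (n : nat) : list (list Z) :=
  Nat.iter n m_step [[6; 0; 0; 0; -5]; [0; 6; 0; -5]; [2; 0; -1]; [0; 1]; [1]]%Z.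
Definition m_poly (n : nat) : list Z := nth 0 (m_state n) nil.

Lemma U_m_rec f : U5 (f * mu ^ 5) = mu * U5 f - #5 * mu ^ 2 * U5 (f * mu)
  + (#15 * mu ^ 3 - #5 * mu) * U5 (f * mu ^ 2) + (#15 * mu ^ 2 - #25 * mu ^ 4) * U5 (f * mu ^ 3)
  + (#25 * mu ^ 5 - #25 * mu ^ 3 + #5 * mu) * U5 (f * mu ^ 4).
Proof.
  rewrite <- !U_dil.
  assert (S : forall f g, U5 f - U5 g = U5 (f - g)) by reflexivity. rewrite S, <- !U_add.
  f_equal. rewrite !dil_add, !dil_sub, ?dil_add, ?dil_sub, !dil_mul, !dil_pow, !dil_cst by lia.
  rewrite m_quintic at 1. ring.
Qed.

Lemma m_state_spec n : exists s0 s1 s2 s3 s4, m_state n = [s0; s1; s2; s3; s4] /\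
  U5 (nu ^ 4 * mu ^ n) = peval s0 mu /\ U5 (nu ^ 4 * mu ^ n * mu) = peval s1 mu /\
  U5 (nu ^ 4 * mu ^ n * mu ^ 2) = peval s2 mu /\ U5 (nu ^ 4 * mu ^ n * mu ^ 3) = peval s3 mu /\
  U5 (nu ^ 4 * mu ^ n * mu ^ 4) = peval s4 mu.
Proof.
  induction n as [|n (s0 & s1 & s2 & s3 & s4 & E & H0 & H1 & H2 & H3 & H4)].
  - exists [6; 0; 0; 0; -5]%Z, [0; 6; 0; -5]%Z, [2; 0; -1]%Z, [0; 1]%Z, [1]%Z.
    split; [reflexivity|]. destruct U_h_powers as (A1 & A2 & A3 & A4).
    assert (U5 (#1) = #1) as A0 by (rewrite <- (dil_cst 5 1) at 1 by lia; apply sect_dil; lia).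
    repeat split; cbn [peval].
    + replace (nu ^ 4 * mu ^ 0) with (nu ^ 4) by ring. rewrite A4. ring.
    + replace (nu ^ 4 * mu ^ 0 * mu) with (nu ^ 3 * (nu * mu)) by ring. rewrite h_m.
      replace (nu ^ 3 * #1) with (nu ^ 3) by ring. rewrite A3. ring.
    + replace (nu ^ 4 * mu ^ 0 * mu ^ 2) with (nu ^ 2 * (nu * mu) ^ 2) by ring. rewrite h_m.
      replace (nu ^ 2 * #1 ^ 2) with (nu ^ 2) by ring. rewrite A2. ring.
    + replace (nu ^ 4 * mu ^ 0 * mu ^ 3) with (nu * (nu * mu) ^ 3) by ring. rewrite h_m.
      replace (nu * #1 ^ 3) with nu by ring. rewrite A1. ring.
    + replace (nu ^ 4 * mu ^ 0 * mu ^ 4) with ((nu * mu) ^ 4) by ring. rewrite h_m.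
      replace (#1 ^ 4) with (#1) by ring. rewrite A0. ring.
  - unfold m_state. simpl Nat.iter. fold (m_state n). rewrite E.
    do 5 eexists. split; [reflexivity|].
    replace (nu ^ 4 * mu ^ S n) with (nu ^ 4 * mu ^ n * mu) by (simpl; ring).
    repeat split.
    + exact H1.
    + rewrite <- H2. f_equal. ring.
    + rewrite <- H3. f_equal. ring.
    + rewrite <- H4. f_equal. ring.
    + replace (nu ^ 4 * mu ^ n * mu * mu ^ 4) with (nu ^ 4 * mu ^ n * mu ^ 5) by ring.
      rewrite U_m_rec, H0, H1, H2, H3, H4, !peval_ladd, !peval_lmul. cbn [peval]. ring.
Qed.

Lemma m_poly_spec n : U5 (nu ^ 4 * mu ^ n) = peval (m_poly n) mu.
Proof.
  destruct (m_state_spec n) as (s0 & s1 & s2 & s3 & s4 & E & H & _).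
  unfold m_poly. now rewrite E.
Qed.

Fixpoint U_list (n : nat) (p : list Z) : list Z :=
  match p with nil => nil | c :: p' => ladd (lscal c (m_poly n)) (U_list (S n) p') end.

Lemma U_list_spec p : forall n, U5 (nu ^ 4 * mu ^ n * peval p mu) = peval (U_list n p) mu.
Proof.
  induction p as [|c p IH]; intros n; cbn [peval U_list].
  - replace (nu ^ 4 * mu ^ n * #0) with (#0 * #1) by ring. rewrite U_scal. ring.
  - rewrite peval_ladd, peval_lscal, <- m_poly_spec, <- IH, <- U_scal, <- U_add. f_equal. simpl. ring.
Qed.

Lemma h_m_pow j : nu ^ j * mu ^ j = #1.
Proof. rewrite <- ppow_mul_base, h_m. apply ppow_1_l. Qed.

Lemma four_x_pow i : #(4 ^ Z.of_nat i) * xi ^ i = peval (lpow [-1; 0; 1]%Z i) mu.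
Proof.
  rewrite peval_lpow, <- cst_pow, <- ppow_mul_base. f_equal. cbn [peval].
  transitivity (mu ^ 2 - #1); [rewrite m_sq; ring|ring].
Qed.

Definition all_zero (l : list Z) : bool := forallb (Z.eqb 0) l.
Lemma peval_all_zero l f : all_zero l = true -> peval l f = #0.
Proof.
  unfold all_zero. induction l; cbn [peval forallb]; [reflexivity|]. intros H.
  apply andb_prop in H as [H1 H2]. apply Z.eqb_eq in H1. subst. rewrite IHl by auto. ring.
Qed.

Definition div_list (c : Z) (l : list Z) : list Z := map (fun a => a / c)%Z l.
Definition divides_all (c : Z) (l : list Z) : bool := forallb (fun a => a mod c =? 0)%Z l.
Lemma lscal_div_list c l : c <> 0%Z -> divides_all c l = true -> lscal c (div_list c l) = l.
Proof.
  intros Hc. unfold divides_all, lscal, div_list. induction l; cbn [forallb map]; [reflexivity|]. intros H.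
  apply andb_prop in H as [H1 H2]. apply Z.eqb_eq in H1. rewrite IHl by auto. f_equal.
  symmetry. now apply Z_div_exact_full_2.
Qed.

(** On mu times a polynomial in xi, U5 again yields mu times a polynomial in xi. Removing the factor
    mu on both sides gives an operator on series in xi. *)
Definition V5 (f : ps) : ps := nu * U5 (mu * f).

(** The offsets 4 and 5 turn nu^4 mu^n into 1 and mu, and the list expands (mu^2 - 1)^i = (4 xi)^i.
    The rows [Ux] and [Vx] arise by keeping the powers of mu of the relevant parity, substituting
    mu^2 = 1 + 4 xi and dividing by 4^i. *)
Definition Ux_raw (i : nat) : list Z := U_list 4 (lpow [-1; 0; 1]%Z i).
Definition Vx_raw (i : nat) : list Z := U_list 5 (lpow [-1; 0; 1]%Z i).
Definition Ux (i : nat) : list Z :=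
  div_list (4 ^ Z.of_nat i) (lcomp (evens (Ux_raw i)) [1; 4]%Z).
Definition Vx (i : nat) : list Z :=
  div_list (4 ^ Z.of_nat i) (lcomp (odds (Vx_raw i)) [1; 4]%Z).

Lemma cst_neq_0 z : z <> 0%Z -> #z <> #0.
Proof. intros H. now apply (coef_neq_0 _ 0). Qed.

Lemma m_sq_peval : mu ^ 2 = peval [1; 4]%Z xi.
Proof. rewrite m_sq. cbn [peval]. ring. Qed.

Lemma Ux_spec i : all_zero (odds (Ux_raw i)) = true ->
  divides_all (4 ^ Z.of_nat i) (lcomp (evens (Ux_raw i)) [1; 4]%Z) = true ->
  U5 (xi ^ i) = peval (Ux i) xi.
Proof.
  intros H1 H2. assert (4 ^ Z.of_nat i <> 0)%Z by (apply Z.pow_nonzero; lia).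
  apply (pmul_cancel (#(4 ^ Z.of_nat i))); [now apply cst_neq_0|].
  rewrite <- U_scal, <- peval_lscal. unfold Ux. rewrite lscal_div_list by auto.
  rewrite four_x_pow, peval_lcomp, <- m_sq_peval.
  transitivity (peval (Ux_raw i) mu).
  - unfold Ux_raw. rewrite <- U_list_spec. f_equal. rewrite h_m_pow. ring.
  - rewrite peval_parity, (peval_all_zero (odds _)) by auto. ring.
Qed.

Lemma Vx_spec i : all_zero (evens (Vx_raw i)) = true ->
  divides_all (4 ^ Z.of_nat i) (lcomp (odds (Vx_raw i)) [1; 4]%Z) = true ->
  V5 (xi ^ i) = peval (Vx i) xi.
Proof.
  intros H1 H2. assert (4 ^ Z.of_nat i <> 0)%Z by (apply Z.pow_nonzero; lia).
  apply (pmul_cancel (#(4 ^ Z.of_nat i))); [now apply cst_neq_0|].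
  rewrite <- peval_lscal. unfold Vx, V5. rewrite lscal_div_list by auto.
  transitivity (nu * (#(4 ^ Z.of_nat i) * U5 (mu * xi ^ i))); [ring|]. rewrite <- U_scal.
  replace (#(4 ^ Z.of_nat i) * (mu * xi ^ i)) with (mu * (#(4 ^ Z.of_nat i) * xi ^ i)) by ring.
  rewrite four_x_pow, peval_lcomp, <- m_sq_peval.
  transitivity (nu * peval (Vx_raw i) mu).
  - unfold Vx_raw. rewrite <- U_list_spec. do 2 f_equal.
    replace (nu ^ 4 * mu ^ 5) with (nu ^ 4 * mu ^ 4 * mu) by ring. rewrite h_m_pow. ring.
  - rewrite peval_parity, (peval_all_zero (evens _)) by auto.
    transitivity (nu * mu * peval (odds (Vx_raw i)) (mu ^ 2)); [ring|]. rewrite h_m. ring.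
Qed.

Lemma Ux_eq i : (i < 5)%nat -> U5 (xi ^ i) = peval (Ux i) xi.
Proof.
  intros H. apply Ux_spec; do 5 (destruct i as [|i]; [vm_compute; reflexivity|]); lia.
Qed.
Lemma Vx_eq i : (i < 5)%nat -> V5 (xi ^ i) = peval (Vx i) xi.
Proof.
  intros H. apply Vx_spec; do 5 (destruct i as [|i]; [vm_compute; reflexivity|]); lia.
Qed.

(** * 5-adic lattices *)

Inductive lin (G : ps -> Prop) : ps -> Prop :=
| lin_0 : lin G (#0)
| lin_cons z g f : G g -> lin G f -> lin G (#z * g + f).

(* The q-adically closed Z-submodule generated by G. *)
Definition Span (G : ps -> Prop) (f : ps) : Prop := forall N, exists g, lin G g /\ f =[N] g.

Lemma lin_add G f g : lin G f -> lin G g -> lin G (f + g).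
Proof.
  intros Hf Hg. induction Hf.
  - replace (#0 + g) with g by ring. assumption.
  - replace (#z * g0 + f + g) with (#z * g0 + (f + g)) by ring. now constructor.
Qed.
Lemma lin_scal G z f : lin G f -> lin G (#z * f).
Proof.
  intros Hf. induction Hf.
  - replace (#z * #0) with (#0) by ring. constructor.
  - replace (#z * (#z0 * g + f)) with (#(z * z0) * g + #z * f) by (rewrite cst_mul; ring).
    now constructor.
Qed.

Lemma span_add G f g : Span G f -> Span G g -> Span G (f + g).
Proof.
  intros Hf Hg N. destruct (Hf N) as (f' & H1 & H2), (Hg N) as (g' & H3 & H4).
  exists (f' + g'). split; [now apply lin_add|now apply eqN_add].
Qed.
Lemma span_scal G z f : Span G f -> Span G (#z * f).
Proof.
  intros Hf N. destruct (Hf N) as (f' & H1 & H2). exists (#z * f').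
  split; [now apply lin_scal|]. apply eqN_mul; [apply eqN_refl|assumption].
Qed.
Lemma span_gen (G : ps -> Prop) g : G g -> Span G g.
Proof.
  intros H N. exists (#1 * g + #0). split; [repeat constructor; assumption|].
  replace (#1 * g + #0) with g by ring. apply eqN_refl.
Qed.
Lemma span_0 G : Span G (#0).
Proof. intros N. exists (#0). split; [constructor|apply eqN_refl]. Qed.
Lemma span_closed G f : (forall N, exists g, Span G g /\ f =[N] g) -> Span G f.
Proof.
  intros H N. destruct (H N) as (g & H1 & H2). destruct (H1 N) as (g' & H3 & H4).
  exists g'. split; [assumption|]. now apply eqN_trans with g.
Qed.
Lemma span_sum G f N : (forall k, (k < N)%nat -> Span G (f k)) -> Span G (sump f N).
Proof. induction N; intros H; simpl; [apply span_0|]. apply span_add; auto. Qed.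

(* Linear operators with the modulus of q-adic continuity of U5. *)
Record clin (A : ps -> ps) : Prop := {
  clin_add : forall f g, A (f + g) = A f + A g;
  clin_scal : forall z f, A (#z * f) = #z * A f;
  clin_cont : forall N f g, f =[5 * N] g -> A f =[N] A g }.

Lemma span_map A G G' f : clin A -> (forall g, G g -> Span G' (A g)) -> Span G f -> Span G' (A f).
Proof.
  intros [Hadd Hscal Hcont] HG Hf. apply span_closed. intros N.
  destruct (Hf (5 * N)%nat) as (g & Hg & E). exists (A g). split; [|now apply Hcont].
  clear E. induction Hg.
  - replace (#0) with (#0 * #0) by ring. rewrite Hscal. replace (#0 * A (#0)) with (#0) by ring.
    apply span_0.
  - rewrite Hadd, Hscal. apply span_add; [apply span_scal|]; auto.
Qed.

Lemma span_sub G f g : Span G f -> Span G g -> Span G (f - g).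
Proof.
  intros Hf Hg. replace (f - g) with (f + #(-1) * g) by ring.
  apply span_add; [|apply span_scal]; assumption.
Qed.
Lemma span_mono (G G' : ps -> Prop) f : (forall g, G g -> Span G' g) -> Span G f -> Span G' f.
Proof.
  intros H Hf. apply (span_map (fun f => f) G); auto. split; auto.
  intros N f0 g E. apply (eqN_le (5 * N)); [lia|assumption].
Qed.

Lemma clin_mul g : clin (pmul g).
Proof.
  split; intros; [ring..|]. apply eqN_mul; [apply eqN_refl|].
  apply (eqN_le (5 * N)); [lia|assumption].
Qed.
Lemma clin_U : clin U5.
Proof. split; intros; [apply U_add|apply U_scal|]. apply eqN_sect; [lia|assumption]. Qed.
Lemma clin_V : clin V5.
Proof.
  unfold V5. split; intros.
  - replace (mu * (f + g)) with (mu * f + mu * g) by ring. rewrite U_add. ring.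
  - replace (mu * (#z * f)) with (#z * (mu * f)) by ring. rewrite U_scal. ring.
  - apply eqN_mul; [apply eqN_refl|]. apply (clin_cont _ clin_U). apply eqN_mul; [apply eqN_refl|assumption].
Qed.
Lemma V_dil f g : V5 (dil 5 f * g) = f * V5 g.
Proof.
  unfold V5. replace (mu * (dil 5 f * g)) with (dil 5 f * (mu * g)) by ring. rewrite U_dil. ring.
Qed.

Lemma clin_sum A f N : clin A -> A (sump f N) = sump (fun k => A (f k)) N.
Proof.
  intros [Hadd Hscal _]. induction N; simpl.
  - replace (#0) with (#0 * #0) at 1 by ring. rewrite Hscal. ring.
  - now rewrite Hadd, IHN.
Qed.
Lemma clin_sub A f g : clin A -> A (f - g) = A f - A g.
Proof.
  intros [Hadd Hscal _]. replace (f - g) with (f + #(-1) * g) by ring. rewrite Hadd, Hscal. ring.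
Qed.

Definition gens (v : nat -> Z) (g : ps) : Prop := exists j, g = #(5 ^ v j) * xi ^ j.

Lemma span_monomial v z j : (5 ^ v j | z)%Z -> Span (gens v) (#z * xi ^ j).
Proof.
  intros [k ->]. rewrite cst_mul.
  replace (#k * #(5 ^ v j) * xi ^ j) with (#k * (#(5 ^ v j) * xi ^ j)) by ring.
  apply span_scal, span_gen. now exists j.
Qed.

Lemma span_shift v v' a l z f : (forall j, 0 <= v j)%Z -> (0 <= a)%Z ->
  (forall j, 0 <= v' (j + l)%nat <= v j + a)%Z -> (5 ^ a | z)%Z ->
  Span (gens v) f -> Span (gens v') (#z * xi ^ l * f).
Proof.
  intros H0 Ha H [k ->]. apply (span_map (pmul _)); [apply clin_mul|].
  intros g [j ->]. rewrite cst_mul.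
  replace (#k * #(5 ^ a) * xi ^ l * (#(5 ^ v j) * xi ^ j)) with
    (#k * (#(5 ^ a) * #(5 ^ v j) * (xi ^ j * xi ^ l))) by ring.
  rewrite <- cst_mul, <- ppow_add. apply span_scal, span_monomial.
  rewrite <- Z.pow_add_r by auto. specialize (H j). specialize (H0 j).
  exists (5 ^ (a + v j - v' (j + l)%nat))%Z.
  rewrite <- Z.pow_add_r by lia. f_equal. lia.
Qed.

Fixpoint divisible_from (v : nat -> Z) (j : nat) (l : list Z) : bool :=
  match l with nil => true | c :: l' => ((c mod 5 ^ v j =? 0)%Z && divisible_from v (S j) l')%bool end.

Lemma mul_peval b v v' l f : (forall j, 0 <= v j)%Z -> (forall j, 0 <= b j)%Z ->
  (forall i j, 0 <= v' (i + j)%nat <= v i + b j)%Z -> divisible_from b 0 l = true ->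
  Span (gens v) f -> Span (gens v') (peval l xi * f).
Proof.
  intros Hv Hb H D Hf.
  enough (A : forall l j, divisible_from b j l = true -> Span (gens v') (xi ^ j * peval l xi * f)).
  { replace (peval l xi * f) with (xi ^ 0 * peval l xi * f) by ring. now apply A. }
  clear l D. induction l as [|c l IH]; intros j D; cbn [peval].
  - replace (xi ^ j * #0 * f) with (#0) by ring. apply span_0.
  - cbn [divisible_from] in D. apply andb_prop in D as [D1 D2]. apply Z.eqb_eq in D1.
    replace (xi ^ j * (#c + xi * peval l xi) * f) with
      (#c * xi ^ j * f + xi ^ S j * peval l xi * f) by (simpl; ring).
    apply span_add; [|now apply IH].
    apply (span_shift v v' (b j)); auto. apply Z.mod_divide; auto.
    specialize (Hb j). apply Z.pow_nonzero; lia.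
Qed.

Lemma span_peval v l : (forall j, 0 <= v j)%Z -> divisible_from v 0 l = true ->
  Span (gens v) (peval l xi).
Proof.
  intros Hv D.
  enough (A : forall l j, divisible_from v j l = true -> Span (gens v) (xi ^ j * peval l xi)).
  { replace (peval l xi) with (xi ^ 0 * peval l xi) by ring. now apply A. }
  clear l D. induction l as [|c l IH]; intros j D; cbn [peval].
  - replace (xi ^ j * #0) with (#0) by ring. apply span_0.
  - cbn [divisible_from] in D. apply andb_prop in D as [D1 D2]. apply Z.eqb_eq in D1.
    replace (xi ^ j * (#c + xi * peval l xi)) with (#c * xi ^ j + xi ^ S j * peval l xi) by (simpl; ring).
    apply span_add; [|now apply IH]. apply span_monomial, Z.mod_divide; auto.
    specialize (Hv j). apply Z.pow_nonzero; lia.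
Qed.

(* The bound v(t_ij) >= (5 j - i - 1) / 6 on the matrix of U5 in powers of xi is what the modular
   equation propagates; wt is its shape. *)
Definition wt (a c : Z) (j : nat) : Z := (a + Z.max 0 ((5 * Z.of_nat j + c) / 6))%Z.
(** The shape of the expansion of 1 / (1 + 5 xi), which brings one factor 5 with each xi; the offset
    c makes room for a polynomial in xi in front of it. *)
Definition wt_src (c : Z) (j : nat) : Z := Z.max 0 (Z.of_nat j - c).
Notation Lam a c := (Span (gens (wt a c))).
Notation Src c := (Span (gens (wt_src c))).

Lemma wt_nonneg a c j : (0 <= a)%Z -> (0 <= wt a c j)%Z.
Proof. unfold wt. lia. Qed.

(* Coefficients of xi^5 - y; they are divisible by 5. *)
Definition modular_coefs_5 (k : nat) : list Z :=
  match k with O => ladd (modular_coefs 0) [0; -1]%Z | _ => modular_coefs k end.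

(** A is U5 or V5. Both satisfy the recurrence given by the modular equation and differ in their
    first five rows and in the constant c0, which is -1 for U5 and 1 for V5. *)
Section Operator.
Variable A : ps -> ps.
Variable c0 : Z.
Variable init : nat -> list Z.
Hypothesis A_clin : clin A.
Hypothesis A_dil : forall f g, A (dil 5 f * g) = f * A g.
Hypothesis A_init : forall i, (i < 5)%nat -> A (xi ^ i) = peval (init i) xi.
Hypothesis init_div : forall i, (i < 5)%nat -> divisible_from (wt 0 (c0 - Z.of_nat i)) 0 (init i) = true.

Lemma peval_dil l k f : (0 < k)%nat -> dil k (peval l f) = peval l (dil k f).
Proof.
  intros Hk. induction l; cbn [peval]; [now apply dil_cst|].
  now rewrite dil_add, dil_mul, dil_cst, IHl by auto.
Qed.

Lemma A_rec i : A (xi ^ (i + 5)) = sump (fun k => peval (modular_coefs k) xi * A (xi ^ (i + k))) 5.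
Proof.
  rewrite ppow_add, x_quintic, <- sump_scal, (clin_sum A) by auto. apply sump_ext. intros k _.
  rewrite <- peval_dil, <- A_dil by lia. f_equal. rewrite ppow_add. ring.
Qed.

Lemma A_rec_5 i : A (xi ^ (i + 5)) - xi * A (xi ^ i)
  = sump (fun k => peval (modular_coefs_5 k) xi * A (xi ^ (i + k))) 5.
Proof.
  rewrite A_rec. unfold modular_coefs_5. cbn [sump]. rewrite peval_ladd, Nat.add_0_r.
  cbn [peval]. ring.
Qed.

(** In the recurrence the numerators of the bounds for a coefficient of the modular equation and for
    row i - 5 + k add up to 5 more than the numerator for row i, and 5 is the most that rounding
    down two sixths can lose. *)
Lemma A_monomial i : Lam 0 (c0 - Z.of_nat i) (A (xi ^ i)).
Proof.
  induction i as [i IH] using lt_wf_ind. destruct (Nat.lt_ge_cases i 5) as [L|L].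
  - rewrite A_init by auto. apply span_peval; auto. intros; apply wt_nonneg; lia.
  - replace i with ((i - 5) + 5)%nat at 2 by lia. rewrite A_rec. apply span_sum.
    intros k Hk. apply (mul_peval (fun j => Z.max 0 ((5 * Z.of_nat j + Z.of_nat k) / 6)%Z)
      (wt 0 (c0 - Z.of_nat (i - 5 + k)))).
    + intros; apply wt_nonneg; lia.
    + intros; lia.
    + intros a b. unfold wt. lia.
    + do 5 (destruct k as [|k]; [vm_compute; reflexivity|]). lia.
    + apply IH. lia.
Qed.

(** xi^5 is congruent to xi(q^5) modulo 5, and xi(q^5) leaves A as the factor xi. Modulo 5 times the
    lattice, row i + 5 is therefore row i shifted by one. *)
Lemma A_monomial_5 i : (-4 <= c0 - Z.of_nat i)%Z -> Lam 1 (-16) (A (xi ^ (i + 5)) - xi * A (xi ^ i)).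
Proof.
  intros H. rewrite A_rec_5. apply span_sum. intros k Hk.
  apply (mul_peval (fun j => Z.max 1 ((5 * Z.of_nat j + Z.of_nat k) / 6)%Z)
      (wt 0 (c0 - Z.of_nat (i + k)))).
  - intros; apply wt_nonneg; lia.
  - intros; lia.
  - intros a b. unfold wt. lia.
  - do 5 (destruct k as [|k]; [vm_compute; reflexivity|]). lia.
  - apply A_monomial.
Qed.

(** The bound for A(xi^j) deteriorates by one sixth per unit of j, which the factor 5^(j - c) of the
    generator more than repays. *)
Lemma A_src c f : Src c f -> Lam 0 (c0 - c) (A f).
Proof.
  apply span_map; auto. intros g [j ->]. rewrite (clin_scal A) by auto.
  replace (#(5 ^ wt_src c j) * A (xi ^ j)) with (#(5 ^ wt_src c j) * xi ^ 0 * A (xi ^ j)) by ring.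
  apply (span_shift (wt 0 (c0 - Z.of_nat j)) _ (wt_src c j)).
  - intros; apply wt_nonneg; lia.
  - unfold wt_src. lia.
  - intros i. unfold wt, wt_src. lia.
  - apply Z.divide_refl.
  - apply A_monomial.
Qed.
End Operator.

Definition inv5x : ps := pinv (#1 + #5 * xi).
Lemma inv5x_spec : (#1 + #5 * xi) * inv5x = #1.
Proof.
  apply mul_pinv. unfold padd. rewrite mul_coef_0, x_0. reflexivity.
Qed.

Lemma src_inv5x c f : Src c f -> Src c (inv5x * f).
Proof.
  apply span_map; [apply clin_mul|]. intros g [j ->]. apply span_closed. intros N.
  exists (geom (#(-5) * xi) N * (#(5 ^ wt_src c j) * xi ^ j)). split.
  - induction N; simpl.
    + match goal with |- Span _ ?f => replace f with (#0) by ring end. apply span_0.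
    + replace ((geom (#(-5) * xi) N + (#(-5) * xi) ^ N) * (#(5 ^ wt_src c j) * xi ^ j)) with
        (geom (#(-5) * xi) N * (#(5 ^ wt_src c j) * xi ^ j) +
         #((-5) ^ Z.of_nat N * 5 ^ wt_src c j) * xi ^ (N + j)).
      2:{ rewrite cst_mul, <- cst_pow, ppow_add, ppow_mul_base. ring. }
      apply span_add; [assumption|]. apply span_monomial.
      replace ((-5) ^ Z.of_nat N)%Z with ((-1) ^ Z.of_nat N * 5 ^ Z.of_nat N)%Z.
      2:{ rewrite <- Z.pow_mul_l. reflexivity. }
      rewrite <- Z.mul_assoc, <- Z.pow_add_r by (unfold wt_src; lia).
      apply Z.divide_mul_r. exists (5 ^ (Z.of_nat N + wt_src c j - wt_src c (N + j)))%Z.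
      rewrite <- Z.pow_add_r by (unfold wt_src; lia). f_equal. lia.
  - apply eqN_mul; [|apply eqN_refl]. unfold inv5x.
    replace (#(-5) * xi) with (#1 - (#1 + #5 * xi)) by ring. apply pinv_geom.
    unfold padd. rewrite mul_coef_0, x_0. reflexivity.
Qed.

Lemma src_peval c l f j d : divisible_from (wt_src d) 0 l = true -> (Z.of_nat j + d <= c)%Z ->
  f = xi ^ j * peval l xi -> Src c f.
Proof.
  intros D H ->.
  replace (xi ^ j * peval l xi) with (#1 * xi ^ j * peval l xi) by ring.
  apply (span_shift (wt_src d) _ 0).
  - intros; unfold wt_src; lia.
  - lia.
  - intros i. unfold wt_src. lia.
  - apply Z.divide_1_l.
  - apply span_peval; auto. intros; unfold wt_src; lia.
Qed.

Lemma U_src c f : Src c f -> Lam 0 (-1 - c) (U5 f).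
Proof.
  apply (A_src U5 (-1) Ux); auto using clin_U, U_dil, Ux_eq.
  intros i Hi. do 5 (destruct i as [|i]; [vm_compute; reflexivity|]). lia.
Qed.
Lemma V_src c f : Src c f -> Lam 0 (1 - c) (V5 f).
Proof.
  apply (A_src V5 1 Vx); auto using clin_V, V_dil, Vx_eq.
  intros i Hi. do 5 (destruct i as [|i]; [vm_compute; reflexivity|]). lia.
Qed.
Lemma U_5 i : (i <= 3)%nat -> Lam 1 (-16) (U5 (xi ^ (i + 5)) - xi * U5 (xi ^ i)).
Proof.
  intros H. apply (A_monomial_5 U5 (-1) Ux); auto using clin_U, U_dil, Ux_eq; [|lia].
  intros k Hk. do 5 (destruct k as [|k]; [vm_compute; reflexivity|]). lia.
Qed.
Lemma V_5 i : (i <= 5)%nat -> Lam 1 (-16) (V5 (xi ^ (i + 5)) - xi * V5 (xi ^ i)).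
Proof.
  intros H. apply (A_monomial_5 V5 1 Vx); auto using clin_V, V_dil, Vx_eq; [|lia].
  intros k Hk. do 5 (destruct k as [|k]; [vm_compute; reflexivity|]). lia.
Qed.

(* The two alternating steps on the lattices *)
Local Opaque Ux Vx.

(* With d the generating function, U5(q d f) = d mu T_even f and U5(q d mu f) = d T_odd f. *)
Definition T_even (f : ps) : ps := V5 ((#1 + #4 * xi) ^ 4 * xi * inv5x * f).
Definition T_odd (f : ps) : ps := U5 ((#1 + #4 * xi) ^ 5 * xi * inv5x * f).

(** With the offset 16 exactly 1, xi, ..., xi^4 carry no factor 5, so that cancellation modulo 5 in
    the even step has to be inspected for five monomials only. *)
Definition even_gens : ps -> Prop := gens (wt 0 (-16)).
(* T_odd (xi - xi^2) vanishes modulo 5 although T_odd xi does not: this gains the factor 5 at every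
   second step. *)
Definition odd_gens (g : ps) : Prop := g = xi - xi ^ 2 \/ gens (wt 1 (-16)) g.
Definition scaled (k : Z) (G : ps -> Prop) (g : ps) : Prop := exists g0, G g0 /\ g = #(5 ^ k) * g0.

Lemma clin_T_even : clin T_even.
Proof.
  destruct clin_V as [H1 H2 H3]. unfold T_even. split; intros.
  - rewrite <- H1. f_equal. ring.
  - rewrite <- H2. f_equal. ring.
  - apply H3. apply eqN_mul; [apply eqN_refl|assumption].
Qed.
Lemma clin_T_odd : clin T_odd.
Proof.
  destruct clin_U as [H1 H2 H3]. unfold T_odd. split; intros.
  - rewrite <- H1. f_equal. ring.
  - rewrite <- H2. f_equal. ring.
  - apply H3. apply eqN_mul; [apply eqN_refl|assumption].
Qed.

Lemma span_scaled k G f : Span G f -> Span (scaled k G) (#(5 ^ k) * f).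
Proof.
  apply span_map; [apply clin_mul|]. intros g Hg. apply span_gen. now exists g.
Qed.
Lemma span_scaled_map A k a G G' f : (0 <= k)%Z -> (0 <= a)%Z -> clin A ->
  (forall g, G g -> Span (scaled a G') (A g)) -> Span (scaled k G) f -> Span (scaled (k + a) G') (A f).
Proof.
  intros Hk Ha HA H. apply span_map; auto. intros g (g0 & Hg & ->). rewrite (clin_scal A) by auto.
  apply H in Hg. revert Hg. apply span_map; [apply clin_mul|]. intros g (g1 & Hg & ->).
  apply span_gen. exists g1. split; auto. rewrite Z.pow_add_r, cst_mul by lia. ring.
Qed.
Lemma span_scaled_gens k f : (0 <= k)%Z ->
  Span (gens (wt k (-16))) f -> Span (scaled k even_gens) f.
Proof.
  intros Hk. apply span_mono. intros g [j ->]. apply span_gen.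
  exists (#(5 ^ wt 0 (-16) j) * xi ^ j). split; [now exists j|]. unfold wt.
  rewrite Z.pow_add_r, cst_mul, Z.add_0_l by lia. ring.
Qed.
Lemma span_scaled_dvd k G f n : (0 <= k)%Z -> Span (scaled k G) f -> (5 ^ k | f n)%Z.
Proof.
  intros Hk H. destruct (H (S n)) as (g & Hg & E). rewrite E by lia. clear E H.
  induction Hg as [|z g f' (g0 & _ & ->) _ IH].
  - unfold cst. destruct (n =? 0)%nat; apply Z.divide_0_r.
  - unfold padd. apply Z.divide_add_r; auto. rewrite !pmul_cst_l.
    apply Z.divide_mul_r, Z.divide_factor_l.
Qed.

Lemma src_times_inv5x c j d l : divisible_from (wt_src d) 0 l = true -> (Z.of_nat j + d <= c)%Z ->
  Src c (xi ^ j * peval l xi * inv5x).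
Proof.
  intros D H. rewrite pmul_comm. apply src_inv5x. now apply (src_peval c l _ j d).
Qed.

Lemma Lam_scal_le z a b c c' f : (0 <= a)%Z -> (0 <= b)%Z -> (5 ^ a | z)%Z ->
  (forall j, wt b c' j <= wt 0 c j + a)%Z -> Lam 0 c f -> Lam b c' (#z * f).
Proof.
  intros Ha Hb D H Hf. replace (#z * f) with (#z * xi ^ 0 * f) by ring.
  apply (span_shift (wt 0 c) _ a); auto.
  - intros; apply wt_nonneg; lia.
  - intros j. rewrite Nat.add_0_r. split; [now apply wt_nonneg|apply H].
Qed.

(* V5(xi^j) modulo 5 times the lattice spanned by even_gens. *)
Definition V_res (j : nat) : list Z :=
  nth j [[]; [0; -1]; [0; 3]; [0; 3]; [0; -1]; [0; 1]; [0; 0; -1]; [0; 0; 3]; [0; 0; 3]; [0; 0; -1]]%Z [].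

(** Rows 1 to 4 are computed; rows 5 to 9 are, by [V_5], the shifts of rows 0 to 4. *)
Lemma V_residue j : (1 <= j <= 9)%nat -> Lam 1 (-16) (V5 (xi ^ j) - peval (V_res j) xi).
Proof.
  intros Hj. destruct (Nat.lt_ge_cases j 5) as [L|L].
  - rewrite Vx_eq by auto.
    replace (peval (Vx j) xi - peval (V_res j) xi) with (peval (ladd (Vx j) (lscal (-1) (V_res j))) xi)
      by (rewrite peval_ladd, peval_lscal; ring).
    apply span_peval; [intros; apply wt_nonneg; lia|].
    destruct j; [lia|]. do 4 (destruct j as [|j]; [vm_compute; reflexivity|]). lia.
  - pose proof (V_5 (j - 5) ltac:(lia)) as H. replace (j - 5 + 5)%nat with j in H by lia.
    replace (V5 (xi ^ j) - peval (V_res j) xi) with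
      ((V5 (xi ^ j) - xi * V5 (xi ^ (j - 5))) + (xi * V5 (xi ^ (j - 5)) - peval (V_res j) xi)) by ring.
    apply span_add; [exact H|]. clear H. rewrite Vx_eq by lia.
    replace (xi * peval (Vx (j - 5)) xi - peval (V_res j) xi) with
      (peval (ladd (0 :: Vx (j - 5))%Z (lscal (-1) (V_res j))) xi)
      by (rewrite peval_ladd, peval_lscal; cbn [peval]; ring).
    apply span_peval; [intros; apply wt_nonneg; lia|].
    do 5 (destruct j as [|j]; [lia|]).
    do 5 (destruct j as [|j]; [vm_compute; reflexivity|]). lia.
Qed.

Lemma odd_span_Lam f : Lam 1 (-16) f -> Span odd_gens f.
Proof. apply span_mono. intros g Hg. apply span_gen. now right. Qed.

Lemma T_even_small i : (i <= 4)%nat -> Span odd_gens (T_even (xi ^ i)).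
Proof.
  intros Hi. pose proof clin_V as [Vadd Vscal _].
  (* Chosen so that (1 + 4 xi)^4 = (1 + 5 xi)(1 + xi + xi^2 + xi^3 + xi^4) + 5 r(xi): modulo 5 the
     multiplier is a sum of five consecutive powers of xi. *)
  set (r := [0; 2; 18; 50; 50; -1]%Z).
  assert (E : T_even (xi ^ i) = V5 (xi ^ (i + 1)) + V5 (xi ^ (i + 2)) + V5 (xi ^ (i + 3)) + V5 (xi ^ (i + 4))
     + V5 (xi ^ (i + 5)) + #5 * V5 (xi ^ (i + 1) * peval r xi * inv5x)).
  { rewrite <- Vscal, <- !Vadd. unfold T_even. f_equal. rewrite !ppow_add. unfold r. cbn [peval].
    transitivity (xi * xi ^ i * ((#1 + #5 * xi) * inv5x * (#1 + xi + xi ^ 2 + xi ^ 3 + xi ^ 4)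
      + #5 * (#2 * xi + #18 * xi ^ 2 + #50 * xi ^ 3 + #50 * xi ^ 4 - xi ^ 5) * inv5x)); [ring|].
    rewrite inv5x_spec. ring. }
  rewrite E.
  assert (H5 : Span odd_gens (#5 * V5 (xi ^ (i + 1) * peval r xi * inv5x))).
  { apply odd_span_Lam. apply (Lam_scal_le 5 1 1 (1 - (Z.of_nat i + 6))).
    - lia.
    - lia.
    - apply Z.divide_refl.
    - intros j. unfold wt. lia.
    - apply V_src, (src_times_inv5x _ _ 5); [reflexivity|lia]. }
  apply span_add; [|exact H5]. clear H5 E.
  assert (D : forall j, (1 <= j <= 9)%nat -> exists f, Span odd_gens f /\
    V5 (xi ^ j) = peval (V_res j) xi + f).
  { intros j Hj. exists (V5 (xi ^ j) - peval (V_res j) xi). split; [|ring].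
    now apply odd_span_Lam, V_residue. }
  destruct (D (i + 1)%nat ltac:(lia)) as (f1 & F1 & ->).
  destruct (D (i + 2)%nat ltac:(lia)) as (f2 & F2 & ->).
  destruct (D (i + 3)%nat ltac:(lia)) as (f3 & F3 & ->).
  destruct (D (i + 4)%nat ltac:(lia)) as (f4 & F4 & ->).
  destruct (D (i + 5)%nat ltac:(lia)) as (f5 & F5 & ->).
  assert (G1 : Span odd_gens (xi - xi ^ 2)) by (apply span_gen; now left).
  assert (G2 : Span odd_gens (#5 * xi)).
  { apply odd_span_Lam. replace (#5 * xi) with (#5 * xi ^ 1) by ring. apply span_monomial.
    apply Z.divide_refl. }
  (* In each window of five consecutive entries of [V_res] the coefficients of xi and xi^2 add up to
     5. Hence t = 1, and z is minus the coefficient of xi^2. *)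
  assert (C : exists z t, peval (V_res (i + 1)) xi + peval (V_res (i + 2)) xi + peval (V_res (i + 3)) xi
    + peval (V_res (i + 4)) xi + peval (V_res (i + 5)) xi = #z * (xi - xi ^ 2) + #t * (#5 * xi)).
  { destruct i as [|[|[|[|[|i]]]]]; [exists 0%Z, 1%Z|exists 1%Z, 1%Z|exists (-2)%Z, 1%Z
     |exists (-5)%Z, 1%Z|exists (-4)%Z, 1%Z|lia]; unfold V_res; cbn [nth Nat.add peval]; ring. }
  destruct C as (z & t & C).
  match goal with |- Span _ ?f => replace f with
    (#z * (xi - xi ^ 2) + #t * (#5 * xi) + f1 + f2 + f3 + f4 + f5) by (rewrite <- C; ring) end.
  auto 10 using span_add, span_scal.
Qed.

Lemma T_even_gen g : even_gens g -> Span odd_gens (T_even g).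
Proof.
  intros [i ->]. rewrite (clin_scal _ clin_T_even). destruct (Nat.le_gt_cases i 4) as [L|L].
  - now apply span_scal, T_even_small.
  (* From xi^5 on, the power of 5 carried by the generator suffices without any cancellation. *)
  - apply odd_span_Lam.
    assert (E : T_even (xi ^ i) = V5 (xi ^ (i + 1) * peval (lpow [1; 4]%Z 4) xi * inv5x)).
    { unfold T_even. f_equal. rewrite peval_lpow, ppow_add. cbn [peval]. ring. }
    rewrite E. apply (Lam_scal_le _ (wt 0 (-16) i) 1 (1 - (Z.of_nat i + 5))).
    + apply wt_nonneg; lia.
    + lia.
    + apply Z.divide_refl.
    + intros j. unfold wt. lia.
    + apply V_src, (src_times_inv5x _ _ 4); [reflexivity|lia].
Qed.

Lemma T_odd_gen g : odd_gens g -> Span (scaled 1 even_gens) (T_odd g).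
Proof.
  intros Hg. apply span_scaled_gens; [lia|]. destruct Hg as [->|[i ->]].
  - pose proof clin_U as [Uadd Uscal _].
    (* Chosen so that (1 + 4 xi)^5 = (1 + 5 xi)(1 + 1024 xi^5) + 5 r(xi). Modulo 5 only U5 of xi^2,
       xi^3, xi^7 and xi^8 remain; the last two reduce to the first two by [U_5], and U5(xi^2) -
       U5(xi^3) lies in 5 times the lattice by computation. *)
    set (r := [0; 3; 32; 128; 256; 0; -1024]%Z).
    assert (E : T_odd (xi - xi ^ 2) = (U5 (xi ^ 2) - U5 (xi ^ 3)) + #1024 * ((U5 (xi ^ (2 + 5)) - xi * U5 (xi ^ 2))
      - (U5 (xi ^ (3 + 5)) - xi * U5 (xi ^ 3)) + xi * (U5 (xi ^ 2) - U5 (xi ^ 3)))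
      + #5 * U5 (xi ^ 2 * peval (lmul [1; -1]%Z r) xi * inv5x)).
    { transitivity (U5 (xi ^ 2) - U5 (xi ^ 3) + #1024 * (U5 (xi ^ (2 + 5)) - U5 (xi ^ (3 + 5)))
       + #5 * U5 (xi ^ 2 * peval (lmul [1; -1]%Z r) xi * inv5x)); [|ring].
      rewrite <- !(clin_sub U5) by apply clin_U. rewrite <- !Uscal, <- !Uadd. unfold T_odd. f_equal.
      rewrite peval_lmul. unfold r. cbn [peval].
      transitivity ((xi ^ 2 - xi ^ 3) * ((#1 + #5 * xi) * inv5x * (#1 + #1024 * xi ^ 5)
        + #5 * (#3 * xi + #32 * xi ^ 2 + #128 * xi ^ 3 + #256 * xi ^ 4 - #1024 * xi ^ 6) * inv5x)); [ring|].
      rewrite inv5x_spec. simpl Nat.add. ring. }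
    rewrite E.
    assert (D : forall l, divisible_from (wt 1 (-16)) 0 l = true -> Lam 1 (-16) (peval l xi)).
    { intros l. apply span_peval. intros; apply wt_nonneg; lia. }
    assert (B : U5 (xi ^ 2) - U5 (xi ^ 3) = peval (ladd (Ux 2) (lscal (-1) (Ux 3))) xi).
    { rewrite !Ux_eq, peval_ladd, peval_lscal by lia. ring. }
    rewrite B. apply span_add; [apply span_add|].
    + apply D. vm_compute. reflexivity.
    + apply span_scal, span_add; [apply span_sub; apply U_5; lia|].
      match goal with |- Span _ (xi * peval ?l xi) =>
        replace (xi * peval l xi) with (peval (0%Z :: l) xi) by (cbn [peval]; ring) end.
      apply D. vm_compute. reflexivity.
    + apply (Lam_scal_le 5 1 1 (-1 - 9)).
      * lia.
      * lia.
      * apply Z.divide_refl.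
      * intros j. unfold wt. lia.
      * apply U_src, (src_times_inv5x _ _ 7); [reflexivity|lia].
  - rewrite (clin_scal _ clin_T_odd).
    assert (E : T_odd (xi ^ i) = U5 (xi ^ (i + 1) * peval (lpow [1; 4]%Z 5) xi * inv5x)).
    { unfold T_odd. f_equal. rewrite peval_lpow, ppow_add. cbn [peval]. ring. }
    rewrite E. apply (Lam_scal_le _ (wt 1 (-16) i) 1 (-1 - (Z.of_nat i + 6))).
    + apply wt_nonneg; lia.
    + lia.
    + apply Z.divide_refl.
    + intros j. unfold wt. lia.
    + apply U_src, (src_times_inv5x _ _ 5); [reflexivity|lia].
Qed.

(** Row 5 is needed exactly, because the first step is examined modulo 25 times the lattice, where
    the congruence of [V_5] for this row is too weak. *)
Definition Vx5 : list Z :=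
  ladd (lmul (modular_coefs 0) (Vx 0)) (ladd (lmul (modular_coefs 1) (Vx 1))
   (ladd (lmul (modular_coefs 2) (Vx 2)) (ladd (lmul (modular_coefs 3) (Vx 3))
    (lmul (modular_coefs 4) (Vx 4))))).
Lemma Vx5_eq : V5 (xi ^ 5) = peval Vx5 xi.
Proof.
  pose proof (A_rec V5 clin_V V_dil 0) as H. cbn [sump Nat.add] in H. rewrite H.
  rewrite !Vx_eq by lia. unfold Vx5. rewrite !peval_ladd, !peval_lmul. ring.
Qed.

Local Opaque Vx5.

(** The initial gain. [T_even] brings no factor 5 on the whole lattice, but it does on the constant
    1, and the cofactor must still lie in the smaller odd lattice; hence precision 25 is
    required. *)
Lemma T_even_1 : Span (scaled 1 odd_gens) (T_even (#1)).
Proof.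
  pose proof clin_V as [Vadd Vscal _].
  (* Uses 1 / (1 + 5 xi) = 1 - 5 xi + 25 xi^2 / (1 + 5 xi); the integers are the coefficients of xi
     (1 + 4 xi)^4 (1 - 5 xi). *)
  assert (E : T_even (#1) = (V5 (xi ^ 1) + #11 * V5 (xi ^ 2) + #16 * V5 (xi ^ 3) + #(-224) * V5 (xi ^ 4)
     + #(-1024) * V5 (xi ^ 5) + #(-1280) * (xi * V5 (xi ^ 1))) +
     #(-1280) * (V5 (xi ^ (1 + 5)) - xi * V5 (xi ^ 1))
     + #25 * V5 (xi ^ 3 * peval (lpow [1; 4]%Z 4) xi * inv5x)).
  { transitivity (V5 (xi ^ 1) + #11 * V5 (xi ^ 2) + #16 * V5 (xi ^ 3) + #(-224) * V5 (xi ^ 4)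
     + #(-1024) * V5 (xi ^ 5) + #(-1280) * V5 (xi ^ (1 + 5))
     + #25 * V5 (xi ^ 3 * peval (lpow [1; 4]%Z 4) xi * inv5x)); [|ring].
    rewrite <- !Vscal, <- !Vadd. unfold T_even. f_equal. rewrite peval_lpow. cbn [peval].
    transitivity (xi * (#1 + #4 * xi) ^ 4 * ((#1 + #5 * xi) * inv5x * (#1 - #5 * xi)
      + #25 * xi ^ 2 * inv5x)); [ring|]. rewrite inv5x_spec. simpl Nat.add. ring. }
  rewrite E. clear E.
  assert (L2 : forall f, Lam 2 (-16) f -> Span (scaled 1 odd_gens) f).
  { intros f. apply span_mono. intros g [j ->]. apply span_gen.
    exists (#(5 ^ wt 1 (-16) j) * xi ^ j). split; [right; now exists j|]. unfold wt.
    rewrite !Z.pow_add_r, !cst_mul by lia.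
    change (5 ^ 2)%Z with (5 ^ 1 * 5 ^ 1)%Z. rewrite cst_mul. ring. }
  apply span_add; [apply span_add|].
  - replace (V5 (xi ^ 1) + #11 * V5 (xi ^ 2) + #16 * V5 (xi ^ 3) + #(-224) * V5 (xi ^ 4)
     + #(-1024) * V5 (xi ^ 5) + #(-1280) * (xi * V5 (xi ^ 1))) with
     (* Only the class of -199 modulo 5 matters, as 25 (xi - xi^2) lies in the lattice [Lam 2 (-16)]
        of the remainder; 995 = 5 * 199 compensates for it in the list. *)
     (#(-199) * (#(5 ^ 1) * (xi - xi ^ 2)) +
      peval (ladd [0; 995; -995]%Z (ladd (Vx 1) (ladd (lscal 11 (Vx 2)) (ladd (lscal 16 (Vx 3))
        (ladd (lscal (-224) (Vx 4)) (ladd (lscal (-1024) Vx5) (lscal (-1280) (0 :: Vx 1)%Z))))))) xi).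
    2:{ rewrite Vx5_eq, !Vx_eq by lia. rewrite !peval_ladd, !peval_lscal.
        change (5 ^ 1)%Z with 5%Z. cbn [peval]. ring. }
    apply span_add.
    + apply span_scal, span_gen. exists (xi - xi ^ 2). split; [now left|reflexivity].
    + apply L2, span_peval; [intros; apply wt_nonneg; lia|]. vm_compute. reflexivity.
  - apply L2. replace (#(-1280) * (V5 (xi ^ (1 + 5)) - xi * V5 (xi ^ 1))) with
      (#(-1280) * xi ^ 0 * (V5 (xi ^ (1 + 5)) - xi * V5 (xi ^ 1))) by ring.
    apply (span_shift (wt 1 (-16)) _ 1).
    + intros; apply wt_nonneg; lia.
    + lia.
    + intros j. unfold wt. lia.
    + exists (-256)%Z. reflexivity.
    + apply V_5. lia.
  - apply L2, (Lam_scal_le _ 2 2 (1 - 7)).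
    + lia.
    + lia.
    + apply Z.divide_refl.
    + intros j. unfold wt. lia.
    + apply V_src, (src_times_inv5x _ _ 4); [reflexivity|lia].
Qed.

Fixpoint T_iter (n : nat) : ps :=
  match n with O => #1 | S n' => if Nat.even n' then T_even (T_iter n') else T_odd (T_iter n') end.

(** The exponent is 1 after the first step and grows by 1 with every application of [T_odd]. *)
Lemma T_iter_span k : (0 < k)%nat ->
  Span (scaled (Z.of_nat (k / 2 + 1)) (if Nat.even k then even_gens else odd_gens)) (T_iter k).
Proof.
  assert (H : forall j, Span (scaled (Z.of_nat (j + 1)) odd_gens) (T_iter (2 * j + 1)) /\
    Span (scaled (Z.of_nat (j + 2)) even_gens) (T_iter (2 * j + 2))).
  { assert (Ev : forall j, Nat.even (2 * j) = true) by (intros; rewrite Nat.even_mul; reflexivity).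
    assert (O2 : forall j, Span (scaled (Z.of_nat (j + 1)) odd_gens) (T_iter (2 * j + 1)) ->
      Span (scaled (Z.of_nat (j + 2)) even_gens) (T_iter (2 * j + 2))).
    { intros j Hj. replace (2 * j + 2)%nat with (S (2 * j + 1)) by lia. cbn [T_iter].
      rewrite Nat.even_add, Ev. cbn [Nat.even Bool.eqb].
      replace (Z.of_nat (j + 2)) with (Z.of_nat (j + 1) + 1)%Z by lia.
      apply (span_scaled_map T_odd _ _ odd_gens); auto using clin_T_odd, T_odd_gen; lia. }
    induction j as [|j [IH1 IH2]].
    - split; [|apply O2]; exact T_even_1.
    - assert (B : Span (scaled (Z.of_nat (S j + 1)) odd_gens) (T_iter (2 * S j + 1))).
      { replace (2 * S j + 1)%nat with (S (2 * j + 2)) by lia. cbn [T_iter].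
        rewrite Nat.even_add, Ev. cbn [Nat.even Bool.eqb].
        replace (Z.of_nat (S j + 1)) with (Z.of_nat (j + 2) + 0)%Z by lia.
        apply (span_scaled_map T_even _ _ even_gens); auto using clin_T_even; try lia.
        intros g Hg. replace (T_even g) with (#(5 ^ 0) * T_even g) by (simpl; ring).
        now apply span_scaled, T_even_gen. }
      split; auto. }
  intros Hk. destruct (nat_divmod 2 k ltac:(lia)) as (t & r & Hr & ->).
  destruct r as [|[|r]]; [| |lia].
  - destruct t as [|t]; [lia|]. destruct (H t) as [_ H2].
    replace (2 * S t + 0)%nat with (2 * t + 2)%nat in * by lia.
    replace ((2 * t + 2) / 2 + 1)%nat with (t + 2)%nat.
    2:{ replace (2 * t + 2)%nat with ((t + 1) * 2)%nat by lia. rewrite Nat.div_mul; lia. }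
    rewrite Nat.even_add, Nat.even_mul. exact H2.
  - destruct (H t) as [H1 _].
    replace ((2 * t + 1) / 2 + 1)%nat with (t + 1)%nat.
    2:{ replace (2 * t + 1)%nat with (1 + t * 2)%nat by lia. rewrite Nat.div_add by lia. simpl. lia. }
    rewrite Nat.even_add, Nat.even_mul. exact H1.
Qed.

(** * The congruence for formal power series *)

Lemma psi_x : mono 1 * dil 5 psi ^ 2 = psi ^ 2 * xi * inv5x.
Proof.
  assert (E : psi ^ 2 * xi = mono 1 * dil 5 psi ^ 2 * (#1 + #5 * xi)).
  { apply (pmul_cancel (#(-4) * phi ^ 2)).
    - apply pmul_neq_0; [now apply cst_neq_0|]. apply ppow_neq_0, (coef_neq_0 _ 0).
      rewrite phi_0. lia.
    - pose proof psi_relation as R. fold phi5 in R. rewrite <- phi_m in R.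
      transitivity (phi ^ 2 * (#1 - mu ^ 2) * (psi ^ 2 - mono 1 * dil 5 psi ^ 2)
        + #(-4) * phi ^ 2 * xi * (mono 1 * dil 5 psi ^ 2)).
      { rewrite m_sq. ring. }
      match type of R with ?l = ?r =>
        transitivity (l + #(-4) * phi ^ 2 * xi * (mono 1 * dil 5 psi ^ 2)); [ring|] end.
      rewrite R.
      transitivity (#(-4) * mono 1 * dil 5 psi ^ 2 * phi ^ 2 * mu ^ 2
        + #(-4) * phi ^ 2 * xi * (mono 1 * dil 5 psi ^ 2)); [ring|]. rewrite m_sq. ring. }
  transitivity (mono 1 * dil 5 psi ^ 2 * ((#1 + #5 * xi) * inv5x)); [rewrite inv5x_spec; ring|].
  transitivity (psi ^ 2 * xi * inv5x); [rewrite E; ring|reflexivity].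
Qed.

Section Congruence.
Variable D : ps.
Hypothesis D_spec : D * euler_1 ^ 16 = euler_2 ^ 5.

Lemma D_phi_psi : D * (phi ^ 9 * psi ^ 2) = #1.
Proof.
  apply (pmul_cancel (euler_2 ^ 9 * euler_1 ^ 2)).
  - apply pmul_neq_0; apply ppow_neq_0, qprod_neq_0.
  - transitivity (D * ((phi * euler_2) ^ 9 * (psi * euler_1) ^ 2)); [ring|].
    rewrite phi_product, psi_product.
    transitivity (D * euler_1 ^ 16 * euler_1 ^ 2 * euler_2 ^ 4); [ring|]. rewrite D_spec. ring.
Qed.

Lemma D_dil : mono 1 * D = dil 5 D * (mu ^ 9 * xi * inv5x).
Proof.
  pose proof (f_equal (dil 5) D_phi_psi) as H.
  rewrite !dil_mul, !dil_pow, dil_cst in H by lia. fold phi5 in H. rewrite <- phi_m in H.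
  transitivity (mono 1 * D * #1); [ring|]. rewrite <- H.
  transitivity (D * dil 5 D * phi ^ 9 * mu ^ 9 * (mono 1 * dil 5 psi ^ 2)); [ring|].
  rewrite psi_x.
  transitivity (D * (phi ^ 9 * psi ^ 2) * (dil 5 D * (mu ^ 9 * xi * inv5x))); [ring|].
  rewrite D_phi_psi. ring.
Qed.

(* The coefficient of q^j, j >= 1, is D n for the n with 4 n - 1 = 5^a (4 j - 1). *)
Fixpoint slice (a : nat) : ps :=
  match a with O => D | S a' => U5 (mono 1 * slice a') end.

(** Since 9 is odd, the parity of the exponent of mu alternates: from an even a one factor mu is
    left over, and at the next step it completes mu^10 = (1 + 4 xi)^5. *)
Lemma slice_T a : slice a = D * ((if Nat.even a then #1 else mu) * T_iter a).
Proof.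
  induction a as [|a IH]; [simpl; ring|].
  assert (S : forall f, U5 (mono 1 * (D * f)) = D * U5 (mu ^ 9 * xi * inv5x * f)).
  { intros f. rewrite <- U_dil. f_equal. rewrite pmul_assoc, D_dil. ring. }
  cbn [slice T_iter]. rewrite IH, S, Nat.even_succ, <- Nat.negb_even. f_equal.
  destruct (Nat.even a); cbn [negb].
  - unfold T_even, V5.
    transitivity ((nu * mu) * U5 (mu ^ 9 * xi * inv5x * (#1 * T_iter a))); [rewrite h_m; ring|].
    transitivity (mu * (nu * U5 (mu ^ 9 * xi * inv5x * (#1 * T_iter a)))); [ring|].
    do 3 f_equal. rewrite <- m_sq. ring.
  - unfold T_odd. transitivity (U5 (mu ^ 9 * xi * inv5x * (mu * T_iter a))); [|rewrite <- m_sq].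
    + reflexivity.
    + replace (#1 * U5 ((mu ^ 2) ^ 5 * xi * inv5x * T_iter a)) with
        (U5 ((mu ^ 2) ^ 5 * xi * inv5x * T_iter a)) by ring. f_equal. ring.
Qed.

(** U5 after multiplication by q reads index 5 j - 1 instead of j, and 4 (5 j - 1) - 1 = 5 (4 j -
    1). *)
Lemma slice_coef a : forall j n, (1 <= j)%nat ->
  (4 * Z.of_nat n - 1 = 5 ^ Z.of_nat a * (4 * Z.of_nat j - 1))%Z -> slice a j = D n.
Proof.
  induction a as [|a IH]; intros j n Hj E.
  - cbn [slice]. f_equal. change (5 ^ Z.of_nat 0)%Z with 1%Z in E. lia.
  - cbn [slice]. unfold U5, sect. rewrite mono_mul_coef.
    destruct (Nat.ltb_spec (5 * j + 0) 1); [lia|]. apply IH; [lia|].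
    rewrite E, Nat2Z.inj_succ, Z.pow_succ_r by lia.
    rewrite Nat2Z.inj_sub by lia. rewrite Nat2Z.inj_add, Nat2Z.inj_mul. simpl (Z.of_nat _). ring.
Qed.

Lemma dvd_mul k (f g : ps) : (forall n, (k | f n)%Z) -> forall n, (k | (g * f)%ps n)%Z.
Proof.
  intros H n. unfold pmul. induction (seq 0 (S n)) as [|i l IH]; simpl; [apply Z.divide_0_r|].
  apply Z.divide_add_r; auto. apply Z.divide_mul_r, H.
Qed.

Theorem coef_congruence n a : (1 <= n)%nat -> (1 <= a)%nat ->
  (5 ^ Z.of_nat a | 4 * Z.of_nat n - 1)%Z -> (5 ^ (Z.of_nat a / 2 + 1) | D n)%Z.
Proof.
  intros Hn Ha [t Ht].
  assert (M : (5 ^ Z.of_nat a mod 4 = 1)%Z).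
  { clear. induction a; [reflexivity|]. rewrite Nat2Z.inj_succ, Z.pow_succ_r by lia. lia. }
  assert (P : (0 < 5 ^ Z.of_nat a)%Z) by (apply Z.pow_pos_nonneg; lia).
  (* 4 n - 1 is 3 and 5^a is 1 modulo 4, so the cofactor t is again of the form 4 j - 1, and j >= 1
     because t > 0. *)
  assert (Hm : (t mod 4 = 3)%Z).
  { assert ((t * 5 ^ Z.of_nat a) mod 4 = 3)%Z as E by lia.
    rewrite Zmult_mod, M, Z.mul_1_r, Z.mod_mod in E by lia. exact E. }
  assert (0 < t)%Z by nia.
  pose (j := Z.to_nat ((t + 1) / 4)).
  assert (Ej : (4 * Z.of_nat j - 1 = t)%Z) by (unfold j; lia).
  rewrite <- (slice_coef a j n); [|lia|rewrite Ej; lia].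
  rewrite slice_T. apply dvd_mul, dvd_mul. intros i.
  replace (Z.of_nat a / 2 + 1)%Z with (Z.of_nat (a / 2 + 1)).
  - eapply span_scaled_dvd; [lia|]. apply T_iter_span. lia.
  - rewrite Nat2Z.inj_add, Nat2Z.inj_div. reflexivity.
Qed.
End Congruence.

Local Close Scope ps_scope.
Local Close Scope Z_scope.
Local Open Scope R_scope.

(** * From real generating functions to formal power series *)

(** Absolute convergence is part of the notion because Cauchy products require it. *)
Definition evals (q : R) (f : ps) (l : R) : Prop :=
  is_series (fun n => IZR (f n) * q ^ n) l /\ ex_series (fun n => Rabs (IZR (f n) * q ^ n)).

Lemma IZR_lsum {A} (f : A -> Z) l :
  IZR (lsum f l) = List.fold_right (fun a s => IZR (f a) + s) 0 l.
Proof. induction l; simpl; [reflexivity|]. now rewrite plus_IZR, IHl. Qed.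

Lemma sum_f_R0_seq (g : nat -> R) n :
  sum_f_R0 g n = List.fold_right (fun a s => g a + s) 0 (List.seq 0 (S n)).
Proof.
  assert (H : forall l (c : R), List.fold_right (fun a s => g a + s) c l =
    List.fold_right (fun a s => g a + s) 0 l + c).
  { induction l; intros c; simpl; [ring|]. rewrite IHl. ring. }
  induction n; [simpl; ring|].
  rewrite List.seq_S, List.fold_right_app. simpl (List.fold_right _ 0 (cons _ nil)).
  rewrite H, <- IHn. simpl. ring.
Qed.

Lemma pmul_term q f g n : IZR (pmul f g n) * q ^ n =
  sum_f_R0 (fun k => (IZR (f k) * q ^ k) * (IZR (g (n - k)%nat) * q ^ (n - k))) n.
Proof.
  unfold pmul. rewrite IZR_lsum, Rmult_comm, (sum_eq _ (fun k => (IZR (f k * g (n - k)%nat)) * q ^ n)).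
  - rewrite <- scal_sum, sum_f_R0_seq. reflexivity.
  - intros k Hk. transitivity (IZR (f k) * IZR (g (n - k)%nat) * (q ^ k * q ^ (n - k))); [ring|].
    rewrite <- pow_add, <- mult_IZR. do 2 f_equal. lia.
Qed.

Lemma evals_mul q f g a b : evals q f a -> evals q g b -> evals q (pmul f g) (a * b).
Proof.
  intros [H1 H2] [H3 H4]. split.
  - eapply is_series_ext; [|apply (is_series_mult _ _ _ _ H1 H3 H2 H4)].
    intros n. symmetry. apply pmul_term.
  - destruct H2 as [A HA], H4 as [B HB].
    assert (HA' : ex_series (fun n => Rabs (Rabs (IZR (f n) * q ^ n)))).
    { exists A. eapply is_series_ext; [|exact HA]. intros; now rewrite Rabs_Rabsolu. }
    assert (HB' : ex_series (fun n => Rabs (Rabs (IZR (g n) * q ^ n)))).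
    { exists B. eapply is_series_ext; [|exact HB]. intros; now rewrite Rabs_Rabsolu. }
    eapply (ex_series_le (K := R_AbsRing) (V := R_CompleteNormedModule));
      [|exists (A * B); apply (is_series_mult _ _ _ _ HA HB HA' HB')].
    intros n. change norm with Rabs. cbv beta. rewrite Rabs_Rabsolu, pmul_term.
    eapply Rle_trans; [apply Rsum_abs|]. apply Req_le, sum_eq. intros. apply Rabs_mult.
Qed.

Lemma is_series_single (k : nat) (c : R) : is_series (fun n => if (n =? k)%nat then c else 0) c.
Proof.
  set (f := fun n => if (n =? k)%nat then c else 0).
  assert (F : forall n, n <> k -> f n = 0).
  { intros n Hn. unfold f. destruct (Nat.eqb_spec n k); [contradiction|reflexivity]. }
  assert (B : forall j, (j < k)%nat -> sum_f_R0 f j = 0).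
  { induction j; intros Hj; [apply F; lia|].
    change (sum_f_R0 f (S j)) with (sum_f_R0 f j + f (S j)). rewrite IHj, F by lia. ring. }
  assert (E : f k = c) by (unfold f; now rewrite Nat.eqb_refl).
  apply is_series_Reals. intros eps Heps. exists k. intros n Hn.
  assert (S : sum_f_R0 f n = c).
  { induction Hn as [|n Hn IH].
    - destruct k as [|k']; [exact E|].
      change (sum_f_R0 f (S k')) with (sum_f_R0 f k' + f (S k')). rewrite B, E by lia. ring.
    - change (sum_f_R0 f (S n)) with (sum_f_R0 f n + f (S n)). rewrite IH, F by lia. ring. }
  unfold Rdist. change (Rabs (sum_f_R0 f n - c) < eps).
  rewrite S, Rminus_diag, Rabs_R0. exact Heps.
Qed.

Lemma evals_single q k z : evals q (fun n => if (n =? k)%nat then z else 0%Z) (IZR z * q ^ k).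
Proof.
  split; [|exists (Rabs (IZR z * q ^ k))]; (eapply is_series_ext; [|apply (is_series_single k)]);
    intros n; simpl; destruct (Nat.eqb_spec n k) as [->|];
    rewrite ?Rmult_0_l, ?Rabs_R0; reflexivity.
Qed.

Lemma evals_cst q z : evals q (cst z) (IZR z).
Proof. replace (IZR z) with (IZR z * q ^ 0) by (simpl; ring). apply evals_single. Qed.

Lemma evals_mono q k : evals q (mono k) (q ^ k).
Proof. replace (q ^ k) with (IZR 1 * q ^ k) by ring. apply evals_single. Qed.

Lemma evals_add q f g a b : evals q f a -> evals q g b -> evals q (padd f g) (a + b).
Proof.
  intros [H1 H2] [H3 H4]. split.
  - eapply is_series_ext; [|apply (is_series_plus _ _ _ _ H1 H3)]. intros n.
    unfold padd. rewrite plus_IZR. change plus with Rplus. simpl. ring.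
  - eapply (ex_series_le (K := R_AbsRing) (V := R_CompleteNormedModule));
      [|apply (ex_series_plus _ _ H2 H4)].
    intros n. change norm with Rabs. change plus with Rplus. cbv beta.
    rewrite Rabs_Rabsolu. unfold padd. rewrite plus_IZR, Rmult_plus_distr_r. apply Rabs_triang.
Qed.

Lemma evals_pow q f a k : evals q f a -> evals q (ppow f k) (a ^ k).
Proof. intros H. induction k; simpl; [apply evals_cst|]. now apply evals_mul. Qed.

Lemma evals_bounded q f C : 0 <= C -> Rabs q <= / 4 -> (forall n, Rabs (IZR (f n)) <= C * 2 ^ n) ->
  exists l, evals q f l.
Proof.
  intros HC Hq H.
  assert (A : ex_series (fun n => Rabs (IZR (f n) * q ^ n))).
  { eapply (ex_series_le (K := R_AbsRing) (V := R_CompleteNormedModule)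
      _ (fun n => C * (/ 2) ^ n)).
    - intros n. change norm with Rabs. cbv beta. rewrite Rabs_Rabsolu, Rabs_mult, <- RPow_abs.
      apply Rle_trans with (C * 2 ^ n * (/ 4) ^ n).
      + apply Rmult_le_compat; auto using Rabs_pos, pow_le.
        apply pow_incr. split; [apply Rabs_pos|assumption].
      + rewrite Rmult_assoc, <- Rpow_mult_distr. apply Req_le. do 2 f_equal. field.
    - apply (ex_series_scal_l (K := R_AbsRing) C (fun n => (/ 2) ^ n)), ex_series_geom.
      rewrite Rabs_right; lra. }
  destruct (ex_series_Rabs _ A) as [l Hl]. exists l. now split.
Qed.

(** Equality near 0 determines all coefficients. Restricting to |q| <= 1/128 leaves room for crude
    coefficient bounds in the treatment of the infinite products. *)
Lemma evals_ext_small f g : (forall q, Rabs q <= / 128 -> exists l, evals q f l /\ evals q g l) -> f = g.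
Proof.
  intros H.
  assert (CV : forall f : ps, ex_series (fun n => Rabs (IZR (f n) * (/ 128) ^ n)) ->
    Rbar_lt 0 (CV_radius (fun n => IZR (f n)))).
  { intros f0 E. apply Rbar_lt_le_trans with (/ 128); [simpl; lra|].
    unfold CV_radius. apply (proj1 (Lub_Rbar_correct _)). exact E. }
  extensionality n. apply eq_IZR.
  destruct (H (/ 128)) as (l & [_ H1] & [_ H2]); [rewrite Rabs_right; lra|].
  apply (PSeries_ext_recip (fun n => IZR (f n)) (fun n => IZR (g n))); try now apply CV.
  exists (mkposreal (/ 128) ltac:(lra)). intros q Hq.
  destruct (H q) as (l' & [H3 _] & [H4 _]).
  - unfold ball in Hq. simpl in Hq. unfold AbsRing_ball, abs, minus, plus, opp in Hq. simpl in Hq.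
    rewrite Ropp_0, Rplus_0_r in Hq. lra.
  - unfold PSeries. now rewrite (is_series_unique _ _ H3), (is_series_unique _ _ H4).
Qed.

Section Pochhammer.
Variable c : nat.
Hypothesis Hc : (0 < c)%nat.

Definition poch_factor (k : nat) : ps := (#1 + #(-1) * mono (c + c * k))%ps.

(* Majorises the coefficients of the partial products, up to the factor 2^n. *)
Fixpoint half_prod (N : nat) : R :=
  match N with O => 1 | S N' => half_prod N' * (1 + (/ 2) ^ S N') end.

Lemma half_pow_pos n : 0 < (/ 2) ^ n.
Proof. apply pow_lt; lra. Qed.

Lemma half_prod_pos N : 0 < half_prod N.
Proof.
  induction N; [simpl; lra|]. pose proof (half_pow_pos (S N)).
  change (half_prod (S N)) with (half_prod N * (1 + (/ 2) ^ S N)).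
  apply Rmult_lt_0_compat; lra.
Qed.

Lemma half_prod_le N : half_prod N <= 3.
Proof.
  (* The constant bound 3 does not propagate, but 3 (1 - 2^(-N)) does; it holds with equality at N =
     1 and fails at N = 0, which is split off. *)
  destruct N; [simpl; lra|]. enough (half_prod (S N) <= 3 * (1 - (/ 2) ^ S N)).
  { pose proof (half_pow_pos (S N)). lra. }
  induction N; [simpl; lra|].
  change (half_prod (S (S N))) with (half_prod (S N) * (1 + (/ 2) ^ S (S N))).
  assert (E : (/ 2) ^ S N = 2 * (/ 2) ^ S (S N)) by (simpl; field).
  rewrite E in IHN. set (t := (/ 2) ^ S (S N)) in *. pose proof (half_pow_pos (S (S N))) as T.
  fold t in T. apply Rle_trans with (3 * (1 - 2 * t) * (1 + t)); [|nra].
  apply Rmult_le_compat_r; lra.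
Qed.

Lemma poch_coef_bound N : forall n, Rabs (IZR (prodp poch_factor N n)) <= half_prod N * 2 ^ n.
Proof.
  induction N; intros n.
  - simpl. unfold cst. destruct (Nat.eqb_spec n 0) as [->|].
    + rewrite Rabs_R1. simpl. lra.
    + rewrite Rabs_R0. pose proof (pow_lt 2 n). lra.
  - assert (E : prodp poch_factor (S N) n = (prodp poch_factor N n -
      (if (n <? c + c * N)%nat then 0 else prodp poch_factor N (n - (c + c * N))%nat))%Z).
    { rewrite <- mono_mul_coef. simpl prodp.
      replace (pmul (prodp poch_factor N) (poch_factor N)) with
        (prodp poch_factor N - mono (c + c * N) * prodp poch_factor N)%ps by (unfold poch_factor; ring).
      reflexivity. }
    rewrite E, minus_IZR. unfold Rminus. eapply Rle_trans; [apply Rabs_triang|]. rewrite Rabs_Ropp.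
    change (half_prod (S N)) with (half_prod N * (1 + (/ 2) ^ S N)).
    pose proof (half_prod_pos N). pose proof (half_pow_pos (S N)). pose proof (pow_lt 2 n ltac:(lra)).
    replace (half_prod N * (1 + (/ 2) ^ S N) * 2 ^ n) with
      (half_prod N * 2 ^ n + half_prod N * (/ 2) ^ S N * 2 ^ n) by ring.
    apply Rplus_le_compat; [apply IHN|].
    destruct (Nat.ltb_spec n (c + c * N)).
    + rewrite Rabs_R0. apply Rmult_le_pos; [apply Rmult_le_pos|]; lra.
    + eapply Rle_trans; [apply IHN|]. rewrite Rmult_assoc. apply Rmult_le_compat_l; [lra|].
      replace (2 ^ n) with (2 ^ S N * 2 ^ (n - S N)) by (rewrite <- pow_add; f_equal; nia).
      rewrite <- Rmult_assoc, <- Rpow_mult_distr, Rinv_l, pow1, Rmult_1_l by lra.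
      apply Rle_pow; [lra|]. nia.
Qed.

Lemma iprod_coef_bound n : Rabs (IZR (iprod poch_factor n)) <= 3 * 2 ^ n.
Proof.
  unfold iprod. eapply Rle_trans; [apply poch_coef_bound|].
  apply Rmult_le_compat_r; [apply pow_le; lra|apply half_prod_le].
Qed.

Lemma evals_prodp q N :
  evals q (prodp poch_factor (S N)) (prod_f_R0 (fun j => 1 - q ^ c * (q ^ c) ^ j) N).
Proof.
  assert (F : forall k, evals q (poch_factor k) (1 - q ^ c * (q ^ c) ^ k)).
  { intros k. replace (1 - q ^ c * (q ^ c) ^ k) with (1 + -1 * q ^ (c + c * k)).
    - apply evals_add; [apply (evals_cst q 1)|]. apply evals_mul; [apply (evals_cst q (-1))|].
      apply evals_mono.
    - rewrite pow_add, pow_mult. ring. }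
  induction N.
  - simpl. replace (1 - q ^ c * 1) with (1 * (1 - q ^ c * (q ^ c) ^ 0)) by (simpl; ring).
    apply evals_mul; [apply (evals_cst q 1)|apply F].
  - apply (evals_mul q _ _ _ _ IHN (F (S N))).
Qed.

(** The two series agree through q^N, and later coefficients differ by at most 3 * 2^n + 3 * 2^n. As
    2/128 = (1/16)(1/4), one factor gives the decay in N and the other a convergent geometric
    series. *)
Lemma evals_tail q l p N : Rabs q <= / 128 -> evals q (iprod poch_factor) l ->
  evals q (prodp poch_factor N) p -> Rabs (l - p) <= / 2 * (/ 16) ^ N.
Proof.
  intros Hq [H1 _] [H2 _].
  pose (t := fun n => IZR (iprod poch_factor n) * q ^ n - IZR (prodp poch_factor N n) * q ^ n).
  assert (H : is_series t (l - p)) by apply (is_series_minus _ _ _ _ H1 H2).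
  assert (B : forall n, Rabs (t n) <= 6 * (/ 16) ^ S N * (/ 4) ^ n).
  { intros n. unfold t.
    destruct (Nat.le_gt_cases n N) as [L|L].
    - rewrite (iprod_prodp _ N); [|apply unital_mono; intros; nia|lia].
      rewrite Rminus_diag, Rabs_R0. apply Rmult_le_pos; [apply Rmult_le_pos|]; try lra; apply pow_le; lra.
    - replace (IZR (iprod poch_factor n) * q ^ n - IZR (prodp poch_factor N n) * q ^ n)
        with ((IZR (iprod poch_factor n) + - IZR (prodp poch_factor N n)) * q ^ n) by ring.
      rewrite Rabs_mult, <- RPow_abs.
      apply Rle_trans with (6 * 2 ^ n * (/ 128) ^ n).
      + apply Rmult_le_compat; auto using Rabs_pos.
        * apply pow_le, Rabs_pos.
        * eapply Rle_trans; [apply Rabs_triang|]. rewrite Rabs_Ropp.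
          pose proof (iprod_coef_bound n). pose proof (poch_coef_bound N n).
          pose proof (half_prod_le N). pose proof (pow_lt 2 n ltac:(lra)). nra.
        * apply pow_incr. split; [apply Rabs_pos|assumption].
      + rewrite !Rmult_assoc. apply Rmult_le_compat_l; [lra|].
        rewrite <- Rpow_mult_distr. replace (2 * / 128) with (/ 16 * / 4) by field.
        rewrite Rpow_mult_distr. apply Rmult_le_compat_r; [apply pow_le; lra|].
        replace n with (S N + (n - S N))%nat by lia. rewrite pow_add.
        rewrite <- (Rmult_1_r ((/ 16) ^ S N)) at 2.
        apply Rmult_le_compat_l; [apply pow_le; lra|].
        rewrite <- (pow1 (n - S N)). apply pow_incr. lra. }
  assert (G : is_series (fun n => 6 * (/ 16) ^ S N * (/ 4) ^ n) (6 * (/ 16) ^ S N * / (1 - / 4))).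
  { apply (is_series_scal_l (K := R_AbsRing) (6 * (/ 16) ^ S N) (fun n => (/ 4) ^ n)).
    apply is_series_geom. rewrite Rabs_right; lra. }
  assert (A : ex_series (fun n => Rabs (t n))).
  { eapply (ex_series_le (K := R_AbsRing) (V := R_CompleteNormedModule)); [|eexists; exact G].
    intros n. change norm with Rabs. cbv beta. rewrite Rabs_Rabsolu. apply B. }
  rewrite <- (is_series_unique _ _ H).
  eapply Rle_trans; [apply Series_Rabs, A|].
  eapply Rle_trans; [apply Series_le; [|eexists; exact G]|].
  - intros n. split; [apply Rabs_pos|apply B].
  - rewrite (is_series_unique _ _ G). simpl. apply Req_le. field.
Qed.

Lemma evals_qpoch q : Rabs q <= / 128 ->
  evals q (iprod poch_factor) (qpoch (q ^ c) (q ^ c)) /\ qpoch (q ^ c) (q ^ c) <> 0.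
Proof.
  intros Hq.
  destruct (evals_bounded q (iprod poch_factor) 3) as [l Hl]; [lra|lra|apply iprod_coef_bound|].
  assert (E : qpoch (q ^ c) (q ^ c) = l).
  { assert (G : is_lim_seq (fun N => (/ 16) ^ S N) 0).
    { apply -> (is_lim_seq_incr_1 (fun N => (/ 16) ^ N)). apply is_lim_seq_geom.
      rewrite Rabs_right; lra. }
    unfold qpoch. rewrite (is_lim_seq_unique _ l); [reflexivity|].
    apply is_lim_seq_le_le with (u := fun N => l - / 2 * (/ 16) ^ S N)
      (w := fun N => l + / 2 * (/ 16) ^ S N).
    - intros N. pose proof (evals_tail q l _ _ Hq Hl (evals_prodp q N)) as T.
      apply Rabs_le_between in T. lra.
    - replace (Finite l) with (Finite (l - / 2 * 0)) by (f_equal; ring).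
      apply is_lim_seq_minus'; [apply is_lim_seq_const|].
      apply (is_lim_seq_scal_l _ (/ 2) 0), G.
    - replace (Finite l) with (Finite (l + / 2 * 0)) by (f_equal; ring).
      apply is_lim_seq_plus'; [apply is_lim_seq_const|].
      apply (is_lim_seq_scal_l _ (/ 2) 0), G. }
  rewrite E. split; [exact Hl|]. intros ->.
  (* Comparison with the empty product: the limit differs from 1 by at most 1/2 and cannot be 0. *)
  pose proof (evals_tail q 0 _ 0 Hq Hl (evals_cst q 1)) as T.
  unfold Rminus in T. rewrite Rplus_0_l, Rabs_Ropp, Rabs_R1 in T. simpl in T. lra.
Qed.
End Pochhammer.

(** Convergence at the single point 1/2 forces a radius of convergence of at least 1/2, inside which
    convergence is absolute. *)
Lemma evals_ps (f : ps) (s : R -> R) :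
  (forall q, Rabs q < 1 -> is_series (fun n => IZR (f n) * q ^ n) (s q)) ->
  forall q, Rabs q < / 2 -> evals q f (s q).
Proof.
  intros H q Hq. split; [apply H; lra|].
  apply (CV_disk_inside (fun n => IZR (f n))).
  apply Rbar_lt_le_trans with (/ 2); [exact Hq|].
  apply Rbar_not_lt_le. intros C.
  apply (CV_disk_outside (fun n => IZR (f n)) (/ 2)).
  - rewrite Rabs_right by lra. exact C.
  - apply ex_series_lim_0. eexists. apply H. rewrite Rabs_right; lra.
Qed.

Lemma generating_function (d : nat -> nat -> Z) (hd : elongated_plane_partitions d) k :
  pmul (d k) (ppow euler_1 (3 * k + 1)) = ppow euler_2 k.
Proof.
  assert (F1 : euler_1 = iprod (poch_factor 1)) by (symmetry; apply (iprod_progression 1 1); lia).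
  assert (F2 : euler_2 = iprod (poch_factor 2)) by (symmetry; apply (iprod_progression 2 2); lia).
  apply evals_ext_small. intros q Hq. exists (qpoch (q ^ 2) (q ^ 2) ^ k).
  destruct (evals_qpoch 1 ltac:(lia) q Hq) as [H1 N1].
  destruct (evals_qpoch 2 ltac:(lia) q Hq) as [H2 _].
  rewrite <- F1 in H1. rewrite <- F2 in H2. rewrite pow_1 in H1, N1.
  split; [|now apply evals_pow].
  assert (Hd : evals q (d k) (qpoch (q ^ 2) (q ^ 2) ^ k / qpoch q q ^ (3 * k + 1))).
  { apply (evals_ps (d k) (fun q => qpoch (q ^ 2) (q ^ 2) ^ k / qpoch q q ^ (3 * k + 1))); [|lra].
    exact (hd k). }
  replace (qpoch (q ^ 2) (q ^ 2) ^ k) with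
    (qpoch (q ^ 2) (q ^ 2) ^ k / qpoch q q ^ (3 * k + 1) * qpoch q q ^ (3 * k + 1)).
  - apply evals_mul; [exact Hd|now apply evals_pow].
  - field. now apply pow_nonzero.
Qed.

Theorem theorem1p1 (d : nat -> nat -> Z) (hd : elongated_plane_partitions d)
  (n alpha : nat) (hn : (1 <= n)%nat) (halpha : (1 <= alpha)%nat)
  (hcong : eqm (5 ^ Z.of_nat alpha) (4 * Z.of_nat n) 1) :
  eqm (5 ^ (Z.of_nat alpha / 2 + 1)) (d 5%nat n) 0.
Proof.
  assert (P : forall e, (0 <= e)%Z -> (5 ^ e <> 0)%Z) by (intros; apply Z.pow_nonzero; lia).
  unfold eqm in *. rewrite Z.mod_0_l by (apply P; lia).
  apply Z.mod_divide; [apply P; lia|].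
  apply (coef_congruence (d 5%nat)); auto.
  - exact (generating_function d hd 5).
  - apply Z.mod_divide; [apply P; lia|].
    rewrite Zminus_mod, hcong, <- Zminus_mod. reflexivity.
Qed.
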